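(* Let $\Pi$ be a finite invertible automaton that is nuclear and smooth, let $L(\Pi)$ be its limit space with its shift self-covering $f$, and let $\Pi(L(\Pi))$ denote the automaton constructed from the space $|L(\Pi)|$ and its self-covering $|f|$ (as described in the context, from a choice of data $x,(\ell_y),Q$). Then $\Pi$ is equivalent to $\Pi(L(\Pi))$ (whatever data are used to construct the latter). More precisely, the data $x,(\ell_y),Q$ may be chosen so that $\Pi(L(\Pi))=\Pi$, i.e. so that there are bijections between the alphabets and between the state sets of the two automata that carry the output and transition functions of one to those of the other.
   Context: Automata. An automaton $\Pi$ consists of sets $A$ (alphabet) and $Q$ (states) and maps $\sigma:A\times Q\to A$ (output), $\tau:A\times Q\to Q$ (transition). It is finite if $A,Q$ are finite, and invertible if $\sigma(\cdot,q)$ is a permutation of $A$ for every $q$. $A^*=\bigsqcup_{n\ge 0}A^n$ is viewed as a rooted tree. A state $q$ induces $\Pi_q:A^*\to A^*$ by $\Pi_q(a_1a_2\dots a_n)=\sigma(a_1,q)\,\Pi_{\tau(a_1,q)}(a_2\dots a_n)$; if $\Pi$ is invertible, $\langle\Pi\rangle\le\mathrm{Aut}(A^* )$ is the group generated by all $\Pi_q$. For $g\in\langle\Pi\rangle$ and $v\in A^*$ put $\sigma(v,g)=g(v)$ and let $\tau(v,g)\in\langle\Pi\rangle$ be defined by $g(vw)=\sigma(v,g)\,\tau(v,g)(w)$ for all $w\in A^*$. $\mathbb N=\{1,2,\dots\}$ and $-\mathbb N=\{\dots,-2,-1\}$. $\Pi$ is contracting if there is a finite set $N\subset\langle\Pi\rangle$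 such that for every $g\in\langle\Pi\rangle$ there is $n$ with $\tau(A^n,g)\subset N$; its nucleus is $\bigcup_{g\in\langle\Pi\rangle}\bigcap_{n_0\ge 0}\bigcup_{n\ge n_0}\tau(A^n,g)$. $\Pi$ is nuclear if it is contracting and its set of states $Q$ is its nucleus (via $q\mapsto\Pi_q$, a bijection from $Q$ onto the nucleus); $Q$ then contains the identity state $\varepsilon$. $\Pi$ is smooth if $\tau:A\times Q\to Q$ is surjective and the directed graph with vertex set $A$ and an edge from $a$ to $b$ for every $q\in Q$ with $\sigma(a,q)=b$ and $\tau(a,q)=\varepsilon$ is strongly connected. Groupoids. A topological groupoid $(G,X,s,t)$ has a space of objects $X$, a space of arrows $G$, continuous source and target $s,t:G\to X$, continuous multiplication $gg'$ defined when $t(g)=s(g')$ (so $s(gg')=s(g)$, $t(gg')=t(g')$), inverses and units. Its geometric realization $|G|$ is the geometric realization of its nerve: $|G|=\coprod_{n\ge 0}G_n\times\Delta^n/\sim$ (usual face and degeneracy identifications), where $G_n$ is the space of composable sequences of $n$ arrows. A morphism $\phi$ of groupoids induces a continuous map $|\phi|$ of geometric realizations. Limit space. $L(\Pi)$ is the groupoid with objects $A^{-\mathbb N}$ and arrows $\{(\alpha,\phi)\in A^{-\mathbb N}\times\langle\Pi\rangle^{-\mathbb N}:\phi(n+1)=\tau(\alpha(n),\phi(n))\ \forall n<-1,\ \phi(-\mathbb N)\text{ finite}\}$, with $s(\alpha,\phi)=\alpha$ and $t(\alpha,\phi)(n)=\sigma(\alpha(n),\phi(n))$; $(\alpha,\phi)(\beta,\psi)$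 is $(\alpha,n\mapsto \psi(n)\circ\phi(n))$. $A$ and $\langle\Pi\rangle$ are discrete, objects and arrows carry the product (resp. subspace of product) topology. The shift $f(\alpha,\phi)(n)=(\alpha(n-1),\phi(n-1))$ is a $\#A$-to-$1$ self-covering of $L(\Pi)$, inducing a $\#A$-to-$1$ covering map $|f|:|L(\Pi)|\to|L(\Pi)|$. Under the hypotheses of the claim $|L(\Pi)|$ is arcwise connected. The automaton $\Pi(X)$. Let $X$ be an arcwise connected space with a $d$-to-$1$ covering map $f:X\to X$. Choose a base point $x\in X$ and for each $y\in f^{-1}(x)$ a path $\ell_y$ from $x$ to $y$. Products of paths are read left to right. Let $K\triangleleft\pi_1(X,x)$ be the subgroup of loops inducing, by monodromy (lifting through $f^n$), the identity permutation of $f^{-n}(x)$ for all $n\in\mathbb N$. Choose $Q\subset\pi_1(X,x)$ generating $\pi_1(X,x)/K$ and such that for all $a\in f^{-1}(x)$, $q\in Q$, with $\gamma$ the $f$-lift of $q$ with $\gamma(0)=a$, one has $\ell_a\gamma\ell_{\gamma(1)}^{-1}K\cap Q\ne\emptyset$. $\Pi(X)$ is the automaton with alphabet $f^{-1}(x)$, states $Q$, $\sigma(a,q)=\gamma(1)$, and $\tau(a,q)$ an element of $Q$ congruent to $\ell_a\gamma\ell_{\gamma(1)}^{-1}$ modulo $K$. For a groupoid $L$ with self-covering, $\Pi(L)$ means $\Pi(|L|)$ (with the induced self-covering). Equivalence. Allow automata with input alphabet $A$ and output alphabet $A'$ of the same cardinality: states $R$, $\tau:A\times R\to R$, $\sigma:A\times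 R\to A'$; with an initial state such an automaton defines a tree homomorphism $A^*\to(A')^*$. The states of a tree isomorphism $\phi:A^*\to (A')^*$ are the maps $\phi'$ for which there are words $v\in A^*$, $v'\in (A')^*$ with $\phi(vw)=v'\phi'(w)$ for all $w\in A^*$ (where $|v'|=|v|$). Automata $\Pi,\Pi'$ on alphabets $A,A'$ are equivalent if $\#A=\#A'$ and there is a tree isomorphism $\phi:A^*\to(A')^*$ given by a finite automaton, all of whose states are of the form $\phi g$ with $g\in\langle\Pi\rangle$, such that $\phi\langle\Pi\rangle\phi^{-1}=\langle\Pi'\rangle$. *)

(* Defs.v *)
From HB Require Import structures.
From Stdlib Require Import Relations.
From mathcomp Require Import all_boot all_order all_algebra.
From mathcomp Require Import all_classical all_reals topology normedtype.
From mathcomp Require Import generic_quotient.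
From mathcomp Require Import zify lra.

Set Implicit Arguments.
Unset Strict Implicit.
Unset Printing Implicit Defensive.

Import Order.TTheory GRing.Theory Num.Theory.
Import numFieldNormedType.Exports.

Local Open Scope classical_set_scope.
Local Open Scope quotient_scope.
Local Open Scope ring_scope.

Record transducer (A A' Q : Type) := Transducer {
  out : A -> Q -> A';
  trans : A -> Q -> Q
}.

Notation automaton A Q := (transducer A A Q).

Fixpoint run (A A' Q : Type) (P : transducer A A' Q) (q : Q) (w : seq A) :
    seq A' :=
  if w is a :: w' then out P a q :: run P (trans P a q) w' else [::].

(* For a tree endomorphism g, this is tau(v, g): g (v ++ w) = g v ++ sect g v w. *)
Definition sect (A A' : Type) (g : seq A -> seq A') (v w : seq A) : seq A' :=
  drop (size v) (g (v ++ w)).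

Section Automata.
Variables (A Q : Type) (P : automaton A Q).

Definition invertible := forall q, bijective (out P ^~ q).

(* The subgroup <P> of Aut(A^* ) generated by the maps run P q. *)
Inductive autgroup : set (seq A -> seq A) :=
| autgroup1 : autgroup id
| autgroup_gen q : autgroup (run P q)
| autgroupM g h : autgroup g -> autgroup h -> autgroup (g \o h)
| autgroupV g h : autgroup g -> cancel g h -> cancel h g -> autgroup h.

(* tau(A^n, g) *)
Definition level_sects (n : nat) (g : seq A -> seq A) : set (seq A -> seq A) :=
  [set sect g v | v in [set v | size v = n]].

Definition contracting :=
  exists N : set (seq A -> seq A),
    [/\ finite_set N, N `<=` autgroup
      & forall g, autgroup g -> exists n, level_sects n g `<=` N].

Definition nucleus : set (seq A -> seq A) :=
  \bigcup_(g in autgroup) \bigcap_(n0 in [set: nat])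
    \bigcup_(n in [set n | (n0 <= n)%N]) level_sects n g.

Definition nuclear := contracting /\ set_bij [set: Q] nucleus (run P).

Definition eps_edge (eps : Q) (a b : A) : Prop :=
  exists q, out P a q = b /\ trans P a q = eps.

(* The identity state is required to exist; for a nuclear automaton this only
   excludes the empty one. *)
Definition smooth :=
  (forall q', exists a q, trans P a q = q') /\
  exists eps : Q, run P eps = id /\
    forall a b, clos_refl_trans A (eps_edge eps) a b.

End Automata.

Definition automaton_iso (A Q A' Q' : Type)
    (P : automaton A Q) (P' : automaton A' Q') : Prop :=
  exists (u : A -> A') (v : Q -> Q'), [/\ bijective u, bijective v
    & forall a q, out P' (u a) (v q) = u (out P a q) /\
                  trans P' (u a) (v q) = v (trans P a q)].

Section Equivalence.
Variables (A A' : Type).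

Definition tree_hom (phi : seq A -> seq A') : Prop :=
  (forall w, size (phi w) = size w) /\
  (forall n w, phi (take n w) = take n (phi w)).

Definition finite_state (phi : seq A -> seq A') : Prop :=
  exists (S : finType) (T : transducer A A' S) (s : S), phi = run T s.

Definition is_state_of (phi psi : seq A -> seq A') : Prop :=
  exists (v : seq A) (v' : seq A'),
    size v' = size v /\ forall w, phi (v ++ w) = v' ++ psi w.

Definition automaton_equiv (Q Q' : Type)
    (P : automaton A Q) (P' : automaton A' Q') : Prop :=
  ([set: A] #= [set: A'])%card /\
  exists (phi : seq A -> seq A') (phi' : seq A' -> seq A),
    [/\ cancel phi phi', cancel phi' phi, tree_hom phi, finite_state phi &
        (forall psi, is_state_of phi psi ->
           exists2 g, autgroup P g & psi = phi \o g) /\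
        [set phi \o g \o phi' | g in autgroup P] = autgroup P'].

End Equivalence.

(* gmul g h is the product "g then h"; it is meaningful only when
   gtgt g = gsrc h. *)
Record topGroupoid := TopGroupoid {
  gobj : topologicalType;
  garr : topologicalType;
  gsrc : garr -> gobj;
  gtgt : garr -> gobj;
  gid : gobj -> garr;
  ginv : garr -> garr;
  gmul : garr -> garr -> garr;
  gsrc_id : forall x, gsrc (gid x) = x;
  gtgt_id : forall x, gtgt (gid x) = x;
  gsrc_inv : forall g, gsrc (ginv g) = gtgt g;
  gtgt_inv : forall g, gtgt (ginv g) = gsrc g;
  gsrc_mul : forall g h, gtgt g = gsrc h -> gsrc (gmul g h) = gsrc g;
  gtgt_mul : forall g h, gtgt g = gsrc h -> gtgt (gmul g h) = gtgt h;
  gmulA : forall g h k, gtgt g = gsrc h -> gtgt h = gsrc k ->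
    gmul g (gmul h k) = gmul (gmul g h) k;
  gmul1g : forall g, gmul (gid (gsrc g)) g = g;
  gmulg1 : forall g, gmul g (gid (gtgt g)) = g;
  gmulVg : forall g, gmul (ginv g) g = gid (gtgt g);
  gmulgV : forall g, gmul g (ginv g) = gid (gsrc g);
  gsrc_continuous : continuous gsrc;
  gtgt_continuous : continuous gtgt;
  gid_continuous : continuous gid;
  ginv_continuous : continuous ginv;
  gmul_continuous :
    {within [set gh | gtgt gh.1 = gsrc gh.2],
      continuous (fun gh => gmul gh.1 gh.2)}
}.

Record gmorphism (G H : topGroupoid) := GMorphism {
  mobj : gobj G -> gobj H;
  marr : garr G -> garr H;
  m_src : forall g, gsrc (marr g) = mobj (gsrc g);
  m_tgt : forall g, gtgt (marr g) = mobj (gtgt g);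
  m_id : forall x, marr (gid x) = gid (mobj x);
  m_mul : forall g h, gtgt g = gsrc h ->
    marr (gmul g h) = gmul (marr g) (marr h);
  mobj_continuous : continuous mobj;
  marr_continuous : continuous marr
}.

(* The degeneracy [n+1] -> [n] hitting i twice; the face map [n] -> [n+1]
   missing i is [lift i]. *)
Definition codeg n (i : 'I_n.+1) (j : 'I_n.+2) : 'I_n.+1 :=
  odflt i (unlift (lift ord0 i) j).

Definition inl_ord n (i : 'I_n) : 'I_n.+1 := widen_ord (leqnSn n) i.

Definition simplex (R : realType) (n : nat) : topologicalType :=
  set_type [set t : {ptws 'I_n.+1 -> R} |
             (forall i, 0 <= t i) /\ \sum_i t i = 1].

Definition push_fun (R : realType) m n (th : 'I_m.+1 -> 'I_n.+1)
    (t : 'I_m.+1 -> R) : 'I_n.+1 -> R :=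
  fun k => \sum_(j | th j == k) t j.

Lemma push_subproof (R : realType) m n (th : 'I_m.+1 -> 'I_n.+1)
    (t : simplex R m) :
  push_fun th (val t) \in [set t : {ptws 'I_n.+1 -> R} |
             (forall i, 0 <= t i) /\ \sum_i t i = 1].
Proof.
case: t => t /= /set_mem[/= t0 t1]; apply/mem_set; split => /=.
  by move=> i; apply: sumr_ge0.
by rewrite -t1 (partition_big th predT).
Qed.

(* The affine map of simplices induced by a map of vertices. *)
Definition push (R : realType) m n (th : 'I_m.+1 -> 'I_n.+1)
    (t : simplex R m) : simplex R n :=
  SigSub (push_subproof th t).

Section Nerve.
Variable G : topGroupoid.

(* A composable sequence x_0 -> x_1 -> ... -> x_n of n arrows, recorded with
   its n+1 vertices: for n = 0 this is an object, and for n > 0 the vertices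
   are continuous functions of the arrows. *)
Definition is_chain n :
    set ({ptws 'I_n.+1 -> gobj G} * {ptws 'I_n -> garr G})%type :=
  [set c | forall i : 'I_n, gsrc (c.2 i) = c.1 (inl_ord i) /\
                            gtgt (c.2 i) = c.1 (lift ord0 i)].

Definition chain n : topologicalType := set_type (is_chain (n := n)).

Definition face_arr n (i : 'I_n.+2) (g : 'I_n.+1 -> garr G) (j : 'I_n) :
    garr G :=
  if j.+1 == i then gmul (g (inl_ord j)) (g (lift ord0 j))
  else if (j.+1 < i)%N then g (inl_ord j) else g (lift ord0 j).

Lemma face_subproof n (i : 'I_n.+2) (c : chain n.+1) :
  ((fun j => (val c).1 (lift i j)), face_arr i (val c).2) \in is_chain (n := n).
Proof.
case: c => -[v g] /= /set_mem /= cP; apply/mem_set => j /=.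
have [sl tl] := cP (inl_ord j); have [sr tr] := cP (lift ord0 j).
move: (ltn_ord j) (ltn_ord i) => jn ni.
have E1 : lift ord0 (inl_ord j) = inl_ord (lift ord0 j) by exact: val_inj.
rewrite /face_arr; case: eqP => [ji|ji].
  have comp : gtgt (g (inl_ord j)) = gsrc (g (lift ord0 j)) by rewrite tl sr E1.
  rewrite gsrc_mul// gtgt_mul// sl tr; split; congr (v _); apply: val_inj => /=;
    rewrite /bump /=; lia.
case: ifP => [lt|/negbT lt].
  rewrite sl tl; split; congr (v _); apply: val_inj => /=;
    rewrite /bump /=; lia.
rewrite sr tr; split; congr (v _); apply: val_inj => /=; rewrite /bump /=; lia.
Qed.

Definition face n (i : 'I_n.+2) (c : chain n.+1) : chain n :=
  SigSub (face_subproof i c).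

Definition degen_arr n (i : 'I_n.+1)
    (v : 'I_n.+1 -> gobj G) (g : 'I_n -> garr G) (j : 'I_n.+1) : garr G :=
  if unlift i j is Some k then g k else gid (v i).

Lemma val_codeg n (i : 'I_n.+1) (j : 'I_n.+2) :
  codeg i j = (j - (i < j))%N :> nat.
Proof.
rewrite /codeg; case: unliftP => [k ->|->] /=; rewrite /bump /=; lia.
Qed.

Lemma degen_subproof n (i : 'I_n.+1) (c : chain n) :
  ((fun j => (val c).1 (codeg i j)), degen_arr i (val c).1 (val c).2)
    \in is_chain (n := n.+1).
Proof.
case: c => -[v g] /= /set_mem /= cP; apply/mem_set => j /=.
rewrite /degen_arr; case: unliftP => [k ->|->].
  have [-> ->] := cP k; split; congr (v _); apply: ord_inj; rewrite val_codeg /=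
    /bump /=; lia.
rewrite gsrc_id gtgt_id; split; congr (v _); apply: ord_inj; rewrite val_codeg /=
    /bump /=; lia.
Qed.

Definition degen n (i : 'I_n.+1) (c : chain n) : chain n.+1 :=
  SigSub (degen_subproof i c).

Variable R : realType.

Definition presimplices : topologicalType :=
  {n : nat & (chain n * simplex R n)%type}.

Definition cell n (c : chain n) (t : simplex R n) : presimplices :=
  existT (fun n => (chain n * simplex R n)%type) n (c, t).

Inductive glue : presimplices -> presimplices -> Prop :=
| glue_face n (i : 'I_n.+2) (c : chain n.+1) (t : simplex R n) :
    glue (cell (face i c) t) (cell c (push (lift i) t))
| glue_degen n (i : 'I_n.+1) (c : chain n) (t : simplex R n.+1) :
    glue (cell (degen i c) t) (cell c (push (codeg i) t)).

Definition glue_rel : rel presimplices :=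
  fun a b => `[< clos_refl_sym_trans presimplices glue a b >].

Lemma glue_rel_refl : reflexive glue_rel.
Proof. by move=> a; apply/asboolP; exact: rst_refl. Qed.

Lemma glue_rel_sym : symmetric glue_rel.
Proof. by move=> a b; apply/asboolP/asboolP; exact: rst_sym. Qed.

Lemma glue_rel_trans : transitive glue_rel.
Proof. by move=> a b c /asboolP ba /asboolP ac; apply/asboolP/(rst_trans _ _ _ a). Qed.

Canonical glue_equiv :=
  EquivRel glue_rel glue_rel_refl glue_rel_sym glue_rel_trans.

Definition realization : topologicalType :=
  quotient_topology {eq_quot glue_equiv}.

Definition to_realization (a : presimplices) : realization :=
  \pi_({eq_quot glue_equiv}) a.

Definition of_realization (z : realization) : presimplices :=
  repr (z : {eq_quot glue_equiv}).

End Nerve.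

Section RealizationMap.
Variables (R : realType) (G H : topGroupoid) (F : gmorphism G H).

Lemma chain_map_subproof n (c : chain G n) :
  ((fun j => mobj F ((val c).1 j)), (fun j => marr F ((val c).2 j)))
    \in is_chain (G := H) (n := n).
Proof.
case: c => -[v g] /= /set_mem /= cP; apply/mem_set => j /=.
by rewrite m_src m_tgt; have [-> ->] := cP j.
Qed.

Definition chain_map n (c : chain G n) : chain H n :=
  SigSub (chain_map_subproof c).

Definition presimplices_map (a : presimplices G R) : presimplices H R :=
  cell (chain_map (projT2 a).1) (projT2 a).2.

Definition realization_map (z : realization G R) : realization H R :=
  to_realization (presimplices_map (of_realization z)).

End RealizationMap.

Lemma tree_hom_comp (A B C : Type) (g : seq B -> seq C) (h : seq A -> seq B) :
  tree_hom g -> tree_hom h -> tree_hom (g \o h).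
Proof.
move=> [gs gt] [hs ht]; split=> [w|n w] /=; first by rewrite gs hs.
by rewrite ht gt.
Qed.

Lemma tree_hom_run (A A' Q : Type) (P : transducer A A' Q) q :
  tree_hom (run P q).
Proof.
split=> [w|n w]; first by elim: w q => //= a w IH q; rewrite IH.
by elim: w n q => [|a w IH] [|n] q //=; rewrite IH.
Qed.

Lemma tree_hom_inv (A A' : Type) (g : seq A -> seq A') h :
  cancel g h -> cancel h g -> tree_hom g -> tree_hom h.
Proof.
move=> gK hK [gs gt]; split=> [w|n w]; first by rewrite -gs hK.
by rewrite -{1}[w]hK -gt gK.
Qed.

Lemma tree_hom_cat (A A' : Type) (g : seq A -> seq A') v w :
  tree_hom g -> g (v ++ w) = g v ++ sect g v w.
Proof.
move=> [gs gt]; rewrite /sect -{1}(cat_take_drop (size v) (g (v ++ w))) -gt.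
by rewrite take_size_cat.
Qed.

Lemma autgroup_tree_hom (A Q : Type) (P : automaton A Q) g :
  autgroup P g -> tree_hom g.
Proof.
elim=> {g} [|q|g h _ gP _ hP|g h _ gP gK hK].
- by split.
- exact: tree_hom_run.
- exact: tree_hom_comp.
- exact: tree_hom_inv gP.
Qed.

Lemma autgroup_bij (A Q : Type) (P : automaton A Q) g :
  invertible P -> autgroup P g -> bijective g.
Proof.
move=> Pinv; elim=> {g} [|q|g h _ gP _ hP|g h _ gP gK hK].
- by exists id.
- rewrite -setTT_bijective; split=> //.
    move=> v w _ _; elim: v w q => [|a v IH] [|b w] q //= [].
    by move=> /(bij_inj (Pinv q)) <- /IH <-.
  move=> w _; elim: w q => [|b w IH] q; first by exists [::].
  have [f fK Kf] := Pinv q; have [v _ vw] := IH (trans P (f b) q).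
  by exists (f b :: v) => //=; rewrite vw Kf.
- exact: bij_comp.
- by exists g.
Qed.

Definition letter (A : Type) (g : seq A -> seq A) (a : A) : A :=
  head a (g [:: a]).

Lemma letterE (A : Type) (g : seq A -> seq A) a :
  tree_hom g -> g [:: a] = [:: letter g a].
Proof. by case=> /(_ [:: a]) /=; rewrite /letter; case: (g [:: a]) => [|b []]. Qed.

Lemma letter_comp (A : Type) (g h : seq A -> seq A) a :
  tree_hom g -> tree_hom h -> letter (h \o g) a = letter h (letter g a).
Proof.
move=> gP hP; rewrite {1}/letter /= (letterE _ gP).
by rewrite (letterE _ hP).
Qed.

Lemma sect_comp (A : Type) (g h : seq A -> seq A) a :
  tree_hom g -> tree_hom h ->
  sect (h \o g) [:: a] = sect h [:: letter g a] \o sect g [:: a].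
Proof.
move=> gP hP; apply/funext => w; rewrite {1}/sect /=.
by rewrite -[a :: w]/([:: a] ++ w) (tree_hom_cat _ _ gP) (letterE _ gP).
Qed.

Lemma cvg_ptws (I T : Type) (K : topologicalType) (F : set_system T)
    (f : T -> {ptws I -> K}) (l : {ptws I -> K}) :
  Filter F -> (forall i, (fun t => f t i) @ F --> l i) -> f @ F --> l.
Proof.
move=> FF H; apply/cvg_sup => i B /= [_ [[C oC <-] Cf] sCB].
by apply: (filterS sCB); apply: H; exact: open_nbhs_nbhs.
Qed.

Lemma cvg_set_type (T : Type) (X : topologicalType) (Y : set X)
    (F : set_system T) (f : T -> Y) (l : Y) :
  Filter F -> (fun t => val (f t)) @ F --> val l -> f @ F --> l.
Proof.
move=> FF H B /= [_ [[C oC <-] Cf] sCB].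
by apply: (filterS sCB); apply: H; exact: open_nbhs_nbhs.
Qed.

Section LimitSpace.
Variables (A : choiceType) (Q : Type) (P : automaton A Q).

(* The coordinate indexed by k : nat is the one at position -(k+1). *)
Definition lim_obj : topologicalType := {ptws nat -> discrete_topology A}.

Definition autgroup_type : topologicalType :=
  discrete_topology (set_type (autgroup P)).

Definition autgroup_fun (g : autgroup_type) : seq A -> seq A :=
  val (g : set_type (autgroup P)).

Definition is_lim_arr : set (lim_obj * {ptws nat -> autgroup_type})%type :=
  [set x | (forall k, autgroup_fun (x.2 k) =
                      sect (autgroup_fun (x.2 k.+1)) [:: x.1 k.+1]) /\
           finite_set (range x.2)].

Definition lim_arr : topologicalType := set_type is_lim_arr.

Definition lim_src (x : lim_arr) : lim_obj := (val x).1.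
Definition lim_tgt (x : lim_arr) : lim_obj :=
  fun k => letter (autgroup_fun ((val x).2 k)) ((val x).1 k).

Lemma autgroup_funP (g : autgroup_type) : autgroup P (autgroup_fun g).
Proof. exact: set_mem (valP (g : set_type (autgroup P))). Qed.

Lemma autgroup_fun_inj : injective autgroup_fun.
Proof. exact: val_inj. Qed.

Let th (g : autgroup_type) : tree_hom (autgroup_fun g).
Proof. exact: autgroup_tree_hom (autgroup_funP g). Qed.

Definition ag_one : autgroup_type :=
  exist (fun g => g \in autgroup P) id (mem_set (autgroup1 P)).

Definition ag_comp (g h : autgroup_type) : autgroup_type :=
  exist (fun g => g \in autgroup P) (autgroup_fun g \o autgroup_fun h)
    (mem_set (autgroupM (autgroup_funP g) (autgroup_funP h))).

Lemma lim_id_subproof (al : lim_obj) : (al, fun _ => ag_one) \in is_lim_arr.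
Proof.
apply/mem_set; split=> [k|] /=.
  by apply/funext => w; rewrite /sect /= drop0.
by apply: sub_finite_set (finite_set1 ag_one) => _ [k _ <-].
Qed.

Definition lim_id (al : lim_obj) : lim_arr := SigSub (lim_id_subproof al).

Lemma lim_mul_subproof (x y : lim_arr) : lim_tgt x = lim_src y ->
  ((val x).1, fun k => ag_comp ((val y).2 k) ((val x).2 k)) \in is_lim_arr.
Proof.
move=> xy; have [phiP phif] := set_mem (valP x).
have [psiP psif] := set_mem (valP y).
apply/mem_set; split=> /= [k|].
  rewrite {1}/autgroup_fun /= -/(autgroup_fun _) -/(autgroup_fun _).
  rewrite (sect_comp _ (th _) (th _)) phiP psiP.
  by rewrite -[(val y).1 k.+1]/(lim_src y k.+1) -xy.
apply: sub_finite_set (finite_image2 ag_comp psif phif).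
move=> _ [k _ <-]; exists ((val y).2 k); first by exists k.
by exists ((val x).2 k) => //; exists k.
Qed.

Definition lim_mul (x y : lim_arr) : lim_arr :=
  if pselect (lim_tgt x = lim_src y) is left xy
  then SigSub (lim_mul_subproof xy) else x.

Hypothesis Pinv : invertible P.

Lemma ag_inv_ex (g : autgroup_type) : exists h : autgroup_type,
  cancel (autgroup_fun g) (autgroup_fun h) /\
  cancel (autgroup_fun h) (autgroup_fun g).
Proof.
have [h gK hK] := autgroup_bij Pinv (autgroup_funP g).
by exists (exist (fun g => g \in autgroup P) h
  (mem_set (autgroupV (autgroup_funP g) gK hK))).
Qed.

Definition ag_inv (g : autgroup_type) : autgroup_type := projT1 (cid (ag_inv_ex g)).

Lemma ag_invK g : cancel (autgroup_fun g) (autgroup_fun (ag_inv g)).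
Proof. by rewrite /ag_inv; case: cid => h []. Qed.

Lemma ag_invKV g : cancel (autgroup_fun (ag_inv g)) (autgroup_fun g).
Proof. by rewrite /ag_inv; case: cid => h []. Qed.

Lemma ag_compV g : ag_comp (ag_inv g) g = ag_one.
Proof. by apply: autgroup_fun_inj; apply/funext; exact: ag_invK. Qed.

Lemma ag_compVr g : ag_comp g (ag_inv g) = ag_one.
Proof. by apply: autgroup_fun_inj; apply/funext; exact: ag_invKV. Qed.

Lemma letterK g a : letter (autgroup_fun (ag_inv g)) (letter (autgroup_fun g) a) = a.
Proof.
rewrite -letter_comp; try exact: th.
by rewrite /letter /= ag_invK.
Qed.

Lemma lim_inv_subproof (x : lim_arr) :
  (lim_tgt x, fun k => ag_inv ((val x).2 k)) \in is_lim_arr.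
Proof.
have [phiP phif] := set_mem (valP x).
apply/mem_set; split=> /= [k|].
  rewrite /lim_tgt /=; set phi := (val x).2; set g := phi k.+1; set a := (val x).1 k.+1.
  have E : sect (autgroup_fun (ag_inv g)) [:: letter (autgroup_fun g) a] \o
           sect (autgroup_fun g) [:: a] = id.
    rewrite -sect_comp; try exact: th.
    by apply/funext => w; rewrite /sect /= ag_invK /= drop0.
  rewrite -phiP in E; apply/funext => w.
  by rewrite -{2}(ag_invKV (phi k) w); have := congr1 (@^~ (autgroup_fun (ag_inv (phi k)) w)) E => /= ->.
apply: sub_finite_set (finite_image ag_inv phif).
by move=> _ [k _ <-]; exists ((val x).2 k) => //; exists k.
Qed.

Definition lim_inv (x : lim_arr) : lim_arr := SigSub (lim_inv_subproof x).

Lemma lim_arr_eq (x y : lim_arr) :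
  lim_src x = lim_src y -> (val x).2 = (val y).2 -> x = y.
Proof.
by move=> e1 e2; apply: val_inj; rewrite (surjective_pairing (val x)) e2;
  rewrite -/(lim_src x) e1 -surjective_pairing.
Qed.

Lemma val_lim_mul x y : lim_tgt x = lim_src y ->
  val (lim_mul x y) = ((val x).1, fun k => ag_comp ((val y).2 k) ((val x).2 k)).
Proof. by rewrite /lim_mul; case: pselect. Qed.

Lemma lim_src_id al : lim_src (lim_id al) = al. Proof. by []. Qed.

Lemma lim_tgt_id al : lim_tgt (lim_id al) = al. Proof. by []. Qed.

Lemma lim_src_inv x : lim_src (lim_inv x) = lim_tgt x. Proof. by []. Qed.

Lemma lim_tgt_inv x : lim_tgt (lim_inv x) = lim_src x.
Proof. by apply/funext => k; exact: letterK. Qed.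

Lemma lim_src_mul x y : lim_tgt x = lim_src y -> lim_src (lim_mul x y) = lim_src x.
Proof. by move=> xy; rewrite {1}/lim_src val_lim_mul. Qed.

Lemma lim_tgt_mul x y : lim_tgt x = lim_src y -> lim_tgt (lim_mul x y) = lim_tgt y.
Proof.
move=> xy; apply/funext => k; rewrite {1}/lim_tgt val_lim_mul//=.
rewrite [autgroup_fun _]/(autgroup_fun _ \o autgroup_fun _).
rewrite letter_comp; try exact: th.
by rewrite -[letter (autgroup_fun ((val x).2 k)) _]/(lim_tgt x k) xy.
Qed.

Lemma lim_mulA x y z : lim_tgt x = lim_src y -> lim_tgt y = lim_src z ->
  lim_mul x (lim_mul y z) = lim_mul (lim_mul x y) z.
Proof.
move=> xy yz.
have xyz : lim_tgt x = lim_src (lim_mul y z) by rewrite lim_src_mul.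
have xyz' : lim_tgt (lim_mul x y) = lim_src z by rewrite lim_tgt_mul.
by apply: val_inj; rewrite !val_lim_mul//=; congr pair; apply/funext => k;
  exact: autgroup_fun_inj.
Qed.

Lemma lim_mul1g x : lim_mul (lim_id (lim_src x)) x = x.
Proof.
apply: lim_arr_eq; rewrite ?lim_src_mul// val_lim_mul//=; apply/funext => k.
exact: autgroup_fun_inj.
Qed.

Lemma lim_mulg1 x : lim_mul x (lim_id (lim_tgt x)) = x.
Proof.
apply: lim_arr_eq; rewrite ?lim_src_mul// val_lim_mul//=; apply/funext => k.
exact: autgroup_fun_inj.
Qed.

Lemma lim_mulVg x : lim_mul (lim_inv x) x = lim_id (lim_tgt x).
Proof.
have e := lim_tgt_inv x.
apply: lim_arr_eq; rewrite ?lim_src_mul// val_lim_mul//=; apply/funext => k.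
exact: ag_compVr.
Qed.

Lemma lim_mulgV x : lim_mul x (lim_inv x) = lim_id (lim_src x).
Proof.
apply: lim_arr_eq; rewrite ?lim_src_mul// val_lim_mul//=; apply/funext => k.
exact: ag_compV.
Qed.

Lemma near_arr (x : lim_arr) k : \forall y \near x,
  (val y).1 k = (val x).1 k /\ (val y).2 k = (val x).2 k.
Proof.
have c1 : continuous (fun y : lim_arr => (val y).1 k : discrete_topology A).
  move=> y; apply: (@continuous_comp _ _ _ (fun y : lim_arr => (val y).1) (@^~ k)).
    apply: (@continuous_comp _ _ _ (fun y : lim_arr => val y) fst).
      exact: initial_continuous.
    exact: cvg_fst.
  exact: (@proj_continuous nat (fun=> discrete_topology A) k).
have c2 : continuous (fun y : lim_arr => (val y).2 k : autgroup_type).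
  move=> y; apply: (@continuous_comp _ _ _ (fun y : lim_arr => (val y).2) (@^~ k)).
    apply: (@continuous_comp _ _ _ (fun y : lim_arr => val y) snd).
      exact: initial_continuous.
    exact: cvg_snd.
  exact: (@proj_continuous nat (fun=> autgroup_type) k).
have n1 := c1 x _ (@discrete_set1 (discrete_topology A) ((val x).1 k)).
have n2 := c2 x _ (@discrete_set1 (discrete_topology (set_type (autgroup P))) ((val x).2 k)).
exact: (@filterI _ (nbhs x) _ _ _ n1 n2).
Qed.

Lemma cvg_lim_obj (T : Type) (F : set_system T) (f : T -> lim_obj) (l : lim_obj) :
  Filter F -> (forall k, \forall t \near F, f t k = l k) -> f @ F --> l.
Proof.
move=> FF H; apply: cvg_ptws => k.
by apply/(@discrete_cvg (discrete_topology A)); exact: H.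
Qed.

Lemma cvg_lim_arr (T : Type) (F : set_system T) (f : T -> lim_arr) (l : lim_arr) :
  Filter F ->
  (forall k, \forall t \near F, (val (f t)).1 k = (val l).1 k /\
                                (val (f t)).2 k = (val l).2 k) ->
  f @ F --> l.
Proof.
move=> FF H; apply: cvg_set_type.
have c1 : (fun t => (val (f t)).1) @ F --> (val l).1.
  by apply: cvg_lim_obj => k; apply: filterS (H k) => t [].
have c2 : (fun t => (val (f t)).2) @ F --> (val l).2.
  apply: cvg_ptws => k; apply/(@discrete_cvg (discrete_topology (set_type (autgroup P)))).
  by apply: filterS (H k) => t [].
rewrite (_ : (fun t => val (f t)) = (fun t => ((val (f t)).1, (val (f t)).2))).
  by rewrite (surjective_pairing (val l)); exact: (cvg_pair c1 c2).
by apply/funext => t; rewrite -surjective_pairing.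
Qed.

Lemma continuous_lim_obj (T : topologicalType) (f : T -> lim_obj) :
  (forall x k, \forall t \near x, f t k = f x k) -> continuous f.
Proof. by move=> H x; apply: (@cvg_lim_obj T (nbhs x)); exact: H. Qed.

Lemma continuous_lim_arr (T : topologicalType) (f : T -> lim_arr) :
  (forall x k, \forall t \near x, (val (f t)).1 k = (val (f x)).1 k /\
                                  (val (f t)).2 k = (val (f x)).2 k) ->
  continuous f.
Proof. by move=> H x; apply: (@cvg_lim_arr T (nbhs x)); exact: H. Qed.

Lemma near_obj (x : lim_obj) k : \forall y \near x, y k = x k.
Proof.
exact: (@proj_continuous nat (fun=> discrete_topology A) k x _
          (@discrete_set1 (discrete_topology A) (x k))).
Qed.

Lemma lim_src_continuous : continuous lim_src.
Proof.
by apply: continuous_lim_obj => x k; apply: (@filterS _ (nbhs x) _ _ _ _ (near_arr x k)) => y [].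
Qed.

Lemma lim_tgt_continuous : continuous lim_tgt.
Proof.
apply: continuous_lim_obj => x k.
apply: (@filterS _ (nbhs x) _ _ _ _ (near_arr x k)) => y [e1 e2].
by rewrite /lim_tgt e1 e2.
Qed.

Lemma lim_id_continuous : continuous lim_id.
Proof.
apply: continuous_lim_arr => x k.
by apply: (@filterS _ (nbhs x) _ _ _ _ (near_obj x k)) => y.
Qed.

Lemma lim_inv_continuous : continuous lim_inv.
Proof.
apply: continuous_lim_arr => x k.
apply: (@filterS _ (nbhs x) _ _ _ _ (near_arr x k)) => y [e1 e2] /=.
by rewrite /lim_tgt e1 e2.
Qed.

Lemma lim_mul_continuous :
  {within [set gh | lim_tgt gh.1 = lim_src gh.2],
    continuous (fun gh => lim_mul gh.1 gh.2)}.
Proof.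
apply/subspace_continuousP => -[g h] /= gh; apply: cvg_lim_arr => k.
rewrite near_withinE val_lim_mul//=.
exists ([set g' | (val g').1 k = (val g).1 k /\ (val g').2 k = (val g).2 k],
  [set h' | (val h').1 k = (val h).1 k /\ (val h').2 k = (val h).2 k]).
  by split; exact: near_arr.
move=> [g' h'] /= [[eg1 eg2] [eh1 eh2]] gh'.
by rewrite val_lim_mul//= eg1 eg2 eh2.
Qed.

Definition limit_groupoid : topGroupoid :=
  TopGroupoid lim_src_id lim_tgt_id lim_src_inv lim_tgt_inv lim_src_mul
    lim_tgt_mul lim_mulA lim_mul1g lim_mulg1 lim_mulVg lim_mulgV
    lim_src_continuous lim_tgt_continuous lim_id_continuous lim_inv_continuous
    lim_mul_continuous.

Definition shift_obj (al : lim_obj) : lim_obj := fun k => al k.+1.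

Lemma shift_subproof (x : lim_arr) :
  (shift_obj (val x).1, fun k => (val x).2 k.+1) \in is_lim_arr.
Proof.
have [xP xf] := set_mem (valP x); apply/mem_set; split=> [k|] /=.
  exact: xP.
by apply: sub_finite_set xf => _ [k _ <-]; exists k.+1.
Qed.

Definition shift_arr (x : lim_arr) : lim_arr := SigSub (shift_subproof x).

Lemma shift_src x : lim_src (shift_arr x) = shift_obj (lim_src x).
Proof. by []. Qed.

Lemma shift_tgt x : lim_tgt (shift_arr x) = shift_obj (lim_tgt x).
Proof. by []. Qed.

Lemma shift_id al : shift_arr (lim_id al) = lim_id (shift_obj al).
Proof. exact: val_inj. Qed.

Lemma shift_mul x y : lim_tgt x = lim_src y ->
  shift_arr (lim_mul x y) = lim_mul (shift_arr x) (shift_arr y).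
Proof.
move=> xy; apply: val_inj.
have sxy : lim_tgt (shift_arr x) = lim_src (shift_arr y).
  by rewrite shift_tgt xy.
by rewrite [RHS]val_lim_mul//= val_lim_mul.
Qed.

Lemma shift_obj_continuous : continuous shift_obj.
Proof. by apply: continuous_lim_obj => x k; exact: near_obj. Qed.

Lemma shift_arr_continuous : continuous shift_arr.
Proof. by apply: continuous_lim_arr => x k; exact: near_arr. Qed.

Definition limit_shift : gmorphism limit_groupoid limit_groupoid :=
  @GMorphism limit_groupoid limit_groupoid shift_obj shift_arr
    shift_src shift_tgt shift_id shift_mul shift_obj_continuous
    shift_arr_continuous.

End LimitSpace.
Lemma within_comp (S T U : topologicalType) (A : set S) (B : set T)
    (g : S -> T) (f : T -> U) :
  continuous g -> (forall s, A s -> B (g s)) ->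
  {within B, continuous f} -> {within A, continuous (f \o g)}.
Proof.
move=> cg gAB /subspace_continuousP cf; apply/subspace_continuousP => s As.
apply: (@cvg_comp _ _ _ g f _ (within B (nbhs (g s)))); last exact/cf/gAB.
move=> V VB; have := cg s _ VB; rewrite /= !nbhs_simpl /=.
rewrite /within /=; apply: filterS => z zV Az; exact/zV/gAB.
Qed.

Lemma within_if (T U : topologicalType) (A B C : set T) (b : T -> bool)
    (f g : T -> U) :
  closed A -> closed B -> C `<=` A `|` B ->
  (forall t, A t -> C t -> f t = if b t then f t else g t) ->
  (forall t, B t -> C t -> g t = if b t then f t else g t) ->
  closed C ->
  {within A `&` C, continuous f} -> {within B `&` C, continuous g} ->
  {within C, continuous (fun t => if b t then f t else g t)}.
Proof.
move=> cA cB CAB fE gE cC cf cg.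
have -> : C = (A `&` C) `|` (B `&` C).
  by rewrite -setIUl; apply/seteqP; split=> [t Ct|t []//]; split=> //; exact: CAB.
apply: withinU_continuous; try exact: closedI.
  by apply: subspace_eq_continuous cf => t; rewrite inE => -[At Ct]; exact: fE.
by apply: subspace_eq_continuous cg => t; rewrite inE => -[At Ct]; exact: gE.
Qed.

Lemma continuous_pair (T U V : topologicalType) (g : T -> U) (h : T -> V) :
  continuous g -> continuous h -> continuous (fun t => (g t, h t)).
Proof. by move=> cg ch t; exact: (cvg_pair (cg t) (ch t)). Qed.

Lemma closedX (T U : topologicalType) (A : set T) (B : set U) :
  closed A -> closed B -> closed (A `*` B).
Proof.
move=> cA cB; apply: closedI.
  by apply: (closed_comp _ cA) => t _; exact: cvg_fst.
by apply: (closed_comp _ cB) => t _; exact: cvg_snd.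
Qed.

Section Paths.
Variables (R : realType) (X : topologicalType).

(* Paths and homotopies are functions on the whole of R or R * R, of which only
   the restriction to [0,1] or to the unit square matters. *)
Definition is_path (p : R -> X) (a b : X) : Prop :=
  [/\ {within `[0, 1], continuous p}, p 0 = a & p 1 = b].

Definition path_cat (p q : R -> X) : R -> X :=
  fun t => if t <= 2^-1 then p (2 * t) else q (2 * t - 1).

Definition path_rev (p : R -> X) : R -> X := fun t => p (1 - t).

Definition path_homotopic (a b : X) (p q : R -> X) : Prop :=
  [/\ is_path p a b, is_path q a b
    & exists h : R * R -> X,
        [/\ {within `[0, 1]%classic `*` `[0, 1], continuous h},
            forall t : R, t \in `[0, 1] -> h (0, t) = p t /\ h (1, t) = q t
          & forall s : R, s \in `[0, 1] -> h (s, 0) = a /\ h (s, 1) = b]].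

Lemma path_cst a : is_path (cst a) a a.
Proof. by split=> //; apply: continuous_subspaceT => t; exact: cvg_cst. Qed.

Let scale_cont : continuous (fun t : R => 2 * t).
Proof. by move=> t; apply: cvgM; [exact: cvg_cst|exact: cvg_id]. Qed.

Let scale1_cont : continuous (fun t : R => 2 * t - 1).
Proof. by move=> t; apply: cvgB; [exact: scale_cont|exact: cvg_cst]. Qed.

Let rev_cont : continuous (fun t : R => 1 - t).
Proof. by move=> t; apply: cvgB; [exact: cvg_cst|exact: cvg_id]. Qed.

Lemma path_cat_is_path p q a b c :
  is_path p a b -> is_path q b c -> is_path (path_cat p q) a c.
Proof.
move=> [cp p0 p1] [cq q0 q1]; split; first last.
- rewrite /path_cat ifF; last by apply/negbTE; rewrite -ltNge; lra.
  by rewrite -q1; congr q; lra.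
- by rewrite /path_cat ifT ?mulr0//; lra.
have h2 : (2 : R) * 2^-1 = 1 by lra.
rewrite /path_cat.
apply: (@within_if R X `[0, 2^-1]%classic `[2^-1, 1]%classic `[0, 1]%classic (fun t => t <= 2^-1)
          (fun t => p (2 * t)) (fun t => q (2 * t - 1))).
- exact: interval_closed.
- exact: interval_closed.
- move=> t /=; rewrite !in_itv /= => /andP[t0 t1].
  by case: (leP t 2^-1) => tt; [left|right]; apply/andP; split=> //; exact: ltW.
- by move=> t /=; rewrite in_itv /= => /andP[_ ->].
- move=> t /=; rewrite in_itv /= => /andP[t2 _] _; case: ifP => // t2'.
  have -> : t = 2^-1 by apply/eqP; rewrite eq_le t2 t2'.
  by rewrite h2 subrr q0 p1.
- exact: interval_closed.
- apply: (@within_comp R R X _ `[0, 1]%classic (fun t : R => 2 * t) p) => // t [].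
  by rewrite /= !in_itv /= => /andP[? ?] _; apply/andP; split; lra.
- apply: (@within_comp R R X _ `[0, 1]%classic (fun t : R => 2 * t - 1) q) => // t [].
  by rewrite /= !in_itv /= => /andP[? ?] _; apply/andP; split; lra.
Qed.

Lemma path_rev_is_path p a b : is_path p a b -> is_path (path_rev p) b a.
Proof.
move=> [cp p0 p1]; split; rewrite /path_rev ?subr0 ?subrr//.
apply: (@within_comp R R X _ `[0, 1]%classic (fun t : R => 1 - t) p) => // t.
by rewrite /= !in_itv /= => /andP[? ?]; apply/andP; split; lra.
Qed.

Lemma path_homotopic_refl a b p : is_path p a b -> path_homotopic a b p p.
Proof.
move=> pP; have [cp p0 p1] := pP; split=> //.
exists (fun st => p st.2); split=> //.
apply: (@within_comp (R * R)%type R X _ `[0, 1]%classic snd p) => //; last by move=> st [].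
by move=> st; exact: cvg_snd.
Qed.

Lemma path_homotopic_sym a b p q :
  path_homotopic a b p q -> path_homotopic a b q p.
Proof.
move=> [pP qP [h [ch h01 hab]]]; split=> //.
exists (fun st => h (1 - st.1, st.2)); split=> [|t /h01|s].
- apply: (@within_comp (R * R)%type (R * R)%type X _ (`[0, 1]%classic `*` `[0, 1]%classic)
    (fun st : R * R => (1 - st.1, st.2)) h) => //.
    apply: continuous_pair => st; last exact: cvg_snd.
    by apply: cvgB; [exact: cvg_cst|exact: cvg_fst].
  move=> [s t] [/=]; rewrite !in_itv /= => /andP[? ?] ->; split=> //.
  by apply/andP; split; lra.
- by rewrite /= subr0 subrr => -[-> ->].
- move=> s01 /=; apply: hab; move: s01; rewrite /= !in_itv /= => /andP[? ?].
  by apply/andP; split; lra.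
Qed.

Lemma path_homotopic_trans a b p q r : path_homotopic a b p q ->
  path_homotopic a b q r -> path_homotopic a b p r.
Proof.
move=> [pP qP [h [ch h01 hab]]] [_ rP [k [ck k01 kab]]]; split=> //.
have h2 : (2 : R) * 2^-1 = 1 by lra.
have c01 : closed (`[0, 1]%classic : set R) by exact: interval_closed.
exists (fun st => if st.1 <= 2^-1 then h (2 * st.1, st.2)
                  else k (2 * st.1 - 1, st.2)); split.
- apply: (@within_if (R * R)%type X (`[0, 2^-1]%classic `*` `[0, 1]%classic) (`[2^-1, 1]%classic `*` `[0, 1]%classic)
    (`[0, 1]%classic `*` `[0, 1]%classic) (fun st : R * R => st.1 <= 2^-1)
    (fun st => h (2 * st.1, st.2)) (fun st => k (2 * st.1 - 1, st.2))).
  + by apply: closedX => //; exact: interval_closed.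
  + by apply: closedX => //; exact: interval_closed.
  + move=> [s t] /= [+ t01]; rewrite !in_itv /= => /andP[t0 t1].
    by case: (leP s 2^-1) => tt; [left|right]; split=> //=;
      apply/andP; split=> //; exact: ltW.
  + by move=> [s t] /= [+ _]; rewrite in_itv /= => /andP[_ ->].
  + move=> [s t] /= [+ t01]; rewrite in_itv /= => /andP[s2 _] _.
    case: ifP => // s2'.
    have -> : s = 2^-1 by apply/eqP; rewrite eq_le s2 s2'.
    by rewrite h2 subrr (k01 _ t01).1 (h01 _ t01).2.
  + exact: closedX.
  + apply: (@within_comp (R * R)%type (R * R)%type X _ (`[0, 1]%classic `*` `[0, 1]%classic)
      (fun st : R * R => (2 * st.1, st.2)) h) => //.
      apply: continuous_pair => st; last exact: cvg_snd.
      by apply: cvgM; [exact: cvg_cst|exact: cvg_fst].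
    move=> [s t] [/= [+ ?] _]; rewrite !in_itv /= => /andP[? ?]; split=> //=.
    by apply/andP; split; lra.
  + apply: (@within_comp (R * R)%type (R * R)%type X _ (`[0, 1]%classic `*` `[0, 1]%classic)
      (fun st : R * R => (2 * st.1 - 1, st.2)) k) => //.
      apply: continuous_pair => st; last exact: cvg_snd.
      apply: cvgB; last exact: cvg_cst.
      by apply: cvgM; [exact: cvg_cst|exact: cvg_fst].
    move=> [s t] [/= [+ ?] _]; rewrite !in_itv /= => /andP[? ?]; split=> //=.
    by apply/andP; split; lra.
- move=> t t01 /=; split.
    by rewrite ifT ?mulr0 ?(h01 _ t01).1//; lra.
  rewrite ifF; last by apply/negbTE; rewrite -ltNge; lra.
  by rewrite -(k01 _ t01).2; congr (k (_, _)); lra.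
- move=> s /= +; rewrite in_itv /= => /andP[? ?]; case: ifP => s2.
    by apply: hab; rewrite in_itv /=; apply/andP; split; lra.
  apply: kab; rewrite in_itv /=; apply/andP; split; last lra.
  by move/negbT: s2; rewrite -ltNge => ?; lra.
Qed.

Variable x : X.

Definition loop : choiceType := set_type [set p : R -> X | is_path p x x].

Definition loop_rel : rel loop :=
  fun p q => `[< path_homotopic x x (val p) (val q) >].

Lemma loopP (p : loop) : is_path (val p) x x.
Proof. exact: set_mem (valP p). Qed.

Lemma loop_subproof p : is_path p x x -> p \in [set p : R -> X | is_path p x x].
Proof. by move=> pP; apply/mem_set. Qed.

Definition to_loop p (pP : is_path p x x) : loop := SigSub (loop_subproof pP).

Lemma loop_rel_refl : reflexive loop_rel.
Proof. by move=> p; apply/asboolP/path_homotopic_refl/loopP. Qed.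

Lemma loop_rel_sym : symmetric loop_rel.
Proof. by move=> p q; apply/asboolP/asboolP; exact: path_homotopic_sym. Qed.

Lemma loop_rel_trans : transitive loop_rel.
Proof.
by move=> q p r /asboolP pq /asboolP qr; apply/asboolP/(path_homotopic_trans pq).
Qed.

Canonical loop_equiv :=
  EquivRel loop_rel loop_rel_refl loop_rel_sym loop_rel_trans.

Definition pi1 : choiceType := {eq_quot loop_equiv}.

Definition pi1_repr (q : pi1) : loop := repr (q : {eq_quot loop_equiv}).

Definition pi1_class (p : R -> X) (pP : is_path p x x) : pi1 :=
  \pi_({eq_quot loop_equiv}) (to_loop pP).

Definition pi1_one : pi1 := pi1_class (path_cst x).

Definition pi1_mul (p q : pi1) : pi1 :=
  pi1_class (path_cat_is_path (loopP (pi1_repr p)) (loopP (pi1_repr q))).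

Definition pi1_inv (p : pi1) : pi1 :=
  pi1_class (path_rev_is_path (loopP (pi1_repr p))).

Definition represents (q : pi1) (p : R -> X) : Prop :=
  exists pP : is_path p x x, pi1_class pP = q.

Inductive pi1_gen (S : set pi1) : set pi1 :=
| pi1_gen1 : pi1_gen S pi1_one
| pi1_gen_in q : S q -> pi1_gen S q
| pi1_genM p q : pi1_gen S p -> pi1_gen S q -> pi1_gen S (pi1_mul p q)
| pi1_genV p : pi1_gen S p -> pi1_gen S (pi1_inv p).

End Paths.

Section SelfCoveringAutomaton.
Variables (R : realType) (X : topologicalType) (f : X -> X) (x : X).

(* p is a path with p 0 = a whose image under g is a loop in the class q: when
   g is a covering, p is the g-lift at a of some loop in the class q, and p 1
   depends only on q and a. *)
Definition is_lift (g : X -> X) (q : pi1 R x) (a : X) (p : R -> X) : Prop :=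
  is_path p a (p 1) /\ represents q (g \o p).

(* The classes acting trivially by monodromy on the fibre f^-n(x), for all n. *)
Definition mono_ker : set (pi1 R x) :=
  [set q | forall n y, iter n f y = x ->
     exists2 p, is_lift (iter n f) q y p & p 1 = y].

Definition eq_mod_ker (p q : pi1 R x) : Prop := mono_ker (pi1_mul (pi1_inv p) q).

(* The loop l_a p l_(p 1)^-1 is congruent to q modulo K. *)
Definition transported_to (l : X -> R -> X) (a : X) (p : R -> X)
    (q : pi1 R x) : Prop :=
  exists2 r, represents r (path_cat (path_cat (l a) p) (path_rev (l (p 1))))
    & eq_mod_ker r q.

Record covering_data (l : X -> R -> X) (S : set (pi1 R x)) : Prop := {
  cd_path : forall y, f y = x -> is_path (l y) x y;
  cd_gen : forall q, exists2 g, pi1_gen S g & eq_mod_ker g q;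
  cd_closed : forall a q, f a = x -> S q ->
    exists2 p, is_lift f q a p & exists2 q', S q' & transported_to l a p q'
}.

(* M is a possible value of Pi(X) for the data x, l, S; the values of its
   transition function are only prescribed modulo K. *)
Definition is_covering_automaton (l : X -> R -> X) (S : set (pi1 R x))
    (M : automaton (set_type (f @^-1` [set x])) (set_type S)) : Prop :=
  forall a q, exists2 p, is_lift f (val q) (val a) p &
    val (out M a q) = p 1 /\ transported_to l (val a) p (val (trans M a q)).

End SelfCoveringAutomaton.

(* Main.v *)
(* A cell of |L(P)| labels the tree of iterated preimages of its points by the
   words over A, and up to <P> the labelling depends only on the point. These
   frames form a flat bundle over |L(P)|, with the action of <P> on the fibres;
   a frame is followed along a path by means of the group element that carries
   the larger part of an interval of simplex coordinates. The monodromy of a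
   loop on iterated preimages is then its holonomy, an element of <P>.
   Surjectivity of the transition function makes every generator the holonomy of
   an arrow, and strong connectedness joins any two objects by a path, obtained
   by infinite subdivision, along which the frame does not change. Hence the
   holonomy is onto <P>. For arbitrary data, transport of a frame along l_y ends
   in a tail of the frame up to an element k_y of <P>; the map defined by
   psi (y w) = a k_y (psi w), where y has label a, conjugates Pi(|L|) to P, and
   its inverse is finite-state because P is contracting. *)
Require Import Defs.
From mathcomp Require Import all_boot all_order all_algebra.
From mathcomp Require Import all_classical all_reals topology normedtype.
From mathcomp Require Import zify lra.

Set Implicit Arguments.
Unset Strict Implicit.
Unset Printing Implicit Defensive.

Import Order.TTheory GRing.Theory Num.Theory.
Import numFieldNormedType.Exports.

Local Open Scope classical_set_scope.
Local Open Scope quotient_scope.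
Local Open Scope ring_scope.

(** The realization is a quotient by faces and degeneracies, so open sets in it come from saturated
    open sets of cells, and a chart must be invariant under gluing. The vertex of largest coordinate
    is not: a degeneracy splits a coordinate in two. What survives is the division of [0,1] into
    consecutive intervals of lengths t_0, ..., t_n labelled by the vertices: a degeneracy cuts an
    interval into two with the same label, a face inserts an interval of length 0. That one label
    fills more than half of [u, v] is thus an invariant and open condition with at most one
    solution. The charts are indexed by [u, v] because no label need have a majority in [0,1].
    Labels are read from the first vertex, which a face may remove; hence invariance statements
    carry a group element [k]. Lifts of paths are found as points of transported frames. Two objects
    need not be isomorphic in the groupoid, which forces infinitely many edges on the path between
    them. It is continuous at its limit points because an edge over an arrow close to an identity
    arrow is close to a single point. *)

(** The level set of [c s] is open and closed in [J]. With [T := Prop] a locally constant truth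
    value becomes constant, which is how uniqueness and existence of transport are obtained. *)
Lemma locally_constant_itv (R : realType) (T : Type) (J : set R) (c : R -> T) :
  is_interval J ->
  (forall s0, J s0 -> \forall s \near s0, J s -> c s = c s0) ->
  forall s t, J s -> J t -> c s = c t.
Proof.
move=> /connected_intervalP cJ lc s t Js Jt.
suff DJ : J `&` [set r | c r = c s] = J by have [] : (J `&` [set r | c r = c s]) t by rewrite DJ.
apply: cJ.
- by exists s.
- exists ([set r | J r -> c r = c s])°; first exact: open_interior.
  apply/seteqP; split=> r [Jr cr]; split=> //.
    by apply: filterS (lc r Jr) => r' + Jr' => /(_ Jr') ->.
  by have := nbhs_singleton cr; apply.
- exists (~` ([set r | J r -> c r <> c s])°).
    by apply: open_closedC; exact: open_interior.
  apply/seteqP; split=> r [Jr cr]; split=> //.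
    by move=> /nbhs_singleton /(_ Jr).
  rewrite /=; apply: contrapT => crs; apply: cr.
  by apply: filterS (lc r Jr) => r' + Jr' => /(_ Jr') ->.
Qed.

Lemma within_near (R : realType) (X : topologicalType) (J : set R) (p : R -> X)
    s0 (V : set X) :
  {within J, continuous p} -> J s0 -> nbhs (p s0) V ->
  \forall s \near s0, J s -> V (p s).
Proof. by move=> /subspace_continuousP /[apply] /[apply]. Qed.

(** * Flat bundles and parallel transport *)

(** [Y] has no topology: the charts replace it. [D] is a discrete fibre, and [co_change] says that
    transition functions are locally constant, one fibre value at a time. Coordinates outside [U i]
    are unconstrained. *)
Record flat_bundle (X : topologicalType) (Y I D : Type) (proj : Y -> X)
    (U : I -> set X) (co : I -> Y -> D) : Prop := {
  chart_open : forall i, open (U i);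
  chart_cover : forall z, exists i, U i z;
  co_inj : forall i y y', U i (proj y) -> proj y = proj y' ->
    co i y = co i y' -> y = y';
  co_surj : forall i y z, U i (proj y) -> U i z ->
    exists2 y', proj y' = z & co i y' = co i y;
  co_change : forall i j y, U i (proj y) -> U j (proj y) ->
    \forall z \near proj y, forall y', proj y' = z -> co i y' = co i y ->
      co j y' = co j y
}.

Section FlatBundle.
Variables (R : realType) (X : topologicalType) (Y I D : Type) (proj : Y -> X).
Variables (U : I -> set X) (co : I -> Y -> D).
Hypothesis F : flat_bundle proj U co.

Definition parallel (J : set R) (p : R -> X) (Th : R -> Y) : Prop :=
  forall s0, J s0 -> proj (Th s0) = p s0 /\ exists2 i, U i (p s0) &
    \forall s \near s0, J s -> co i (Th s) = co i (Th s0).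

(** [co_change] moves the constancy from the chart supplied by [parallel] to any other chart at
    [p s0], so later arguments may choose the chart. *)
Lemma parallel_chart (J : set R) (p : R -> X) Th i s0 : {within J, continuous p} ->
  parallel J p Th -> J s0 -> U i (p s0) ->
  \forall s \near s0, J s -> co i (Th s) = co i (Th s0).
Proof.
move=> cp pT Js0 Ui; have [ps0 [j Uj nj]] := pT _ Js0.
rewrite -ps0 in Ui Uj.
have := within_near cp Js0; rewrite -ps0 => /(_ _ (co_change F Uj Ui)) ni.
apply: filterS2 nj ni => s nj ni Js.
by apply: ni (nj Js) => //; exact: (pT _ Js).1.
Qed.

Lemma parallel_sub J J' p Th : J' `<=` J -> parallel J p Th -> parallel J' p Th.
Proof.
move=> sJ pT s0 /sJ/pT[-> [i Ui ni]]; split=> //; exists i => //.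
by apply: filterS ni => s + /sJ.
Qed.

Lemma parallel_eq J p p' Th Th' : (forall s, J s -> p s = p' s) ->
  (forall s, J s -> Th s = Th' s) -> parallel J p Th -> parallel J p' Th'.
Proof.
move=> pp TT pT s0 Js0; have [ps0 [i Ui ni]] := pT _ Js0.
rewrite -pp// -TT//; split=> //; exists i => //.
by apply: filterS ni => s + Js; rewrite -TT//; apply.
Qed.

Lemma parallel_comp (J J' : set R) (phi : R -> R) p Th :
  continuous phi -> (forall s, J' s -> J (phi s)) ->
  parallel J p Th -> parallel J' (p \o phi) (Th \o phi).
Proof.
move=> cphi sJ pT s0 /sJ/pT[ps0 [i Ui ni]]; split=> //; exists i => //.
have ni' : nbhs s0 (phi @^-1` _) := cphi s0 _ ni.
by apply: filterS ni' => s /= nis /sJ/nis.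
Qed.

Lemma parallel_uniq (J : set R) (p : R -> X) Th Th' a : is_interval J -> {within J, continuous p} ->
  parallel J p Th -> parallel J p Th' -> J a -> Th a = Th' a ->
  forall s, J s -> Th s = Th' s.
Proof.
move=> iJ cp pT pT' Ja eqa s Js.
suff -> : (Th s = Th' s) = (Th a = Th' a) by [].
apply: (locally_constant_itv (c := fun s => Th s = Th' s) iJ) => // s0 Js0.
have [z0 [i Ui ni]] := pT _ Js0.
have [z0' _] := pT' _ Js0.
have ni' := parallel_chart cp pT' Js0 Ui.
have nU := within_near cp Js0 (open_nbhs_nbhs (conj (chart_open F i) Ui)).
apply: filterS3 ni ni' nU => t ni ni' nU Jt.
have zt := (pT _ Jt).1; have zt' := (pT' _ Jt).1.
have {ni} e := ni Jt; have {ni'} e' := ni' Jt; have {nU} Ut := nU Jt.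
apply/propext; split=> E.
  by apply: (co_inj F (i := i)); rewrite ?z0 ?z0' // -e -e' E.
by apply: (co_inj F (i := i)); rewrite ?zt ?zt' // e e' E.
Qed.

(** At the junction the two halves may be constant in different charts; the right half is
    re-expressed in the chart of the left one. *)
Lemma parallel_glue (a b c : R) (p : R -> X) Th : a <= b -> b <= c ->
  {within `[a, c], continuous p} ->
  parallel `[a, b] p Th -> parallel `[b, c] p Th -> parallel `[a, c] p Th.
Proof.
move=> ab bc cp p1 p2 s0; rewrite /= in_itv /= => /andP[as0 s0c].
case: (ltgtP s0 b) => sb.
- have J0 : `[a, b]%classic s0 by rewrite /= in_itv /= as0 ltW.
  have [z0 [i Ui ni]] := p1 _ J0; split=> //; exists i => //.
  apply: filterS2 ni (lt_nbhsl sb) => s ni sb' /=; rewrite in_itv /= => /andP[as' _].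
  by apply: ni; rewrite /= in_itv /= as' ltW.
- have J0 : `[b, c]%classic s0 by rewrite /= in_itv /= s0c ltW.
  have [z0 [i Ui ni]] := p2 _ J0; split=> //; exists i => //.
  apply: filterS2 ni (lt_nbhsr sb) => s ni sb' /=; rewrite in_itv /= => /andP[_ sc].
  by apply: ni; rewrite /= in_itv /= sc ltW.
- rewrite sb in as0 s0c *.
  have J1 : `[a, b]%classic b by rewrite /= in_itv /= ab lexx.
  have J2 : `[b, c]%classic b by rewrite /= in_itv /= bc lexx.
  have [z0 [i Ui n1]] := p1 _ J1; split=> //; exists i => //.
  have cp2 : {within `[b, c], continuous p}.
    apply: continuous_subspaceW cp => s /=; rewrite !in_itv /= => /andP[+ ->].
    by move=> /(le_trans ab) ->.
  have n2 := parallel_chart cp2 p2 J2 Ui.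
  apply: filterS2 n1 n2 => s n1 n2; rewrite /= in_itv /= => /andP[as' sc].
  case: (leP s b) => sb'; first by apply: n1; rewrite /= in_itv /= as' sb'.
  by apply: n2; rewrite /= in_itv /= sc ltW.
Qed.

Lemma parallel_exists (a b : R) (p : R -> X) y : a <= b -> {within `[a, b], continuous p} ->
  proj y = p a -> exists2 Th, parallel `[a, b] p Th & Th a = y.
Proof.
move=> ab cp ya.
(* Existence on the interval from [a] to [t] is a truth value that is locally constant in [t] and
   holds at [t = a]. *)
pose L t := exists2 Th, parallel `[a, t] p Th & Th a = y.
rewrite -/(L b).
have La : L a.
  exists (cst y) => // s; rewrite /= in_itv /= -eq_le => /eqP <-; split=> //.
  have [i Ui] := chart_cover F (p a); exists i => //.
  by near=> s'.
suff -> : L b = L a by [].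
apply: (locally_constant_itv (c := L) (J := `[a, b]%classic)); last 2 first.
- by rewrite /= in_itv /= lexx ab.
- by rewrite /= in_itv /= lexx ab.
- exact: interval_is_interval.
move=> t0 Jt0; have [i Ui] := chart_cover F (p t0).
have nU := within_near cp Jt0 (open_nbhs_nbhs (conj (chart_open F i) Ui)).
have [e /= e0 eU] := nU.
(* Inside one chart the lift is prolonged by keeping its coordinate fixed; shortening it is a
   restriction. *)
have claim t t' : `[a, b]%classic t -> `[a, b]%classic t' ->
    ball t0 e t -> ball t0 e t' -> L t -> L t'.
  rewrite /= !in_itv /= => /andP[at_ tb] /andP[at' t'b] Bt Bt' [Th pT Ta].
  case: (leP t' t) => tt'.
    exists Th => //; apply: parallel_sub pT => s /=; rewrite !in_itv /=.
    by move=> /andP[->] /= /le_trans; apply.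
  have Utt s : t <= s <= t' -> U i (p s).
    move=> /andP[ts st]; apply: eU.
      rewrite /ball /= in Bt Bt' *; rewrite !ltr_norml in Bt Bt' *.
      by move: Bt Bt' => /andP[? ?] /andP[? ?]; apply/andP; split; lra.
    by rewrite /= in_itv /=; apply/andP; split; lra.
  have Jt : `[a, t]%classic t by rewrite /= in_itv /= at_ lexx.
  have pt := (pT _ Jt).1.
  have ex s : exists y', t <= s <= t' -> proj y' = p s /\ co i y' = co i (Th t).
    have [ts|] := boolP (t <= s <= t'); last by exists y.
    have [|y' ? ?] := @co_surj _ _ _ _ _ _ _ F i (Th t) (p s) _ (Utt _ ts).
      by rewrite pt; apply: Utt; rewrite lexx ltW.
    by exists y'.
  have [g gP] := choice ex.
  exists (fun s => if s <= t then Th s else g s); last by rewrite at_.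
  have cpt : {within `[a, t'], continuous p}.
    apply: continuous_subspaceW cp => s /=; rewrite !in_itv /= => /andP[-> st] /=.
    exact: le_trans st t'b.
  apply: (@parallel_glue _ t) => //; first exact: ltW.
    apply: parallel_eq pT => // s; rewrite /= in_itv /= => /andP[_ ->] //.
  have main s : `[t, t']%classic s ->
      proj (if s <= t then Th s else g s) = p s /\
      co i (if s <= t then Th s else g s) = co i (Th t).
    rewrite /= in_itv /= => ss; case: (leP s t) => [st|_]; last exact: gP.
    have -> : s = t by apply/eqP; rewrite eq_le st; case/andP: ss.
    by [].
  move=> s Js; have [m1 m2] := main _ Js; split=> //; exists i.
    by apply: Utt; move: Js; rewrite /= in_itv.
  by near=> s' => Js'; rewrite m2; case: (main _ Js').
exists e => //= t Bt Jt; apply/propext; split; apply: claim => //;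
  exact: ballxx.
Unshelve. all: by end_near.
Qed.

Lemma parallel_homotopy (h : R * R -> X) (Th : R -> R -> Y) y b :
  {within `[0, 1]%classic `*` `[0, 1], continuous h} ->
  (forall s, `[0, 1]%classic s -> parallel `[0, 1] (fun t => h (s, t)) (Th s)) ->
  (forall s, `[0, 1]%classic s -> Th s 0 = y) ->
  (forall s, `[0, 1]%classic s -> h (s, 1) = b) ->
  forall s s', `[0, 1]%classic s -> `[0, 1]%classic s' -> Th s 1 = Th s' 1.
Proof.
set J := `[0, 1]%classic => ch pT T0 h1.
have J0 : J 0 by rewrite /J /= in_itv /= lexx ler01.
have J1 : J 1 by rewrite /J /= in_itv /= lexx ler01.
have iJ : is_interval J by exact: interval_is_interval.
have ct s : J s -> {within J, continuous (fun t => h (s, t))}.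
  move=> Js; apply: (@within_comp R (R * R)%type X J (J `*` J) (pair s) h) => //.
  by apply: continuous_pair => t; [exact: cvg_cst|exact: cvg_id].
have cs t : J t -> {within J, continuous (fun s => h (s, t))}.
  move=> Jt; apply: (@within_comp R (R * R)%type X J (J `*` J) (fun s => (s, t)) h) => //.
  by apply: continuous_pair => t'; [exact: cvg_id|exact: cvg_cst].
have projT s t : J s -> J t -> proj (Th s t) = h (s, t).
  by move=> Js Jt; exact: (pT _ Js _ Jt).1.
apply: (@locally_constant_itv _ _ _ (fun s => Th s 1)) => // s0 Js0.
(* At time [t], the transports for [s] near [s0] agree with the one at [s0] in some chart. This
   truth value is locally constant in [t], so it passes from the common start to time 1, where the
   fixed end [b] turns equal coordinates into equal points. *)
pose C t := exists2 i, U i (h (s0, t)) &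
  \forall s \near s0, J s -> co i (Th s t) = co i (Th s0 t).
have C0 : C 0.
  have [i Ui] := chart_cover F (h (s0, 0)); exists i => //.
  by near=> s => Js; rewrite !T0.
have C1 : C 1.
  suff -> : C 1 = C 0 by [].
  apply: (locally_constant_itv (c := C) iJ) => // t0 Jt0.
  have [i Ui] := chart_cover F (h (s0, t0)).
  have /subspace_continuousP/(_ (s0, t0)) := ch.
  move=> /(_ (conj Js0 Jt0)) /(_ _ (open_nbhs_nbhs (conj (chart_open F i) Ui))).
  case=> -[A B] [/= nA [e /= e0 eB]] AB.
  have UU s t : A s -> J s -> ball t0 e t -> J t -> U i (h (s, t)).
    by move=> As Js Bt Jt; apply: AB; split=> //=; exact: eB.
  have iB : is_interval (J `&` ball t0 e).
    move=> r r' [Jr Br] [Jr' Br'] w rw; split; first exact: iJ rw.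
    rewrite /ball /= in Br Br' *; rewrite !ltr_norml in Br Br' *.
    by move: Br Br' rw => /andP[? ?] /andP[? ?] /andP[? ?]; apply/andP; split; lra.
  have cst s t t' : A s -> J s -> ball t0 e t -> J t -> ball t0 e t' -> J t' ->
      co i (Th s t) = co i (Th s t').
    move=> As Js Bt Jt Bt' Jt'.
    apply: (locally_constant_itv (c := fun t => co i (Th s t)) iB) => //.
    move=> r [Jr Br]; have := parallel_chart (ct _ Js) (pT _ Js) Jr (UU _ _ As Js Br Jr).
    by apply: filterS => r' + [Jr' _]; apply.
  have As0 : A s0 by exact: nbhs_singleton.
  have claim t t' : ball t0 e t -> J t -> ball t0 e t' -> J t' -> C t -> C t'.
    move=> Bt Jt Bt' Jt' [j Uj nj]; exists i; first exact: UU.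
    have Uit := UU s0 t As0 Js0 Bt Jt.
    rewrite -!projT // in Uj Uit.
    have := co_change F Uj Uit; rewrite projT // => nc.
    have := within_near (cs _ Jt) Js0 nc => {}nc.
    apply: filterS3 nA nj nc => s As nj ncs Js.
    by rewrite (cst s t' t) // (cst s0 t' t) //; apply: ncs; [|exact: projT|exact: nj].
  exists e => //= t Bt Jt; apply/propext; split; apply: claim => //; exact: ballxx.
have [i Ui ni] := C1; apply: filterS ni => s ni Js.
by apply: (co_inj F (i := i)); rewrite ?projT ?h1 // -?(h1 _ Js0) //; exact: ni.
Unshelve. all: by end_near.
Qed.

End FlatBundle.

(** * Sections of elements of the generated group *)

Lemma autgroup_cons (A Q : Type) (P : automaton A Q) g a w :
  autgroup P g -> g (a :: w) = letter g a :: sect g [:: a] w.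
Proof.
move=> gP; have th := autgroup_tree_hom gP.
by rewrite -[a :: w]/([:: a] ++ w) (tree_hom_cat _ _ th) (letterE _ th).
Qed.

Lemma autgroup_nil (A Q : Type) (P : automaton A Q) g :
  autgroup P g -> g [::] = [::].
Proof. by move=> /autgroup_tree_hom[/(_ [::]) /= /size0nil]. Qed.

Lemma autgroup_size (A Q : Type) (P : automaton A Q) g w :
  autgroup P g -> size (g w) = size w.
Proof. by move=> /autgroup_tree_hom[]. Qed.

Lemma sect_id (A : Type) (v : seq A) : sect id v = id.
Proof. by apply/funext => w; rewrite /sect /= drop_size_cat. Qed.

Lemma run_cons (A Q : Type) (P : automaton A Q) q a :
  letter (run P q) a = out P a q /\ sect (run P q) [:: a] = run P (trans P a q).
Proof. by split=> //; apply/funext => w; rewrite /sect /= drop0. Qed.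

(** For an inverse, the sections at corresponding letters compose to a section of the identity, in
    both orders. *)
Lemma autgroup_sect1 (A Q : Type) (P : automaton A Q) g a :
  autgroup P g -> autgroup P (sect g [:: a]).
Proof.
move=> gP; elim: gP a => {g} [|q|g h gP IHg hP IHh|g h gP IHg gK hK] a.
- by rewrite sect_id; exact: autgroup1.
- by rewrite (run_cons P q a).2; exact: autgroup_gen.
- have := autgroup_tree_hom gP; have := autgroup_tree_hom hP => th tg.
  by rewrite sect_comp //; exact: autgroupM.
- have tg := autgroup_tree_hom gP; have th := tree_hom_inv gK hK tg.
  have gb : letter g (letter h a) = a by rewrite -letter_comp // /letter /= hK.
  have E1 := sect_comp (letter h a) tg th.
  have E2 := sect_comp a th tg.
  have hg : h \o g = id by apply/funext.
  have gh : g \o h = id by apply/funext.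
  rewrite gb hg sect_id in E1; rewrite gh sect_id in E2.
  by apply: (autgroupV (IHg (letter h a))) => w;
    [have := congr1 (@^~ w) E1|have := congr1 (@^~ w) E2].
Qed.

(** * Chains, their preimages under the shift, and frames *)

Section Frames.
Variables (R : realType) (A Q : finType) (P : automaton A Q).
Hypothesis Pinv : invertible P.

Local Notation G := (autgroup P).
Local Notation L := (limit_groupoid Pinv).
Local Notation X := (realization L R).
Local Notation cells := (presimplices L R).

Lemma autgroup_inv g : G g -> exists h, [/\ G h, g \o h = id & h \o g = id].
Proof.
move=> gP; have [h gK hK] := autgroup_bij Pinv gP; exists h.
by split; [exact: autgroupV gK hK|apply/funext|apply/funext].
Qed.

Lemma autgroup_inj g : G g -> injective g.
Proof. by move=> /(autgroup_bij Pinv)/bij_inj. Qed.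

Lemma letter_inj g : G g -> injective (letter g).
Proof.
move=> gP a b ab; have : g [:: a] = g [:: b].
  by rewrite !(letterE _ (autgroup_tree_hom gP)) ab.
by move=> /(autgroup_inj gP) [].
Qed.

(* The extension of the arrow e to position 0: the states of e at the positions
   -1, -2, ... determine the element of <P> acting on further letters. *)
Definition coc_type (e : lim_arr P) : autgroup_type P :=
  exist (fun g => g \in G) (sect (autgroup_fun ((val e).2 0%N)) [:: (val e).1 0%N])
    (mem_set (autgroup_sect1 _ (autgroup_funP _))).

Definition coc (e : lim_arr P) : seq A -> seq A := autgroup_fun (coc_type e).

Lemma cocG e : G (coc e). Proof. exact: autgroup_funP. Qed.

Lemma coc_shift e : coc (shift_arr e) = autgroup_fun ((val e).2 0%N).
Proof. by have [-> _] := set_mem (valP e). Qed.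

Lemma coc_id al : coc (Defs.lim_id P al) = id.
Proof. by rewrite /coc /= /autgroup_fun /= sect_id. Qed.

Definition ext_obj (a : A) (al : lim_obj A) : lim_obj A :=
  fun k => if k is k'.+1 then al k' else a.

Lemma ext_arr_subproof a (e : lim_arr P) :
  (ext_obj a (val e).1, fun k => if k is k'.+1 then (val e).2 k' else coc_type e)
    \in @is_lim_arr A Q P.
Proof.
have [eP ef] := set_mem (valP e); apply/mem_set; split=> /= [[|k] //=|].
apply: (@sub_finite_set _ _ (coc_type e |` range (val e).2)).
  by move=> _ [[|k] _ <-]; [left|right; exists k].
by rewrite finite_setU; split.
Qed.

Definition ext_arr (a : A) (e : lim_arr P) : lim_arr P :=
  SigSub (ext_arr_subproof a e).

Lemma shift_ext_arr a e : shift_arr (ext_arr a e) = e.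
Proof. by apply: val_inj => /=; rewrite -surjective_pairing. Qed.

Lemma src_ext_arr a e : lim_src (ext_arr a e) = ext_obj a (lim_src e).
Proof. by []. Qed.

Lemma tgt_ext_arr a e :
  lim_tgt (ext_arr a e) = ext_obj (letter (coc e) a) (lim_tgt e).
Proof. by apply/funext => -[|k]. Qed.

Lemma coc_ext_arr a e : coc (ext_arr a e) = sect (coc e) [:: a].
Proof. by []. Qed.

Lemma ext_obj_shift (al : lim_obj A) : ext_obj (al 0%N) (shift_obj al) = al.
Proof. by apply/funext => -[|k]. Qed.

Lemma ext_arr_shift e : ext_arr (lim_src e 0%N) (shift_arr e) = e.
Proof.
apply: lim_arr_eq; first by rewrite src_ext_arr shift_src ext_obj_shift.
by apply/funext => -[|k] //=; apply: autgroup_fun_inj; exact: coc_shift.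
Qed.

Section Chains.
Variable n : nat.
Implicit Types c : chain L n.

Definition vtx c (i : 'I_n.+1) : lim_obj A := (val c).1 i.
Definition arr c (i : 'I_n) : lim_arr P := (val c).2 i.

Lemma arr_src c i : lim_src (arr c i) = vtx c (inl_ord i).
Proof. by have /set_mem/(_ i)[] := valP c. Qed.

Lemma arr_tgt c i : lim_tgt (arr c i) = vtx c (lift ord0 i).
Proof. by have /set_mem/(_ i)[] := valP c. Qed.

Lemma chain_eq c c' : vtx c =1 vtx c' -> arr c =1 arr c' -> c = c'.
Proof.
case: c c' => -[v e] cP [[v' e'] cP'] /funext vv' /funext ee'.
by apply: val_inj => /=; congr pair.
Qed.

Definition coc_at c (k : nat) : seq A -> seq A :=
  if insub k is Some i then coc (arr c i) else id.

Lemma coc_at_ord c (i : 'I_n) : coc_at c i = coc (arr c i).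
Proof. by rewrite /coc_at valK. Qed.

Fixpoint hol_to c (k : nat) : seq A -> seq A :=
  if k is k'.+1 then coc_at c k' \o hol_to c k' else id.

Lemma hol_toG c k : G (hol_to c k).
Proof.
elim: k => [|k IH] /=; first exact: autgroup1.
apply: autgroupM => //; rewrite /coc_at; case: insubP => [i _ _|_].
  exact: cocG.
exact: autgroup1.
Qed.

Lemma hol_to_step c (i : 'I_n) :
  hol_to c (lift ord0 i) = coc (arr c i) \o hol_to c (inl_ord i).
Proof. by rewrite /= coc_at_ord. Qed.

(** A preimage of the chain under the shift: the new letter [a] is prescribed at the first vertex
    only, and [hol_to] carries it to the other vertices. *)
Lemma ext_chain_subproof a c :
  ((fun i : 'I_n.+1 => ext_obj (letter (hol_to c i) a) (vtx c i)),
   (fun i : 'I_n => ext_arr (letter (hol_to c i) a) (arr c i)))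
    \in is_chain (G := L) (n := n).
Proof.
apply/mem_set => i; rewrite /fst /snd /gsrc /gtgt /= -/(lim_src _) -/(lim_tgt _).
split; first by rewrite src_ext_arr arr_src.
rewrite tgt_ext_arr arr_tgt; congr ext_obj.
rewrite -[RHS]/(letter (coc_at c i \o hol_to c i) a) coc_at_ord letter_comp //.
  exact/autgroup_tree_hom/hol_toG.
exact/autgroup_tree_hom/cocG.
Qed.

Definition ext_chain a c : chain L n := SigSub (ext_chain_subproof a c).

Definition shift_chain c : chain L n := chain_map (limit_shift Pinv) c.

Lemma vtx_ext_chain a c (i : 'I_n.+1) :
  vtx (ext_chain a c) i = ext_obj (letter (hol_to c i) a) (vtx c i).
Proof. by []. Qed.

Lemma arr_ext_chain a c (i : 'I_n) :
  arr (ext_chain a c) i = ext_arr (letter (hol_to c i) a) (arr c i).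
Proof. by []. Qed.

Lemma vtx_shift_chain c i : vtx (shift_chain c) i = shift_obj (vtx c i).
Proof. by []. Qed.

Lemma arr_shift_chain c i : arr (shift_chain c) i = shift_arr (arr c i).
Proof. by []. Qed.

Lemma shift_ext_chain a c : shift_chain (ext_chain a c) = c.
Proof.
apply: chain_eq => i; first by apply/funext.
by rewrite arr_shift_chain arr_ext_chain shift_ext_arr.
Qed.

Lemma hol_to_ext a c k : hol_to (ext_chain a c) k = sect (hol_to c k) [:: a].
Proof.
elim: k => [|k IH] /=; first by rewrite sect_id.
rewrite IH {1 2}/coc_at; case: insubP => [i _ ik|_].
  rewrite arr_ext_chain coc_ext_arr -ik sect_comp //.
    exact/autgroup_tree_hom/hol_toG.
  exact/autgroup_tree_hom/cocG.
by rewrite /=; apply/funext.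
Qed.

Lemma ext_chain_shift c : ext_chain (vtx c ord0 0%N) (shift_chain c) = c.
Proof.
have key (i : 'I_n.+1) :
    letter (hol_to (shift_chain c) i) (vtx c ord0 0%N) = vtx c i 0%N.
  case: i => k; elim: k => [|k IH] kn; first by congr (vtx _ _ _); exact: val_inj.
  have kn' : (k < n)%N by [].
  rewrite -[nat_of_ord _]/(nat_of_ord (lift ord0 (Ordinal kn'))) hol_to_step.
  rewrite letter_comp; last 2 first.
  - exact/autgroup_tree_hom/hol_toG.
  - exact/autgroup_tree_hom/cocG.
  have := IH (ltnW kn) => /= ->.
  rewrite arr_shift_chain coc_shift.
  have -> : Ordinal kn = lift ord0 (Ordinal kn') by exact: val_inj.
  rewrite -arr_tgt /lim_tgt; congr (letter _ _).
  have -> : Ordinal (ltnW kn) = inl_ord (Ordinal kn') by exact: val_inj.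
  by rewrite -arr_src.
apply: chain_eq => i; first by rewrite vtx_ext_chain key vtx_shift_chain ext_obj_shift.
rewrite arr_ext_chain arr_shift_chain -[nat_of_ord i]/(nat_of_ord (inl_ord i)) key.
by rewrite -arr_src ext_arr_shift.
Qed.

End Chains.

Lemma shift_face n (i : 'I_n.+2) (c : chain L n.+1) :
  shift_chain (face i c) = face i (shift_chain c).
Proof.
apply: chain_eq => j //; rewrite arr_shift_chain /arr /= /face_arr.
case: eqP => // ji; last by case: ifP.
apply: shift_mul; rewrite -!/(arr c _) arr_tgt arr_src; congr (vtx c _); exact: val_inj.
Qed.

Lemma shift_degen n (i : 'I_n.+1) (c : chain L n) :
  shift_chain (degen i c) = degen i (shift_chain c).
Proof.
apply: chain_eq => j //; rewrite arr_shift_chain /arr /= /degen_arr.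
by case: unlift => // ; rewrite shift_id.
Qed.

(** The first vertex of the face is vertex [lift i ord0] of [c]. It is a new one when [i] is 0, and
    the letter changes accordingly. *)
Lemma ext_face n (i : 'I_n.+2) (c : chain L n.+1) a :
  face i (ext_chain a c) = ext_chain (letter (hol_to c (lift i ord0)) a) (face i c).
Proof.
rewrite -[LHS]ext_chain_shift shift_face shift_ext_chain; congr ext_chain.
Qed.

Lemma codeg0 n (i : 'I_n.+1) : codeg i ord0 = ord0.
Proof. by apply: ord_inj; rewrite val_codeg. Qed.

Lemma ext_degen n (i : 'I_n.+1) (c : chain L n) a :
  degen i (ext_chain a c) = ext_chain a (degen i c).
Proof.
rewrite -[LHS]ext_chain_shift shift_degen shift_ext_chain; congr ext_chain.
by rewrite -[vtx _ _ _]/(vtx (ext_chain a c) (codeg i ord0) 0%N) codeg0.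
Qed.

(** Read letter by letter: the first letter of [hol_to] is the one that an extension puts at a
    vertex, and its section is the [hol_to] of the extension. The cocycle rule thus reduces to
    [ext_face]. *)
Lemma hol_to_face n (i : 'I_n.+2) (c : chain L n.+1) (j : 'I_n.+1) :
  hol_to (face i c) j \o hol_to c (lift i ord0) = hol_to c (lift i j).
Proof.
apply/funext => w; elim: w c => [|a w IH] c.
  by rewrite /= !(autgroup_nil (hol_toG _ _)).
rewrite /= !(autgroup_cons _ _ (hol_toG _ _)); congr cons.
  have := congr1 (fun c => vtx c j 0%N) (ext_face i c a).
  by rewrite vtx_ext_chain /= => <-.
by rewrite -!hol_to_ext -ext_face -IH.
Qed.

Lemma hol_to_degen n (i : 'I_n.+1) (c : chain L n) (j : 'I_n.+2) :
  hol_to (degen i c) j = hol_to c (codeg i j).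
Proof.
apply/funext => w; elim: w c => [|a w IH] c.
  by rewrite /= !(autgroup_nil (hol_toG _ _)).
rewrite !(autgroup_cons _ _ (hol_toG _ _)); congr cons.
  have := congr1 (fun c => vtx c j 0%N) (ext_degen i c a).
  by rewrite vtx_ext_chain /= => <-.
by rewrite -!hol_to_ext -ext_degen -IH.
Qed.

Definition ext_cell (a : A) (b : cells) : cells :=
  cell (ext_chain a (projT2 b).1) (projT2 b).2.

Definition shift_cell : cells -> cells := presimplices_map (limit_shift Pinv).

(* frame b w is the preimage of the point of b under the |w|-th iterate of the
   covering that is obtained by appending w to the first vertex of b. *)
Fixpoint frame (b : cells) (w : seq A) : X :=
  if w is a :: w' then frame (ext_cell a b) w' else to_realization b.

Lemma shift_ext_cell a b : shift_cell (ext_cell a b) = b.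
Proof. by case: b => n [c t]; rewrite /shift_cell /presimplices_map /= -/(shift_chain _) shift_ext_chain. Qed.

Lemma to_realization_glue (b b' : cells) :
  Defs.glue b b' -> to_realization b = to_realization b'.
Proof.
by move=> bb'; apply/eqmodP/asboolP; exact: Relation_Operators.rst_step.
Qed.

Lemma to_realization_eq (b b' : cells) : to_realization b = to_realization b' ->
  Relation_Operators.clos_refl_sym_trans cells (@Defs.glue L R) b b'.
Proof. by move/eqmodP/asboolP. Qed.

Lemma of_realizationK (z : X) : to_realization (of_realization z) = z.
Proof. exact: (@reprK _ ({eq_quot (@glue_equiv L R)}) z). Qed.

Lemma frame_face n (i : 'I_n.+2) (c : chain L n.+1) (t : simplex R n) :
  frame (cell (face i c) t) \o hol_to c (lift i ord0) =
  frame (cell c (push (lift i) t)).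
Proof.
apply/funext => w; elim: w c => [|a w IH] c /=.
  rewrite (autgroup_nil (hol_toG _ _)); apply: to_realization_glue.
  exact: glue_face.
rewrite (autgroup_cons _ _ (hol_toG _ _)) /= -hol_to_ext /ext_cell /= -ext_face.
exact: IH.
Qed.

Lemma frame_degen n (i : 'I_n.+1) (c : chain L n) (t : simplex R n.+1) :
  frame (cell (degen i c) t) = frame (cell c (push (codeg i) t)).
Proof.
apply/funext => w; elim: w c => [|a w IH] c /=.
  by apply: to_realization_glue; exact: glue_degen.
by rewrite /ext_cell /= -ext_degen; exact: IH.
Qed.

(* Both face and degeneracy gluings come from a monotone map of vertices. *)
Definition glued_by (b b' : cells) : Prop :=
  exists m n (th : 'I_m.+1 -> 'I_n.+1) (c : chain L m) (c' : chain L n) t,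
    [/\ b = cell c t, b' = cell c' (push th t),
        (forall j k : 'I_m.+1, (j <= k)%N -> (th j <= th k)%N),
        (forall j : 'I_m.+1, vtx c j = vtx c' (th j)) &
        (forall j : 'I_m.+1, hol_to c j \o hol_to c' (th ord0) = hol_to c' (th j)) /\
        frame b \o hol_to c' (th ord0) = frame b'].

Lemma glueP b b' : Defs.glue b b' -> glued_by b b'.
Proof.
case=> [n i c t|n i c t].
  exists n, n.+1, (lift i), (face i c), c, t; split=> //.
    by move=> j k jk; rewrite leq_bump2.
  split=> [j|]; [exact: hol_to_face|exact: frame_face].
exists n.+1, n, (codeg i), (degen i c), c, t; split=> //.
  by move=> j k jk; rewrite !val_codeg; lia.
rewrite codeg0; split=> [j|]; last exact: frame_degen.
by rewrite /= -hol_to_degen.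
Qed.

End Frames.

(** * Lengths of consecutive intervals inside [u, v] *)

Section Weights.
Variable R : realType.
Implicit Types (u v x : R).

Definition clamp u v x : R := Num.min (Num.max x u) v.

Lemma clamp_le u v : {homo clamp u v : x y / x <= y}.
Proof.
move=> x y xy; rewrite /clamp le_min !ge_min lexx orbT andbT.
by rewrite ge_max le_max xy /= le_max lexx orbT.
Qed.

Lemma clamp_lo u v x : u <= v -> x <= u -> clamp u v x = u.
Proof. by move=> uv xu; rewrite /clamp (max_r xu) (min_l uv). Qed.

Lemma clamp_hi u v x : u <= v -> v <= x -> clamp u v x = v.
Proof. by move=> uv vx; rewrite /clamp (max_l (le_trans uv vx)) (min_r vx). Qed.

Section Fixed.
Variables (n : nat) (u v : R).
Implicit Type t : 'I_n.+1 -> R.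

Definition psum t (k : nat) : R := \sum_(j < n.+1 | (j < k)%N) t j.

(* The length of the part of [u, v] that lies in the i-th of the consecutive
   intervals of lengths t 0, ..., t n into which t divides [0, 1]. *)
Definition wt t (i : 'I_n.+1) : R :=
  clamp u v (psum t i.+1) - clamp u v (psum t i).

Lemma sum_ordS (F : 'I_n.+1 -> R) (i : 'I_n.+1) :
  \sum_(j < n.+1 | (j < i.+1)%N) F j = F i + \sum_(j < n.+1 | (j < i)%N) F j.
Proof.
rewrite (bigD1 i) //=; congr (_ + _); apply: eq_bigl => j.
by rewrite ltnS andbC ltn_neqAle.
Qed.

Lemma psum_le t j k : (forall i, 0 <= t i) -> (j <= k)%N -> psum t j <= psum t k.
Proof.
move=> t0 jk; rewrite /psum [leRHS](bigID (fun i : 'I_n.+1 => (i < j)%N)) /=.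
rewrite [X in _ <= X + _](eq_bigl (fun i : 'I_n.+1 => (i < j)%N)) => [|i].
  by rewrite lerDl; apply: sumr_ge0.
by apply/andb_idl => /leq_trans; apply.
Qed.

Lemma psum_all t k : (n < k)%N -> psum t k = \sum_j t j.
Proof. by move=> nk; apply: eq_bigl => j; rewrite (leq_trans (ltn_ord j)). Qed.

Lemma psum0 t : psum t 0 = 0.
Proof. exact: big_pred0. Qed.

Lemma wt_ge0 t i : (forall i, 0 <= t i) -> 0 <= wt t i.
Proof. by move=> t0; rewrite subr_ge0; apply: clamp_le; exact: psum_le. Qed.

Lemma sum_wt t k :
  \sum_(j < n.+1 | (j < k)%N) wt t j = clamp u v (psum t k) - clamp u v 0.
Proof.
elim: k => [|k IH]; first by rewrite big_pred0 // psum0 subrr.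
have [kn|kn] := ltnP k n.+1.
  rewrite -[k]/(nat_of_ord (Ordinal kn)) sum_ordS IH /wt /=; lra.
rewrite (psum_all _ (leqW kn)) -(psum_all _ kn) -IH; apply: eq_bigl => j.
by rewrite ltnS (ltnW (leq_trans (ltn_ord j) kn)) (leq_trans (ltn_ord j) kn).
Qed.

Lemma sum_wt_all t : 0 <= u -> u <= v -> v <= 1 -> \sum_i t i = 1 ->
  \sum_i wt t i = v - u.
Proof.
move=> u0 uv v1 t1; rewrite -(psum_all (wt t) (ltnSn n)) /psum sum_wt.
by rewrite psum_all // t1 clamp_hi // clamp_lo.
Qed.

End Fixed.

Lemma initial_segment m (D : pred 'I_m.+1) :
  (forall j k : 'I_m.+1, (j <= k)%N -> D k -> D j) ->
  exists k, forall j : 'I_m.+1, D j = (j < k)%N.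
Proof.
move=> mD; case: (pickP [pred j | ~~ D j]) => [j0 /= Dj0|D1]; last first.
  by exists m.+1 => j; rewrite ltn_ord; have /= /negbFE := D1 j.
case: (@arg_minnP _ j0 (predC D) (@nat_of_ord m.+1) Dj0) => k Dk kmin; exists k => j.
apply/idP/idP => [Dj|jk]; first by rewrite ltnNge; apply: contra Dk => /mD; apply.
by apply: contraTT jk => Dj; rewrite -leqNgt; exact: kmin.
Qed.

(** Since [th] is monotone, the [j] with [th j < k] form an initial segment, so every partial sum of
    [push_fun th t] is a partial sum of [t]: pushing forward only merges neighbouring intervals or
    inserts empty ones. *)
Lemma wt_push u v m n (th : 'I_m.+1 -> 'I_n.+1) (t : 'I_m.+1 -> R) i :
  (forall j k : 'I_m.+1, (j <= k)%N -> (th j <= th k)%N) ->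
  wt u v (push_fun th t) i = \sum_(j | th j == i) wt u v t j.
Proof.
move=> mth.
have key k : clamp u v (psum (push_fun th t) k) =
    clamp u v 0 + \sum_(j | (th j < k)%N) wt u v t j.
  have -> : psum (push_fun th t) k = \sum_(j | (th j < k)%N) t j.
    rewrite [RHS](partition_big th (fun i => (i < k)%N)) //=.
    apply: eq_bigr => l lk; apply: eq_bigl => j.
    by apply/esym/andb_idl => /eqP ->.
  have [|K KP] := @initial_segment m (fun j => (th j < k)%N).
    by move=> j l jl; apply: leq_ltn_trans; exact: mth.
  by rewrite !(eq_bigl _ _ KP) sum_wt -/(psum t K); lra.
rewrite {1}/wt !key opprD addrACA subrr add0r.
rewrite (bigID (fun j => th j == i)) /=.
rewrite (eq_bigl (fun j => th j == i)) => [|j]; last first.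
  by apply/andb_idl => /eqP ->.
rewrite [X in _ + X - _](eq_bigl (fun j => (th j < i)%N)) ?addrK // => j.
by rewrite ltnS andbC ltn_neqAle.
Qed.

End Weights.

(** * Majority labels as invariants of gluing *)

Section Charts.
Variables (R : realType) (A Q : finType) (P : automaton A Q).
Hypothesis Pinv : invertible P.

Local Notation G := (autgroup P).
Local Notation L := (limit_groupoid Pinv).
Local Notation X := (realization L R).
Local Notation cells := (presimplices L R).

Lemma simplex_ge0 n (t : simplex R n) i : 0 <= (val t : _ -> R) i.
Proof. by have /set_mem[] := valP t. Qed.

Lemma simplex_sum n (t : simplex R n) : \sum_i (val t : _ -> R) i = 1.
Proof. by have /set_mem[] := valP t. Qed.

Definition hmass (u v : R) (b : cells) (g : seq A -> seq A) : R :=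
  \sum_(i < (projT1 b).+1 | `[< hol_to (projT2 b).1 i = g >]) wt u v (val (projT2 b).2) i.

(** Counts the letters of the vertices at position -1. It does not refer to the first vertex, so its
    majority depends on the point alone; it serves to tell the preimages of a point apart. *)
Definition vmass (u v : R) (b : cells) (a : A) : R :=
  \sum_(i | vtx (projT2 b).1 i 0%N == a) wt u v (val (projT2 b).2) i.

Definition subitv (uv : R * R) : Prop :=
  [/\ 0 <= uv.1, uv.1 < uv.2 & uv.2 <= 1].

(* g carries more than half of [u, v], so that it is unique. *)
Definition maj (uv : R * R) (b : cells) (g : seq A -> seq A) : Prop :=
  subitv uv /\ uv.2 - uv.1 < 2 * hmass uv.1 uv.2 b g.

Definition vmaj (uv : R * R) (b : cells) (a : A) : Prop :=
  subitv uv /\ uv.2 - uv.1 < 2 * vmass uv.1 uv.2 b a.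

Lemma mass_disjoint n (t : simplex R n) u v (p q : pred 'I_n.+1) :
  0 <= u -> u < v -> v <= 1 -> (forall i, p i -> q i -> False) ->
  \sum_(i | p i) wt u v (val t) i + \sum_(i | q i) wt u v (val t) i <= v - u.
Proof.
move=> u0 uv v1 pq.
rewrite -(sum_wt_all u0 (ltW uv) v1 (simplex_sum t)) [leRHS](bigID p) /= lerD2l.
rewrite [leRHS](bigID q) /= (eq_bigl q) => [|i].
  by rewrite lerDl; apply: sumr_ge0 => i _; apply: wt_ge0; exact: simplex_ge0.
by apply/andb_idl => qi; apply/negP => /pq; apply.
Qed.

Lemma maj_uniq uv b g g' : maj uv b g -> maj uv b g' -> g = g'.
Proof.
case: b => n [c t] [[u0 lt v1] m] [_ m']; apply: contrapT => gg'.
rewrite /hmass /= in m m'.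
suff : hmass uv.1 uv.2 (cell c t) g + hmass uv.1 uv.2 (cell c t) g' <= uv.2 - uv.1.
  by rewrite /hmass /=; lra.
apply: mass_disjoint => // i /asboolP gi /asboolP g'i.
by apply: gg'; rewrite -gi.
Qed.

Lemma vmaj_uniq uv b a a' : vmaj uv b a -> vmaj uv b a' -> a = a'.
Proof.
case: b => n [c t] [[u0 lt v1] m] [_ m']; apply: contrapT => gg'.
rewrite /vmass /= in m m'.
suff : vmass uv.1 uv.2 (cell c t) a + vmass uv.1 uv.2 (cell c t) a' <= uv.2 - uv.1.
  by rewrite /vmass /=; lra.
apply: mass_disjoint => // i /eqP gi /eqP g'i.
by apply: gg'; rewrite -gi.
Qed.

Lemma maj_exists b : exists uv g, maj uv b g.
Proof.
case: b => n [c t].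
have [i ti] : exists i, 0 < (val t : _ -> R) i.
  apply: contrapT => /forallNP t0; have := simplex_sum t.
  rewrite big1 => [/eqP|i _]; first by rewrite eq_sym oner_eq0.
  by apply/eqP; rewrite eq_le simplex_ge0 andbT leNgt; apply/negP/t0.
have st := simplex_ge0 t.
(* The interval of a vertex with positive coordinate is filled by the label of that vertex. *)
exists (psum (val t) i, psum (val t) i.+1), (hol_to c i).
have lt : psum (val t) i < psum (val t) i.+1.
  by rewrite {2}/psum sum_ordS -/(psum _ _) ltrDr.
split=> /=; first split=> //=.
- by have := psum_le st (leq0n i); rewrite psum0.
- by have := psum_le st (ltn_ord i); rewrite (psum_all _ (ltnSn n)) simplex_sum.
set u := psum _ i in lt *; set v := psum _ i.+1 in lt *.
rewrite /hmass /= (bigD1 i) /=; last exact/asboolP.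
have -> : wt u v (val t) i = v - u.
  by rewrite /wt -/u -/v clamp_hi ?clamp_lo // ltW.
rewrite mulrDr.
apply: (@lt_le_trans _ _ (2 * (v - u))); first lra.
rewrite lerDl mulr_ge0 //; apply: sumr_ge0 => j _; exact: wt_ge0.
Qed.

Lemma majG uv b g : maj uv b g -> G g.
Proof.
case: b => n [c t] [[u0 lt v1]]; rewrite /hmass /=.
case: (pickP (fun i : 'I_n.+1 => `[< hol_to c i = g >])) => [i /asboolP <- _|p0].
  exact: hol_toG.
by rewrite big_pred0 // => m; exfalso; move: m; rewrite mulr0; lra.
Qed.

(** In the extension by [a] every vertex with label [g] receives [letter g a], so the mass of this
    letter is at least that of [g]. *)
Lemma maj_vmaj uv b g a : maj uv b g -> vmaj uv (ext_cell a b) (letter g a).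
Proof.
case: b => n [c t] [suv m]; split=> //; apply: (lt_le_trans m).
rewrite ler_pM2l // /hmass /vmass /=.
rewrite [leRHS](bigID (fun i : 'I_n.+1 => `[< hol_to c i = g >])) /=.
rewrite [X in _ <= X + _](eq_bigl (fun i : 'I_n.+1 => `[< hol_to c i = g >])) => [|i].
  rewrite lerDl; apply: sumr_ge0 => i _; apply: wt_ge0; exact: simplex_ge0.
by apply/andb_idl => /asboolP <-; rewrite vtx_ext_chain.
Qed.

(** [k] accounts for the change of first vertex. The same [k] serves the frame and the labels, which
    makes the coordinate [g \o k] of a frame [frame b \o k] well defined. *)
Definition cell_rel (b b' : cells) : Prop :=
  exists k, [/\ G k, frame b = frame b' \o k,
    (forall uv g, maj uv b' g <-> maj uv b (g \o k)) &
    (forall uv a, vmaj uv b' a <-> vmaj uv b a)].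

Lemma cell_rel_glued b b' : glued_by b b' -> cell_rel b b'.
Proof.
move=> [m [n [th [c [c' [t [-> -> mth vth [hth fth]]]]]]]].
set h := hol_to c' (th ord0) in hth fth.
have [k [kG hk kh]] := autgroup_inv Pinv (hol_toG c' (th ord0)).
rewrite -/h in hk kh.
have sumE uv (p : pred 'I_m.+1) (q : pred 'I_n.+1) :
    (forall j, p j = q (th j)) ->
    \sum_(i | q i) wt uv.1 uv.2 (val (push th t)) i =
    \sum_(j | p j) wt uv.1 uv.2 (val t) j.
  move=> pq; rewrite [RHS](partition_big th q) /=; last by move=> j; rewrite pq.
  apply: eq_bigr => i qi; rewrite wt_push //.
  by apply: eq_bigl => j; apply/esym/andb_idl => /eqP ji; rewrite pq ji.
exists k; split=> //.
- by rewrite -fth -compA hk.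
- move=> uv g; rewrite /maj /hmass /=.
  rewrite (sumE uv (fun j => `[< hol_to c j = g \o k >])) // => j.
  rewrite -hth; apply/asboolP/asboolP => [->|<-]; first by rewrite -compA kh.
  by rewrite -compA hk.
- by move=> uv a; rewrite /vmaj /vmass /= (sumE uv (fun j => vtx c j 0%N == a)) // => j; rewrite vth.
Qed.

Lemma cell_rel_eq b b' : to_realization b = to_realization b' -> cell_rel b b'.
Proof.
move/to_realization_eq; elim=> {b b'} [b b'|b|b b' _|b b' b'' _ + _].
- by move/glueP/cell_rel_glued.
- exists id; split=> //; exact: autgroup1.
- move=> [k [kG bb' mm vv]].
  have [h [hG kh hk]] := autgroup_inv Pinv kG; exists h; split=> //.
  + by rewrite bb' -compA kh.
  + by move=> uv g; rewrite mm -compA hk.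
  + by move=> uv a; rewrite vv.
- move=> [k [kG bb' mm vv]] [k' [kG' bb'' mm' vv']].
  exists (k' \o k); split.
  + exact: autgroupM.
  + by rewrite bb' bb''.
  + by move=> uv g; rewrite mm' mm.
  + by move=> uv a; rewrite vv' vv.
Qed.

Local Notation f := (@realization_map R L L (limit_shift Pinv)).

Lemma shift_cell_glue b b' : Defs.glue b b' ->
  Defs.glue (shift_cell b) (shift_cell b' : cells).
Proof.
case=> [n i c t|n i c t]; rewrite /shift_cell /presimplices_map /=.
  by rewrite -!/(shift_chain _) shift_face; exact: glue_face.
by rewrite -!/(shift_chain _) shift_degen; exact: glue_degen.
Qed.

(** [realization_map] picks a representative; the choice does not matter because the shift respects
    gluing. *)
Lemma realization_shift b : f (to_realization b) = to_realization (shift_cell b).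
Proof.
have := to_realization_eq (of_realizationK (to_realization b)).
rewrite /realization_map -/(shift_cell _); move: (of_realization _) => b'.
elim=> {b b'} [b b'|//|b b' _ ->//|b b' b'' _ -> _ -> //].
by move=> /shift_cell_glue/to_realization_glue.
Qed.

Lemma iter_frame (b : cells) w : iter (size w) f (frame b w) = to_realization b.
Proof.
elim: w b => [|a w IH] b //=.
by rewrite IH realization_shift shift_ext_cell.
Qed.

Lemma frame_surj n (y : X) (b : cells) : iter n f y = to_realization b ->
  exists2 w, size w = n & y = frame b w.
Proof.
elim: n y b => [|n IH] y b /=; first by move=> ->; exists [::].
have [w1 w1n] := IH y (of_realization (iter n f y)) (esym (of_realizationK _)).
move: (of_realization _) => b1 yw fy.
have {fy}: to_realization (shift_cell b1) = to_realization b.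
  by rewrite -fy yw -w1n iter_frame realization_shift.
case/cell_rel_eq => k [kG bb _ _].
case: b1 yw bb => m [c t] yw bb.
(* The cell extends its own shift by one letter, so [y] has a word over that shift, and [k] turns
   this word into one over [b]. *)
have E : cell c t = ext_cell (vtx c ord0 0%N) (shift_cell (cell c t)).
  rewrite /ext_cell /shift_cell /presimplices_map /= -/(shift_chain _).
  by rewrite ext_chain_shift.
exists (k (vtx c ord0 0%N :: w1)); first by rewrite (autgroup_size _ kG) /= w1n.
by rewrite -[RHS]/((frame b \o k) _) -bb /= -E.
Qed.

(** The first letter is recovered from the majority letter of the preimage it leads to, because
    [letter g] is injective. *)
Lemma frame_inj (b : cells) w w' : size w = size w' -> frame b w = frame b w' -> w = w'.
Proof.
elim: w w' b => [|a w IH] [|a' w'] b //= [sw] E.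
have Ea : to_realization (ext_cell a b) = to_realization (ext_cell a' b).
  by rewrite -(iter_frame _ w) -(iter_frame _ w') E sw.
have [uv [g mg]] := maj_exists b.
have [k [_ _ _ /(_ uv) vv]] := cell_rel_eq Ea.
have /(letter_inj Pinv (majG mg)) aa' : letter g a = letter g a'.
  by apply: (@vmaj_uniq uv (ext_cell a b)); [|apply/vv]; exact: maj_vmaj.
by rewrite aa' in E *; rewrite (IH _ _ sw E).
Qed.

Lemma frame_injG (b : cells) k k' : G k -> G k' -> frame b \o k = frame b \o k' -> k = k'.
Proof.
move=> kG kG' E; apply/funext => w; apply: (@frame_inj b).
  by rewrite (autgroup_size _ kG) (autgroup_size _ kG').
exact: (congr1 (@^~ w) E).
Qed.

End Charts.

(** * Openness of majorities and the flat bundle of frames *)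

Lemma clamp_continuous (R : realType) (u v : R) : continuous (clamp u v : R^o -> R^o).
Proof.
move=> x; apply: (@continuous_min R R (fun x => Num.max x u) (cst v)); last exact: cvg_cst.
by apply: (@continuous_max R R id (cst u)); [exact: cvg_id|exact: cvg_cst].
Qed.

Lemma wt_continuous (R : realType) n (u v : R) i :
  continuous (fun t : simplex R n => wt u v (val t) i : R^o).
Proof.
have ct j : continuous (fun t : simplex R n => (val t : _ -> R) j : R^o).
  move=> t; apply: (@continuous_comp _ _ _ (fun t : simplex R n => val t) (@^~ j)).
    exact: initial_continuous.
  exact: (@proj_continuous 'I_n.+1 (fun=> R) j).
have cs k : continuous (fun t : simplex R n => psum (val t) k : R^o).
  by apply: continuous_big => [|j _]; [exact: add_continuous|exact: ct].
have cc k : continuous (fun t : simplex R n => clamp u v (psum (val t) k) : R^o).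
  by move=> t; exact: (continuous_comp (cs k t) (@clamp_continuous R u v _)).
by move=> t; exact: (cvgB (cc i.+1 t) (cc i t)).
Qed.

Section FrameBundle.
Variables (R : realType) (A Q : finType) (P : automaton A Q).
Hypothesis Pinv : invertible P.

Local Notation G := (autgroup P).
Local Notation L := (limit_groupoid Pinv).
Local Notation X := (realization L R).
Local Notation cells := (presimplices L R).
Local Notation f := (@realization_map R L L (limit_shift Pinv)).

Section NearChain.
Variable n : nat.
Implicit Types c : chain L n.

Lemma near_arr_chain c (i : 'I_n) k : \forall c' \near c,
  (val (arr c' i)).1 k = (val (arr c i)).1 k /\
  (val (arr c' i)).2 k = (val (arr c i)).2 k.
Proof.
have ca : continuous (fun c : chain L n => arr c i : lim_arr P).
  move=> c'; apply: (@continuous_comp _ _ _ (fun c : chain L n => (val c).2) (@^~ i)).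
    apply: (@continuous_comp _ _ _ (fun c : chain L n => val c) snd).
      exact: initial_continuous.
    exact: cvg_snd.
  exact: (@proj_continuous 'I_n (fun=> lim_arr P) i).
exact: (ca c _ (near_arr (arr c i) k)).
Qed.

Lemma near_vtx_chain c (i : 'I_n.+1) k : \forall c' \near c, vtx c' i k = vtx c i k.
Proof.
have ca : continuous (fun c : chain L n => vtx c i : lim_obj A).
  move=> c'; apply: (@continuous_comp _ _ _ (fun c : chain L n => (val c).1) (@^~ i)).
    apply: (@continuous_comp _ _ _ (fun c : chain L n => val c) fst).
      exact: initial_continuous.
    exact: cvg_fst.
  exact: (@proj_continuous 'I_n.+1 (fun=> lim_obj A) i).
exact: (ca c _ (near_obj (vtx c i) k)).
Qed.

Lemma coc_type_eq (e e' : lim_arr P) : (val e').1 0%N = (val e).1 0%N ->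
  (val e').2 0%N = (val e).2 0%N -> coc_type e' = coc_type e.
Proof. by move=> e1 e2; apply: autgroup_fun_inj; rewrite /autgroup_fun /= e1 e2. Qed.

Lemma near_coc_at c k : \forall c' \near c, coc_at c' k = coc_at c k.
Proof.
rewrite /coc_at; case: insubP => [i _ _|_]; last by near=> c'.
apply: filterS (near_arr_chain c i 0) => c' [e1 e2].
by rewrite /coc (coc_type_eq e1 e2).
Unshelve. all: by end_near.
Qed.

(** [hol_to] sees the arrows only through their letter and state at position -1, and both are
    discrete. *)
Lemma near_hol_to1 c k : \forall c' \near c, hol_to c' k = hol_to c k.
Proof.
elim: k => [|k IH] /=; first by near=> c'.
by apply: filterS2 IH (near_coc_at c k) => c' -> ->.
Unshelve. all: by end_near.
Qed.

Lemma near_hol_to c : \forall c' \near c, forall i : 'I_n.+1, hol_to c' i = hol_to c i.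
Proof.
apply: (@filter_forall _ _ (fun (i : 'I_n.+1) c' => hol_to c' i = hol_to c i) (nbhs c)) => i.
exact: near_hol_to1.
Qed.

Lemma ext_chain_continuous a : continuous (ext_chain a : chain L n -> chain L n).
Proof.
move=> c; apply: (@cvg_set_type _ _ _ (nbhs c)).
have c1 : (fun c' => (val (ext_chain a c')).1) @ nbhs c --> (val (ext_chain a c)).1.
  apply: cvg_ptws => i; apply: cvg_lim_obj => -[|k] /=.
    by apply: filterS (near_hol_to1 c i) => c' ->.
  exact: near_vtx_chain.
have c2 : (fun c' => (val (ext_chain a c')).2) @ nbhs c --> (val (ext_chain a c)).2.
  apply: cvg_ptws => i; apply: cvg_lim_arr => -[|k] /=.
    apply: filterS2 (near_hol_to1 c i) (near_arr_chain c i 0) => c' -> [e1 e2].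
    by rewrite (coc_type_eq e1 e2).
  exact: near_arr_chain.
rewrite (_ : (fun c' => val (ext_chain a c')) =
  (fun c' => ((val (ext_chain a c')).1, (val (ext_chain a c')).2))).
  by rewrite (surjective_pairing (val (ext_chain a c))); exact: (cvg_pair c1 c2).
by apply/funext => c'; rewrite -surjective_pairing.
Qed.

Lemma shift_chain_continuous : continuous (@shift_chain _ _ _ Pinv n).
Proof.
move=> c; apply: (@cvg_set_type _ _ _ (nbhs c)).
have c1 : (fun c' => (val (shift_chain c')).1) @ nbhs c --> (val (shift_chain c)).1.
  by apply: cvg_ptws => i; apply: cvg_lim_obj => k; exact: near_vtx_chain.
have c2 : (fun c' => (val (shift_chain c')).2) @ nbhs c --> (val (shift_chain c)).2.
  by apply: cvg_ptws => i; apply: cvg_lim_arr => k; exact: near_arr_chain.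
rewrite (_ : (fun c' => val (shift_chain c')) =
  (fun c' => ((val (shift_chain c')).1, (val (shift_chain c')).2))).
  by rewrite (surjective_pairing (val (shift_chain c))); exact: (cvg_pair c1 c2).
by apply/funext => c'; rewrite -surjective_pairing.
Qed.

End NearChain.

Lemma chainwise_continuous (F : forall n, chain L n -> chain L n) :
  (forall n, continuous (F n)) ->
  continuous (fun b : cells => cell (F _ (projT2 b).1) (projT2 b).2).
Proof.
move=> cF [n [c t]] B nB.
have cp : continuous (fun x : chain L n * simplex R n => (F n x.1, x.2)).
  apply: continuous_pair => x; last exact: cvg_snd.
  by apply: (@continuous_comp _ _ _ fst (F n)); [exact: cvg_fst|exact: cF].
exact: (cp (c, t) _ nB).
Qed.

Lemma ext_cell_continuous a : continuous (ext_cell a : cells -> cells).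
Proof.
by apply: (@chainwise_continuous (fun n => @ext_chain _ _ _ Pinv n a)) => n;
  exact: ext_chain_continuous.
Qed.

Lemma shift_cell_continuous : continuous (@shift_cell R _ _ _ Pinv).
Proof.
by apply: (@chainwise_continuous (fun n => @shift_chain _ _ _ Pinv n)) => n;
  exact: shift_chain_continuous.
Qed.

Lemma to_realization_continuous : continuous (@to_realization L R).
Proof. exact: pi_continuous. Qed.

Lemma realization_shift_continuous : continuous f.
Proof.
apply/quotient_continuous.
have -> : f \o \pi_(realization L R) = @to_realization L R \o @shift_cell R _ _ _ Pinv.
  by apply/funext => b; exact: realization_shift.
move=> b; apply: continuous_comp; first exact: shift_cell_continuous.
exact: to_realization_continuous.
Qed.

Lemma frame_continuous w : continuous (fun b : cells => frame b w).
Proof.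
elim: w => [|a w IH] b /=; first exact: to_realization_continuous.
exact: (continuous_comp (@ext_cell_continuous a b) (IH (ext_cell a b))).
Qed.

Lemma near_mass n (c : chain L n) (t : simplex R n) (p : chain L n -> pred 'I_n.+1)
    (u v x : R) :
  (\forall c' \near c, p c' = p c) ->
  x < \sum_(i | p c i) wt u v (val t) i ->
  \forall y \near (c, t), x < \sum_(i | p y.1 i) wt u v (val y.2) i.
Proof.
move=> np xs.
have ct : continuous (fun t : simplex R n => \sum_(i | p c i) wt u v (val t) i : R^o).
  by apply: continuous_big => [|i _]; [exact: add_continuous|exact: wt_continuous].
exists ([set c' | p c' = p c], [set t' | x < \sum_(i | p c i) wt u v (val t') i]).
  by split=> //=; exact: (cvgr_gt _ (ct t) _ xs).
by move=> [c' t'] [/= ->].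
Qed.

Lemma nbhs_cell n (c : chain L n) (t : simplex R n) (S : set cells) :
  (\forall y \near (c, t), S (cell y.1 y.2)) -> nbhs (cell c t) S.
Proof.
move=> H; change (nbhs (c, t) (existT (fun n => (chain L n * simplex R n)%type) n @^-1` S)).
by apply: filterS H => -[].
Qed.

Lemma maj_open uv g : open [set b : cells | maj uv b g].
Proof.
rewrite openE => -[n [c t]] [suv m]; rewrite /hmass /= in m; apply: nbhs_cell.
have m' : (uv.2 - uv.1) / 2 < \sum_(i < n.+1 | `[< hol_to c i = g >]) wt uv.1 uv.2 (val t) i by lra.
have np : \forall c' \near c, (fun i : 'I_n.+1 => `[< hol_to c' i = g >]) =
    (fun i : 'I_n.+1 => `[< hol_to c i = g >]).
  by apply: filterS (near_hol_to c) => c' E; apply/funext => i; rewrite E.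
have := near_mass (p := fun c (i : 'I_n.+1) => `[< hol_to c i = g >]) np m'.
apply: filterS => -[c' t'] /= h.
by split; rewrite ?/hmass /=; [exact: suv|lra].
Qed.

Lemma vmaj_open uv a : open [set b : cells | vmaj uv b a].
Proof.
rewrite openE => -[n [c t]] [suv m]; rewrite /vmass /= in m; apply: nbhs_cell.
have m' : (uv.2 - uv.1) / 2 < \sum_(i < n.+1 | vtx c i 0%N == a) wt uv.1 uv.2 (val t) i by lra.
have np : \forall c' \near c, (fun i : 'I_n.+1 => vtx c' i 0%N == a) =
    (fun i : 'I_n.+1 => vtx c i 0%N == a).
  have : \forall c' \near c, forall i, vtx c' i 0%N = vtx c i 0%N.
    apply: (@filter_forall _ _ (fun (i : 'I_n.+1) c' => vtx c' i 0%N = vtx c i 0%N) (nbhs c)) => i.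
    exact: near_vtx_chain.
  by apply: filterS => c' E; apply/funext => i; rewrite E.
have := near_mass (p := fun c (i : 'I_n.+1) => vtx c i 0%N == a) np m'.
apply: filterS => -[c' t'] /= h.
by split; rewrite ?/vmass /=; [exact: suv|lra].
Qed.

(** [cell_rel] holds between glued cells, so a set of cells that it preserves is the preimage of a
    subset of the realization. The charts and the other open sets constructed below arise this
    way. *)
Lemma saturated_open (N : set cells) : open N ->
  (forall b b', cell_rel b b' -> N b -> N b') ->
  exists2 V : set X, open V & forall b, V (to_realization b) <-> N b.
Proof.
move=> oN sN; exists [set z | N (of_realization z)].
  rewrite /open /= /quotient_open.
  rewrite (_ : _ @^-1` _ = N) //; apply/seteqP; split=> b.
    by apply: sN; apply: cell_rel_eq; exact: of_realizationK.
  by apply: sN; apply: cell_rel_eq; exact/esym/of_realizationK.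
by move=> b; split; apply: sN; apply: cell_rel_eq; rewrite of_realizationK.
Qed.

Definition is_frame : set (seq A -> X) :=
  [set th | exists b k, G k /\ th = frame b \o k].

Definition frames := set_type is_frame.

Lemma frames_subproof b k : G k -> frame b \o k \in is_frame.
Proof. by move=> kG; apply/mem_set; exists b, k. Qed.

Definition mk_frame b k (kG : G k) : frames := SigSub (frames_subproof b kG).

Definition frame_pt (th : frames) : X := val th [::].

Definition chart (uv : R * R) : set X :=
  [set z | exists b g, z = to_realization b /\ maj uv b g].

(** [r] compares the frame with the labelling read from the majority vertices. Being a set makes the
    coordinate total: it is a singleton over the chart ([coord_single]) and empty elsewhere. *)
Definition coord (uv : R * R) (th : frames) : set (seq A -> seq A) :=
  [set r | exists b g k, [/\ G k, val th = frame b \o k, maj uv b g & r = g \o k]].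

Lemma framesP (th : frames) : exists b k, G k /\ val th = frame b \o k.
Proof. exact: set_mem (valP th). Qed.

Lemma frame_ptE th b k : G k -> val th = frame b \o k -> frame_pt th = to_realization b.
Proof. by move=> kG E; rewrite /frame_pt E /= (autgroup_nil kG). Qed.

Lemma coord_single uv th r : coord uv th r -> coord uv th = [set r].
Proof.
move=> [b [g [k [kG E m ->]]]]; apply/seteqP; split=> [r'|_ ->]; last first.
  by exists b, g, k.
move=> [b' [g' [k' [kG' E' m' ->]]]].
have [h [hG bb mm _]] : cell_rel b b'.
  by apply: cell_rel_eq; rewrite -(frame_ptE kG E) -(frame_ptE kG' E').
have hk : h \o k = k'.
  apply: (frame_injG (b := b') (autgroupM hG kG) kG').
  by rewrite -E' E bb.
have -> : g = g' \o h by apply: (maj_uniq m); exact/mm.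
by rewrite -compA hk.
Qed.

Lemma coord_exists uv th b g : frame_pt th = to_realization b -> maj uv b g ->
  exists k, [/\ G k, val th = frame b \o k & coord uv th (g \o k)].
Proof.
move=> zb m; have [b' [k' [kG' E']]] := framesP th.
have [h [hG bb mm _]] : cell_rel b' b.
  by apply: cell_rel_eq; rewrite -(frame_ptE kG' E').
exists (h \o k'); split; first exact: autgroupM.
  by rewrite E' bb.
exists b, g, (h \o k'); split=> //; first exact: autgroupM.
by rewrite E' bb.
Qed.

Lemma coordG uv th r : coord uv th r -> G r.
Proof. by move=> [b [g [k [kG _ m ->]]]]; apply: autgroupM => //; exact: (majG m). Qed.

Lemma frame_bundle : flat_bundle frame_pt chart coord.
Proof.
split.
- move=> uv; pose N := [set b : cells | exists g, maj uv b g].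
  have oN : open N.
    rewrite (_ : N = \bigcup_g [set b | maj uv b g]).
      by apply: bigcup_open => g _; exact: maj_open.
    by apply/seteqP; split=> b [g] => [m|_ m]; exists g.
  have [|V oV VN] := saturated_open oN.
    move=> b b' [k [kG _ mm _]] [g m].
    have [h [hG kh hk]] := autgroup_inv Pinv kG.
    by exists (g \o h); apply/mm; rewrite -compA hk.
  rewrite (_ : chart uv = V) //; apply/seteqP; split=> z.
    by move=> [b [g [-> m]]]; apply/VN; exists g.
  rewrite -(of_realizationK z) => /VN [g m].
  by exists (of_realization z), g.
- move=> z; have [uv [g m]] := maj_exists (of_realization z).
  by exists uv, (of_realization z), g; rewrite of_realizationK.
- move=> uv th th' [b [g [zb m]]] zz E.
  have [k [kG bk ck]] := coord_exists zb m.
  rewrite zz in zb.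
  have [k' [kG' bk' ck']] := coord_exists zb m.
  apply: val_inj; rewrite bk bk'; congr (_ \o _).
  have : coord uv th' (g \o k) by rewrite -E.
  rewrite (coord_single ck') /= => gk; apply/funext => w.
  exact: (autgroup_inj Pinv (majG m) (congr1 (@^~ w) gk)).
- move=> uv th z [b [g [zb m]]] [b' [g' [-> m']]].
  have [k [kG bk ck]] := coord_exists zb m.
  have [h [hG gh hg]] := autgroup_inv Pinv (majG m').
  have hkG : G (h \o (g \o k)) by apply: autgroupM => //; exact: coordG ck.
  exists (mk_frame b' hkG); first by rewrite (@frame_ptE _ b' _ hkG).
  rewrite (coord_single ck); apply: coord_single.
  by exists b', g', (h \o (g \o k)); split=> //; rewrite compA gh.
- move=> uv uv' th [b [g [zb m]]] [b' [g' [zb' m']]].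
  have [k [kG bk ck]] := coord_exists zb m.
  have [k' [kG' bk' ck']] := coord_exists zb' m'.
  set r := g \o k in ck; set r' := g' \o k' in ck'.
  have rG := coordG ck; have rG' := coordG ck'.
  have [h [hG rh hr]] := autgroup_inv Pinv rG.
  (* The transition function that takes [r] to [r'] is left composition with [r' \o h]; [N] is where
     the two majority labels differ by this element. *)
  pose N := [set b : cells | exists g, maj uv b g /\ maj uv' b (r' \o h \o g)].
  have oN : open N.
    rewrite (_ : N = \bigcup_g ([set b | maj uv b g] `&` [set b | maj uv' b (r' \o h \o g)])).
      by apply: bigcup_open => gg _; apply: openI; exact: maj_open.
    by apply/seteqP; split=> b1 [gg] => [m1|_ m1]; exists gg.
  have [|V oV VN] := saturated_open oN.
    move=> b1 b2 [l [lG _ mm _]] [gg [m1 m2]].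
    have [l' [lG' ll' l'l]] := autgroup_inv Pinv lG.
    exists (gg \o l'); split; apply/mm.
      by rewrite -compA l'l.
    by rewrite -[_ \o l]/(r' \o h \o (gg \o (l' \o l))) l'l.
  have Vth : V (frame_pt th).
    rewrite zb; apply/VN; exists g; split=> //.
    have [l [lG bb mm _]] : cell_rel b b' by apply: cell_rel_eq; rewrite -zb -zb'.
    rewrite (_ : _ \o g = g' \o l); first exact/mm.
    have lk : l \o k = k'.
      by apply: (frame_injG (b := b') (autgroupM lG kG) kG'); rewrite -bk' bk bb.
    have [j [jG kj jk]] := autgroup_inv Pinv kG.
    have -> : g = r \o j by rewrite /r -compA kj.
    have -> : r' \o h \o (r \o j) = r' \o (h \o r) \o j by [].
    by rewrite hr /r' -lk; rewrite -[LHS]/(g' \o l \o (k \o j)) kj.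
  have := open_nbhs_nbhs (conj oV Vth); apply: filterS => z.
  rewrite -(of_realizationK z) => /VN [gg [m1 m2]] th' zth' E.
  have [k1 [kG1 bk1 ck1]] := coord_exists zth' m1.
  have : coord uv th' r by rewrite E.
  rewrite (coord_single ck1) /= => Er.
  rewrite (coord_single ck'); apply: coord_single.
  exists (of_realization z), (r' \o h \o gg), k1; split=> //.
  by rewrite -[_ \o k1]/(r' \o h \o (gg \o k1)) -Er -[RHS]/(r' \o (h \o r)) hr.
Qed.

End FrameBundle.

(** * Transport of frames and lifts of paths *)

Lemma within_postcomp (R : realType) (X Y : topologicalType) (J : set R)
    (g : X -> Y) (q : R -> X) :
  continuous g -> {within J, continuous q} -> {within J, continuous (g \o q)}.
Proof. by move=> cg cq s; exact: (continuous_comp (cq s) (cg _)). Qed.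

Section Transport.
Variables (R : realType) (A Q : finType) (P : automaton A Q).
Hypothesis Pinv : invertible P.

Local Notation G := (autgroup P).
Local Notation L := (limit_groupoid Pinv).
Local Notation X := (realization L R).
Local Notation cells := (presimplices L R).
Local Notation f := (@realization_map R L L (limit_shift Pinv)).
Local Notation frames := (@frames R A Q P Pinv).
Local Notation par := (parallel (@frame_pt R A Q P Pinv)
  (@chart R A Q P Pinv) (@coord R A Q P Pinv)).

Lemma maj_ext uv (b : cells) g a : maj uv b g -> maj uv (ext_cell a b) (sect g [:: a]).
Proof.
case: b => n [c t] [suv m]; split=> //; apply: (lt_le_trans m).
rewrite ler_pM2l // /hmass /=.
rewrite [leRHS](bigID (fun i : 'I_n.+1 => `[< hol_to c i = g >])) /=.
rewrite [X in _ <= X + _](eq_bigl (fun i : 'I_n.+1 => `[< hol_to c i = g >])) => [|i].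
  rewrite lerDl; apply: sumr_ge0 => i _; apply: wt_ge0; exact: simplex_ge0.
by apply/andb_idl => /asboolP <-; apply/asboolP; rewrite hol_to_ext.
Qed.

Lemma tail_subproof l (th : frames) : val th \o cons l \in @is_frame R A Q P Pinv.
Proof.
have [b [k [kG E]]] := framesP th; apply/mem_set.
exists (ext_cell (letter k l) b), (sect k [:: l]); split.
  exact: autgroup_sect1.
by apply/funext => w; rewrite E /= (autgroup_cons _ _ kG).
Qed.

(* The frame that th induces at the preimage th [:: l] of its base point. *)
Definition tail_frame l (th : frames) : frames := SigSub (tail_subproof l th).

Lemma coord_tail uv l th r :
  coord uv th r -> coord uv (tail_frame l th) (sect r [:: l]).
Proof.
move=> [b [g [k [kG E m ->]]]].
exists (ext_cell (letter k l) b), (sect g [:: letter k l]), (sect k [:: l]); split.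
- exact: autgroup_sect1.
- by apply/funext => w; rewrite /= E /= (autgroup_cons _ _ kG).
- exact: maj_ext.
- by rewrite sect_comp //; [exact: autgroup_tree_hom kG|exact: autgroup_tree_hom (majG m)].
Qed.

Lemma act_subproof (th : frames) g : G g ->
  val th \o g \in @is_frame R A Q P Pinv.
Proof.
have [b [k [kG E]]] := framesP th => gG; apply/mem_set.
by exists b, (k \o g); split; [exact: autgroupM|rewrite E].
Qed.

Definition act (th : frames) g (gG : G g) : frames := SigSub (act_subproof th gG).

Lemma coord_act uv th g (gG : G g) r : coord uv th r -> coord uv (act th gG) (r \o g).
Proof.
move=> [b [h [k [kG E m ->]]]]; exists b, h, (k \o g); split=> //.
  exact: autgroupM.
by rewrite /= E.
Qed.

Lemma frame_pt_act th g (gG : G g) : frame_pt (act th gG) = frame_pt th.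
Proof. by rewrite /frame_pt /= (autgroup_nil gG). Qed.

Lemma act_trans (th th' : frames) : frame_pt th = frame_pt th' ->
  exists g, exists gG : G g, th' = act th gG.
Proof.
have [b [k [kG E]]] := framesP th; have [b' [k' [kG' E']]] := framesP th'.
rewrite (frame_ptE kG E) (frame_ptE kG' E') => /esym bb'.
have [h [hG bb mm _]] := cell_rel_eq bb'.
have [j [jG kj jk]] := autgroup_inv Pinv kG.
exists (j \o (h \o k')), (autgroupM jG (autgroupM hG kG')).
apply: val_inj; rewrite /= E E' bb.
by rewrite -[RHS]/(frame b \o ((k \o j) \o (h \o k'))) kj.
Qed.

Lemma frames_inj (th : frames) w w' : size w = size w' -> val th w = val th w' -> w = w'.
Proof.
have [b [k [kG E]]] := framesP th; rewrite E => sw /(frame_inj _) kw.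
apply: (autgroup_inj Pinv kG); apply: kw.
by rewrite !(autgroup_size _ kG).
Qed.

Lemma act_inj (th : frames) g g' (gG : G g) (gG' : G g') :
  act th gG = act th gG' -> g = g'.
Proof.
move=> /(congr1 val) /= E; apply/funext => w.
apply: (@frames_inj th); first by rewrite !(autgroup_size w gG) (autgroup_size w gG').
exact: (congr1 (@^~ w) E).
Qed.

Lemma iter_frames (th : frames) w : iter (size w) f (val th w) = frame_pt th.
Proof.
have [b [k [kG E]]] := framesP th.
by rewrite (frame_ptE kG E) E /= -(autgroup_size w kG) iter_frame.
Qed.

Lemma frames_surj n y (th : frames) : iter n f y = frame_pt th ->
  exists2 w, size w = n & y = val th w.
Proof.
have [b [k [kG E]]] := framesP th; rewrite (frame_ptE kG E) => /frame_surj[w wn ->].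
have [j [jG kj jk]] := autgroup_inv Pinv kG.
exists (j w); first by rewrite (autgroup_size _ jG).
by rewrite E -[RHS]/(frame b ((k \o j) w)) kj.
Qed.

Lemma frame_exists (z : X) : exists th : frames, frame_pt th = z.
Proof.
exists (mk_frame (of_realization z) (autgroup1 P)).
by rewrite /frame_pt /= of_realizationK.
Qed.

Lemma parallel_coord (J : set R) (p : R -> X) Th s0 : {within J, continuous p} ->
  par J p Th -> J s0 -> exists uv r, [/\ chart uv (p s0), coord uv (Th s0) r &
    \forall s \near s0, J s -> coord uv (Th s) r].
Proof.
move=> cp pT Js0; have [zs0 [uv Uuv nr]] := pT _ Js0.
have [b [g [zb m]]] := Uuv; rewrite zb in zs0.
have [k [kG E ck]] := coord_exists zs0 m.
exists uv, (g \o k); split=> //.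
by apply: filterS nr => s + Js => /(_ Js) ->.
Qed.

(** The group acts on frames, and hence on coordinates, by composition on the right, while changes
    of chart compose on the left. *)
Lemma parallel_act (J : set R) p Th g (gG : G g) : par J p Th -> par J p (fun s => act (Th s) gG).
Proof.
move=> pT s0 Js0; have [zs0 [uv Uuv nr]] := pT _ Js0.
have [b [h [zb m]]] := Uuv; rewrite zb in zs0.
have [k [kG E ck]] := coord_exists zs0 m.
split; first by rewrite frame_pt_act zb zs0.
exists uv => //; apply: filterS nr => s + Js => /(_ Js) Es.
rewrite (coord_single (coord_act gG ck)); apply: coord_single.
by apply: coord_act; rewrite Es.
Qed.

(** This supplies lifts: [val (Th s) w] is a path over [p] for the iterate of the shift map of order
    [size w]. *)
Lemma parallel_continuous (J : set R) (p : R -> X) Th w : {within J, continuous p} ->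
  par J p Th -> {within J, continuous (fun s => val (Th s) w)}.
Proof.
move=> cp pT; apply/subspace_continuousP => s0 Js0 V.
rewrite nbhsE => -[V' [oV' V's0] sV].
have {}V's0 : V' (val (Th s0) w) by [].
have [uv [r [_ cr nr]]] := parallel_coord cp pT Js0.
(* Over a cell with majority label [g], a frame with coordinate [r] is [frame b \o h] with
   [g \o h = r]. The condition on its point at [w] is then saturated and open. *)
pose N := [set b : cells | exists g h, [/\ maj uv b g, G h, g \o h = r & V' (frame b (h w))]].
have oN : open N.
  rewrite (_ : N = \bigcup_(gh in [set gh : (seq A -> seq A) * (seq A -> seq A) | G gh.2 /\ gh.1 \o gh.2 = r])
      ([set b | maj uv b gh.1] `&` (fun b => frame b (gh.2 w)) @^-1` V')).
    apply: bigcup_open => -[g h] _; apply: openI; first exact: maj_open.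
    by move/continuousP: (@frame_continuous R A Q P Pinv (h w)); exact.
  apply/seteqP; split=> b.
    by move=> [g [h [m hG gh v]]]; exists (g, h).
  by move=> [[g h] [/= hG gh] [m v]]; exists g, h.
have [|W oW WN] := saturated_open oN.
  move=> b1 b2 [k [kG bb mm _]] [g [h [m hG gh v]]].
  have [j [jG kj jk]] := autgroup_inv Pinv kG.
  exists (g \o j), (k \o h); split.
  - by apply/mm; rewrite -[_ \o k]/(g \o (j \o k)) jk.
  - exact: autgroupM.
  - by rewrite -gh -[LHS]/(g \o (j \o k) \o h) jk.
  - by move: v; rewrite bb.
have [b0 [g0 [k0 [kG0 E0 m0 r0]]]] := cr.
have W0 : W (p s0).
  rewrite -(pT _ Js0).1 (frame_ptE kG0 E0); apply/WN; exists g0, k0; split=> //.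
  by move: V's0; rewrite E0.
have nW := within_near cp Js0 (open_nbhs_nbhs (conj oW W0)).
apply: filterS2 nr nW => s cs Ws Js; apply: sV.
have [b [g [k [kG E m rk]]]] := cs Js.
have := Ws Js; rewrite -(pT _ Js).1 (frame_ptE kG E).
move=> /WN [g' [h [m' hG gh v]]]; move: gh; rewrite -(maj_uniq m m') rk => gh.
have hk : h = k; last first.
  by rewrite -[from_subspace _ _ _]/(val (Th s) w) E -hk.
by apply/funext => w'; apply: (autgroup_inj Pinv (majG m)); exact: (congr1 (@^~ w') gh).
Qed.

(** The points of [Th s] at words of length one are separated by majority letters, an open
    condition, so a lift of [p] cannot leave the point labelled [l]. Sections of a constant
    coordinate are constant, which makes the tails parallel. *)
Lemma parallel_tail (J : set R) (p q : R -> X) Th a l : is_interval J ->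
  {within J, continuous p} -> {within J, continuous q} ->
  (forall s, J s -> f (q s) = p s) -> par J p Th -> J a ->
  q a = val (Th a) [:: l] -> par J q (fun s => tail_frame l (Th s)).
Proof.
move=> iJ cp cq fq pT Ja qa.
have qT s : J s -> q s = val (Th s) [:: l].
  move=> Js; suff -> : (q s = val (Th s) [:: l]) = (q a = val (Th a) [:: l]) by [].
  apply: (locally_constant_itv (c := fun s => q s = val (Th s) [:: l]) iJ) => // s0 Js0.
  have letters s1 : J s1 -> exists x, q s1 = val (Th s1) [:: x].
    move=> Js1; have /(@frames_surj 1)[[|x []] // _ ->] : f (q s1) = frame_pt (Th s1).
      by rewrite (pT _ Js1).1 fq.
    by exists x.
  have [uv [r [_ cr nr]]] := parallel_coord cp pT Js0.
  have [l0 ql0] := letters _ Js0.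
  have vm s1 x : coord uv (Th s1) r -> q s1 = val (Th s1) [:: x] ->
      exists2 b, q s1 = to_realization b & vmaj uv b (letter r x).
    move=> [b [g [k [kG E m ->]]]] ->.
    exists (ext_cell (letter k x) b); first by rewrite E /= (letterE _ (autgroup_tree_hom kG)).
    rewrite letter_comp; [|exact: autgroup_tree_hom kG|exact: autgroup_tree_hom (majG m)].
    exact: maj_vmaj.
  (* [letter r l0] is the majority letter of [q s0]; the lift keeps it nearby, and [letter r] is
     injective. *)
  have [|W oW WN] := saturated_open (@vmaj_open R A Q P Pinv uv (letter r l0)).
    by move=> b b' [k [_ _ _ vv]] /vv.
  have W0 : W (q s0) by have [b -> m] := vm _ _ cr ql0; exact/WN.
  have nW := within_near cq Js0 (open_nbhs_nbhs (conj oW W0)).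
  apply: filterS2 nr nW => s1 cs Ws Js1.
  have [x qx] := letters _ Js1; have [b qb mb] := vm _ _ (cs Js1) qx.
  have xl : x = l0.
    apply: (letter_inj Pinv (coordG cr)); apply: (vmaj_uniq mb).
    by apply/WN; rewrite -qb; exact: Ws.
  rewrite qx xl ql0; apply/propext; split=> /frames_inj.
    by move=> /(_ erefl)[->].
  by move=> /(_ erefl)[->].
move=> s0 Js0; split; first by rewrite qT.
have [uv [r [Uuv cr nr]]] := parallel_coord cp pT Js0.
exists uv.
  have [b [g [k [kG E m rk]]]] := coord_tail l cr.
  by exists b, g; split=> //; rewrite qT // -(frame_ptE kG E).
apply: filterS nr => s cs Js; rewrite (coord_single (coord_tail l cr)).
by apply: coord_single; apply: coord_tail; exact: cs.
Qed.

(** One letter at a time: the intermediate image [q1] of [q] is a lift of [p], and the tail frame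
    over it handles the remaining word. *)
Lemma parallel_lift (J : set R) (p q : R -> X) Th a w : is_interval J ->
  {within J, continuous p} -> {within J, continuous q} ->
  (forall s, J s -> iter (size w) f (q s) = p s) -> par J p Th -> J a ->
  q a = val (Th a) w -> forall s, J s -> q s = val (Th s) w.
Proof.
move=> iJ + cq; elim: w p Th => [|l w IH] p Th cp fq pT Ja qa s Js.
  by rewrite -[RHS]/(frame_pt (Th s)) (pT _ Js).1 -fq.
pose q1 := iter (size w) f \o q.
have cq1 : {within J, continuous q1}.
  rewrite /q1; elim: (size w) => [|n IHn] //.
  exact: (@within_postcomp R X X J f _ (@realization_shift_continuous R A Q P Pinv) IHn).
have fq1 s1 : J s1 -> f (q1 s1) = p s1 by move=> /fq.
have q1a : q1 a = val (Th a) [:: l].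
  by rewrite /q1 /= qa -[val _ _]/(val (tail_frame l (Th a)) w) iter_frames.
have pq1 := parallel_tail iJ cp cq1 fq1 pT Ja q1a.
exact: (IH _ _ cq1 _ pq1).
Qed.

End Transport.

(** * Finiteness of sections and contraction *)

Section FiniteState.
Variables (A Q : finType) (P : automaton A Q).

Local Notation G := (autgroup P).
Implicit Types (g h k : seq A -> seq A).

Lemma sect_nil g : sect g [::] = g.
Proof. by apply/funext => w; rewrite /sect drop0. Qed.

Lemma sect_cat g v w : sect (sect g v) w = sect g (v ++ w).
Proof. by apply/funext => u; rewrite /sect drop_drop catA size_cat addnC. Qed.

Lemma autgroup_sect g v : G g -> G (sect g v).
Proof.
elim: v g => [|a v IH] g gG; first by rewrite sect_nil.
by rewrite -cat1s -sect_cat; apply: IH; exact: autgroup_sect1.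
Qed.

Lemma autgroup_cat g v w : G g -> g (v ++ w) = g v ++ sect g v w.
Proof. by move=> /autgroup_tree_hom/tree_hom_cat ->. Qed.

Lemma sectM g h v : G g -> G h -> sect (g \o h) v = sect g (h v) \o sect h v.
Proof.
move=> gG hG; apply/funext => w; rewrite {1}/sect /= (autgroup_cat _ _ hG).
by rewrite (autgroup_cat _ _ gG) drop_size_cat // (autgroup_size _ gG) (autgroup_size _ hG).
Qed.

(** A section of a product is a product of sections, and a section of an inverse is the inverse of a
    section. *)
Lemma finite_sects g : G g -> finite_set (range (sect g)).
Proof.
elim=> {g} [|q|g h gG fg hG fh|g h gG fg gK hK].
- apply: (@sub_finite_set _ _ [set id]); last exact: finite_set1.
  by move=> _ [v _ <-]; exact: sect_id.
- apply: (@sub_finite_set _ _ (range (run P))); last exact: finite_image (@finite_finset Q setT).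
  move=> _ [v _ <-].
  elim: v q => [|a v IH] q; first by exists q => //; rewrite sect_nil.
  by rewrite -cat1s -sect_cat (run_cons P q a).2.
- apply: (@sub_finite_set _ _ [set k \o l | k in range (sect g) & l in range (sect h)]);
  last exact: finite_image2.
  move=> _ [v _ <-]; rewrite sectM //.
  by exists (sect g (h v)); [exists (h v)|exists (sect h v); first by exists v].
(* Inversion as a total function, [id] on maps without inverse, so that the sections of [h] lie in
   the image of a finite set. *)
- pose inv k := if pselect (exists l, cancel k l /\ cancel l k) is left e
    then projT1 (cid e) else id.
  apply: (@sub_finite_set _ _ (inv @` range (sect g))); last exact: finite_image.
  move=> _ [v _ <-].
  have hG := autgroupV gG gK hK.
  have E1 := sectM v gG hG; have E2 := sectM (h v) hG gG.
  rewrite (_ : g \o h = id) ?sect_id in E1; last exact/funext.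
  rewrite (_ : h \o g = id) ?sect_id ?hK in E2; last exact/funext.
  have c1 : cancel (sect g (h v)) (sect h v) by move=> w; have := congr1 (@^~ w) E2.
  have c2 : cancel (sect h v) (sect g (h v)) by move=> w; have := congr1 (@^~ w) E1.
  exists (sect g (h v)); first by exists (h v).
  rewrite /inv; case: pselect => [e|[]]; last by exists (sect h v).
  case: cid => l [/= kl lk]; apply/funext => w.
  by rewrite -{1}[w]c2 kl.
Qed.

Definition products (B : set (seq A -> seq A)) n :=
  iter n (fun C => [set g \o h | g in B & h in C]) [set id].

Lemma products_finite B n : finite_set B -> finite_set (products B n).
Proof. by move=> fB; elim: n => [|n IH]; [exact: finite_set1|exact: finite_image2]. Qed.

Lemma productsD B m n g h : products B m g -> products B n h -> products B (m + n) (g \o h).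
Proof.
elim: m g => [|m IH] g; first by move=> ->.
by move=> [k Bk [l Bl <-]] nh; exists k => //; exists (l \o h) => //; exact: IH.
Qed.

Lemma products_le B m n : B id -> (m <= n)%N -> products B m `<=` products B n.
Proof.
move=> B1 /subnK <- g; elim: (n - m)%N => [|d IH] // /IH gd.
by exists id => //; exists g.
Qed.

Lemma products_G B n : B `<=` G -> products B n `<=` G.
Proof.
move=> BG; elim: n => [|n IH] g; first by move=> ->; exact: autgroup1.
by move=> [k /BG kG [l /IH lG <-]]; exact: autgroupM.
Qed.

Section Contracting.
Hypothesis Pcon : contracting P.

(** Closing [K] and a contracting set under sections keeps them finite by [finite_sects]. There are
    then finitely many products of two elements, and one level sends all their sections into [B].
    The level [n.+1] is positive because it later serves as a block length. *)
Lemma contracting_core (K : set (seq A -> seq A)) : finite_set K -> K `<=` G ->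
  exists B n, [/\ finite_set B, K `<=` B, B id, B `<=` G &
    (forall g v, B g -> B (sect g v)) /\
    forall g h v, B g -> B h -> size v = n.+1 -> B (sect (g \o h) v)].
Proof.
move=> fK KG; have [N [fN NG con]] := Pcon.
pose K1 := K `|` N `|` [set id].
have fK1 : finite_set K1 by rewrite !finite_setU; split=> //; exact: finite_set1.
have K1G : K1 `<=` G by move=> g [[/KG|/NG]|->] //; exact: autgroup1.
pose B := \bigcup_(g in K1) range (sect g).
have K1B : K1 `<=` B by move=> g Kg; exists g => //; exists [::] => //; exact: sect_nil.
have BG : B `<=` G by move=> _ [g /K1G gG [v _ <-]]; exact: autgroup_sect.
have Bs g v : B g -> B (sect g v).
  by move=> [h Kh [u _ <-]]; exists h => //; exists (u ++ v) => //; rewrite sect_cat.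
have fB : finite_set B by apply: bigcup_finite => // g /K1G/finite_sects.
have lev g : G g -> exists n, forall v, (n <= size v)%N -> B (sect g v).
  move=> /con [n nN]; exists n => v nv.
  rewrite -(cat_take_drop n v) -sect_cat; apply: Bs; apply: K1B; left; right.
  by apply: nN; exists (take n v) => //=; rewrite size_takel.
have [s sE] : exists s : seq (seq A -> seq A), [set g \o h | g in B & h in B] = [set` s].
  by apply/finite_seqP; exact: finite_image2.
have [n nB] : exists n, forall g v, g \in s -> (n <= size v)%N -> B (sect g v).
  have : forall g, g \in s -> G g.
    move=> g gs; have : [set` s] g by [].
    by rewrite -sE => -[k /BG kG [l /BG lG <-]]; exact: autgroupM.
  elim: (s) => [|g s' IH] sG; first by exists 0%N.
  have [|n nB] := IH; first by move=> k ks; apply: sG; rewrite inE ks orbT.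
  have [|m mB] := lev g; first by apply: sG; rewrite mem_head.
  exists (maxn m n) => k v; rewrite geq_max inE => /orP[/eqP ->|ks] /andP[mv nv].
    exact: mB.
  exact: nB.
exists B, n; split=> //; first by move=> g Kg; apply: K1B; left; left.
- by apply: K1B; right.
- split=> // g h v Bg Bh vn; apply: nB; last by rewrite vn leqnSn.
  suff : [set` s] (g \o h) by [].
  by rewrite -sE; exists g => //; exists h.
Qed.

Variable ka : A -> seq A -> seq A.
Hypothesis kaG : forall a, G (ka a).

(** If [phi] maps [a :: w] to an image of [a] followed by [phi (ka a w)], then after [a] the map
    [phi \o g] continues as [phi \o twist g a]. The iterated twists of [id] thus describe the states
    of [phi]. *)
Definition twist g a := ka (letter g a) \o sect g [:: a].

(* The states at level n of a product of 2m elements of B form a product of m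
   elements, while n steps of the twist contribute n more factors; so products
   of 2n + 2 elements are stable under n steps. *)
Lemma twist_finite : exists F : set (seq A -> seq A),
  [/\ finite_set F, F `<=` G, F id & forall g a, F g -> F (twist g a)].
Proof.
have [B [n' [fB KB B1 BG [Bs Bn]]]] : exists B n, [/\ finite_set B, range ka `<=` B, B id, B `<=` G &
    (forall g v, B g -> B (sect g v)) /\
    forall g h v, B g -> B h -> size v = n.+1 -> B (sect (g \o h) v)].
  apply: contracting_core => [|_ [a _ <-]]; last exact: kaG.
  exact: finite_image (@finite_finset A setT).
set n := n'.+1 in Bn.
have prG m := @products_G B m BG.
have prs m g v : products B m g -> products B m (sect g v).
  elim: m g v => [|m IH] g v; first by move=> ->; exact: sect_id.
  move=> [k Bk [l Bl <-]]; rewrite sectM; [|exact: BG|exact: prG Bl].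
  by exists (sect k (l v)); [exact: Bs|exists (sect l v) => //; exact: IH].
have half m g v : products B m.*2 g -> size v = n -> products B m (sect g v).
  elim: m g v => [|m IH] g v; first by move=> ->; rewrite sect_id.
  move=> [k Bk [_ [k' Bk' [l Bl <-]] <-]] vn.
  rewrite compA sectM; [|by apply: autgroupM; exact: BG|exact: prG Bl].
  exists (sect (k \o k') (l v)); last by exists (sect l v) => //; exact: IH.
  by apply: Bn => //; rewrite (autgroup_size _ (prG _ _ Bl)).
pose tw g w := foldl twist g w.
have twE g w : G g -> exists2 h, products B (size w) h & tw g w = h \o sect g w.
  elim/last_ind: w => [|w a IH] gG; first by exists id => //; rewrite sect_nil.
  have [h hB E] := IH gG; rewrite /tw -cats1 foldl_cat -/(tw g w) /= E /twist.
  rewrite size_cat addn1 -sect_cat sectM; last 2 first.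
  - exact: prG hB.
  - exact: autgroup_sect.
  eexists; last by rewrite compA.
  exists (ka (letter (h \o sect g w) a)); first by apply: KB; exists (letter (h \o sect g w) a).
  by eexists; first exact: (prs _ _ (sect g w [:: a]) hB).
have block g w : products B n.*2.+2 g -> size w = n -> products B n.*2.+2 (tw g w).
  move=> gB wn; have [h hB ->] := twE g w (prG _ _ gB); rewrite wn in hB.
  rewrite (_ : n.*2.+2 = (n + n.+2)%N); last by rewrite -addnn; lia.
  apply: productsD => //; apply: (@products_le _ n.+1) => //.
  by apply: half => //; rewrite doubleS.
have blocks m g w : products B n.*2.+2 g -> size w = (m * n)%N -> products B n.*2.+2 (tw g w).
  elim: m g w => [|m IH] g w gB wm.
    by move/size0nil: wm => ->.
  rewrite -(cat_take_drop n w) /tw foldl_cat; apply: IH.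
    by apply: block => //; rewrite size_takel // wm mulSn leq_addr.
  by rewrite size_drop wm mulSn addKn.
exists (range (tw id)); split.
- apply: (@sub_finite_set _ _ (products B (n + n.*2.+2))); last exact: products_finite.
  move=> _ [w _ <-].
  have id2 : products B n.*2.+2 id by apply: (@products_le _ 0).
  (* Full blocks of length [n] stay among the products of 2n + 2 elements; the fewer than [n]
     remaining letters add at most [n] factors. *)
  rewrite -(cat_take_drop (size w %/ n * n)%N w) /tw foldl_cat -/(tw id _) -/(tw _ _).
  have B1' : products B n.*2.+2 (tw id (take (size w %/ n * n)%N w)).
    by apply: (@blocks (size w %/ n)%N id) => //; rewrite size_takel // leq_trunc_div.
  have [h hB ->] := twE _ (drop (size w %/ n * n)%N w) (prG _ _ B1').
  apply: productsD; last exact: prs.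
  apply: products_le hB => //; rewrite size_drop.
  by rewrite {1}(divn_eq (size w) n) addKn ltnW // ltn_pmod.
- move=> _ [w _ <-]; have [h hB ->] := twE id w (autgroup1 P).
  by apply: autgroupM; [exact: prG hB|exact: autgroup_sect (autgroup1 P)].
- by exists [::].
- by move=> _ a [w _ <-]; exists (rcons w a) => //; rewrite /tw -cats1 foldl_cat.
Qed.
End Contracting.
End FiniteState.

(* A path from [src c] to [tgt c] by ternary subdivision: the middle third of
   the interval of [c] is [mid c], the outer thirds recur to [left c] and
   [right c]. Points that are never in a middle third get a value common to all
   hulls of their branch. *)
Section TernaryPath.
Variables (R : realType) (X : topologicalType) (C Y : Type) (pi : Y -> X).
Variables (src tgt : C -> Y) (left right : C -> C) (mid : C -> R -> Y).
Variable hull : C -> set Y.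

Local Notation J := (`[0, 1]%classic : set R).

Hypothesis src_left : forall c, src (left c) = src c.
Hypothesis tgt_right : forall c, tgt (right c) = tgt c.
Hypothesis tgt_left : forall c, pi (tgt (left c)) = pi (mid c 0).
Hypothesis src_right : forall c, pi (src (right c)) = pi (mid c 1).
Hypothesis mid_cont : forall c, continuous (pi \o mid c).
Hypothesis hull_src : forall c, hull c (src c).
Hypothesis hull_tgt : forall c, hull c (tgt c).
Hypothesis hull_mid : forall c u, J u -> hull c (mid c u).
Hypothesis hull_left : forall c, hull (left c) `<=` hull c.
Hypothesis hull_right : forall c, hull (right c) `<=` hull c.
Hypothesis branches : forall cs : nat -> C,
  (forall n, cs n.+1 = left (cs n) \/ cs n.+1 = right (cs n)) ->
  (exists y, forall n, hull (cs n) y) /\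
  forall y, (forall n, hull (cs n) y) -> forall V, nbhs (pi y) V ->
    exists n, forall y', hull (cs n) y' -> V (pi y').
Hypothesis branches_uniq : forall cs : nat -> C,
  (forall n, cs n.+1 = left (cs n) \/ cs n.+1 = right (cs n)) ->
  forall y y', (forall n, hull (cs n) y) -> (forall n, hull (cs n) y') ->
  pi y = pi y'.

Implicit Types (x : C * R) (s t : R).

Definition middle s := (3^-1 <= s) && (s <= 2 * 3^-1).

Definition descend x : C * R :=
  if middle x.2 then x else
  if x.2 < 3^-1 then (left x.1, 3 * x.2) else (right x.1, 3 * x.2 - 2).

Definition orb x n := iter n descend x.

Lemma orbS x n : orb x n.+1 = orb (descend x) n.
Proof. exact: iterSr. Qed.

(** A relation, since several [y] may lie in all hulls of a branch; only [pi y] is determined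
    ([value_uniq]). *)
Definition value x (y : Y) : Prop :=
  (exists2 n, middle (orb x n).2 & y = mid (orb x n).1 (3 * (orb x n).2 - 1)) \/
  (forall n, ~~ middle (orb x n).2 /\ hull (orb x n).1 y).

Lemma descend_middle x : middle x.2 -> descend x = x.
Proof. by rewrite /descend => ->. Qed.

Lemma orb_middle x n : middle x.2 -> orb x n = x.
Proof. by move=> m; elim: n => //= n ->; exact: descend_middle. Qed.

Lemma value_middle x y : middle x.2 -> value x y <-> y = mid x.1 (3 * x.2 - 1).
Proof.
move=> m; split=> [[[n _]|/(_ 0%N)[]]|->]; first by rewrite (orb_middle n m).
  by rewrite m.
by left; exists 0%N.
Qed.

Lemma descend_hull x : hull (descend x).1 `<=` hull x.1.
Proof.
rewrite /descend; case: ifP => _; first exact: subset_refl.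
by case: (x.2 < 3^-1) => /=; [exact: hull_left|exact: hull_right].
Qed.

Lemma value_descend x y : value x y <-> value (descend x) y.
Proof.
have [m|m] := boolP (middle x.2); first by rewrite descend_middle.
split=> -[[n mn ->]|H].
- left; case: n mn => [|n] mn; first by rewrite mn in m.
  by rewrite orbS in mn *; exists n.
- by right=> n; rewrite -orbS.
- by left; exists n.+1; rewrite orbS.
- right=> -[|n]; last by rewrite orbS.
  by split=> //; apply: descend_hull; exact: (H 0%N).2.
Qed.

Lemma descend_itv x : J x.2 -> J (descend x).2.
Proof.
case: x => c s; rewrite /= !in_itv /= => /andP[s0 s1].
rewrite /descend /middle /=; case: ifP => [_|/negbT]; first by apply/andP.
rewrite negb_and -!ltNge => /orP[lt|lt].
  by rewrite lt /=; apply/andP; split; lra.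
rewrite ifF /=; first by apply/andP; split; lra.
by apply/negbTE; rewrite -leNgt; lra.
Qed.

Lemma orb_itv x n : J x.2 -> J (orb x n).2.
Proof. by move=> Jx; elim: n => //= n; exact: descend_itv. Qed.

Lemma orb_branch x : (forall n, ~~ middle (orb x n).2) ->
  forall n, (orb x n.+1).1 = left (orb x n).1 \/ (orb x n.+1).1 = right (orb x n).1.
Proof.
move=> H n; rewrite -[orb x n.+1]/(descend (orb x n)) /descend ifN //.
by case: ifP; [left|right].
Qed.

Lemma value_hull x y : J x.2 -> value x y -> hull x.1 y.
Proof.
move=> Jx [[n mn ->]|/(_ 0%N)[]//].
have : hull (orb x n).1 `<=` hull x.1.
  elim: n {mn} => [|n IH] /=; first exact: subset_refl.
  apply: (subset_trans _ IH); exact: descend_hull.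
apply; apply: hull_mid; move: mn => /andP[? ?].
by rewrite /= in_itv /=; apply/andP; split; lra.
Qed.

Lemma value_exists x : J x.2 -> exists y, value x y.
Proof.
move=> Jx; have [[n mn]|H] := pselect (exists n, middle (orb x n).2).
  by eexists; left; exists n.
have H' n : ~~ middle (orb x n).2 by apply/negP => m; apply: H; exists n.
have [[y yP] _] := branches (orb_branch H').
by exists y; right.
Qed.

Lemma value_uniq x y y' : value x y -> value x y' -> pi y = pi y'.
Proof.
move=> [[n mn ->]|H] [[n' mn' ->]|H'].
- wlog le : n n' mn mn' / (n <= n')%N.
    move=> W; case/orP: (leq_total n n') => le; first exact: W le.
    by apply/esym; exact: W le.
  have -> // : orb x n' = orb x n.
  by rewrite -(subnK le) /orb iterD; exact: orb_middle.
- by have [] := H' n; rewrite mn.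
- by have [] := H n'; rewrite mn'.
- apply: (branches_uniq (orb_branch (fun n => (H n).1))) => n.
    exact: (H n).2.
  exact: (H' n).2.
Qed.

(** Continuity for all selections of values at once, so that it can be proved before a path is
    selected. *)
Definition cont_at x := forall y V, value x y -> nbhs (pi y) V ->
  \forall s \near x.2, J s -> forall y', value (x.1, s) y' -> V (pi y').

Lemma near_nmiddle s : ~~ middle s ->
  (\forall s' \near s, ~~ middle s' && ((s' < 3^-1) == (s < 3^-1))).
Proof.
rewrite /middle negb_and -!ltNge => /orP[lt|lt].
  apply: filterS (lt_nbhsl lt) => s' lt'.
  by rewrite lt lt' eqxx andbT negb_and -!ltNge lt'.
apply: filterS (lt_nbhsr lt) => s' lt'.
rewrite negb_and -!ltNge lt' orbT /=.
by rewrite !ltNge (ltW (lt_trans _ lt)) ?(ltW (lt_trans _ lt')) //; lra.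
Qed.

Let aff_cont (a b : R) : continuous (fun s : R => a * s + b).
Proof. by move=> s; apply: cvgD; [apply: cvgM; [exact: cvg_cst|exact: cvg_id]|exact: cvg_cst]. Qed.

Lemma near_descend x (D : C * R -> Prop) : ~~ middle x.2 ->
  (\forall s \near (descend x).2, J s -> D ((descend x).1, s)) ->
  \forall s \near x.2, J s -> D (descend (x.1, s)).
Proof.
case: x => c s /= nm; have nn := near_nmiddle nm.
have aux d (a b : R) : (forall s', ~~ middle s' -> (s' < 3^-1) = (s < 3^-1) ->
      descend (c, s') = (d, a * s' + b)) ->
    (\forall s' \near (descend (c, s)).2, J s' -> D ((descend (c, s)).1, s')) ->
    \forall s0 \near s, J s0 -> D (descend (c, s0)).
  move=> dE; rewrite (dE _ nm erefl) /= => /aff_cont; rewrite /= nbhs_simpl /=.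
  apply: filterS2 nn => s' /andP[nm' /eqP lt] K Js'.
  have := @descend_itv (c, s') Js'; rewrite dE //; exact: K.
have [lt|lt] := boolP (s < 3^-1).
  apply: (aux (left c) 3 0) => s' nm' lt'.
  by rewrite /descend /= (negbTE nm') lt' lt addr0.
apply: (aux (right c) 3 (-2)) => s' nm' lt'.
by rewrite /descend /= (negbTE nm') lt' (negbTE lt).
Qed.

Lemma cont_at_descend x : ~~ middle x.2 -> cont_at (descend x) -> cont_at x.
Proof.
move=> nm H y V /value_descend vy nV.
have := @near_descend _ (fun x => forall y', value x y' -> V (pi y')) nm (H _ _ vy nV).
by apply: filterS => s + Js y' /value_descend; apply.
Qed.

Lemma near_orb n x : (forall m, ~~ middle (orb x m).2) ->
  \forall s \near x.2, J s -> (orb (x.1, s) n).1 = (orb x n).1.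
Proof.
elim: n x => [|n IH] x H; first by near=> s.
have H' m : ~~ middle (orb (descend x) m).2 by rewrite -orbS.
have := @near_descend _ (fun x' => (orb x' n).1 = (orb (descend x) n).1) (H 0%N) (IH _ H').
by apply: filterS => s + Js; rewrite !orbS; apply.
Unshelve. all: by end_near.
Qed.

(** Nearby points make the same first [n] choices of left and right, so their values lie in the
    [n]-th hull, whose image is inside [V] for a suitable [n]. *)
Lemma cont_at_branch x : (forall n, ~~ middle (orb x n).2) -> cont_at x.
Proof.
move=> H y V vy nV.
have vh n : hull (orb x n).1 y.
  by case: vy => [[m mm]|/(_ n)[]//]; have := H m; rewrite mm.
have [_ /(_ _ vh _ nV)[n nh]] := branches (orb_branch H).
apply: filterS (near_orb n H) => s sP Js y' vy'; apply: nh.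
rewrite -sP //; apply: value_hull; first exact: orb_itv.
by elim: (n) => // m; move/value_descend.
Qed.

Lemma orb0 c n : ~~ middle (orb (c, 0) n).2 /\ orb (c, 0) n = (iter n left c, 0).
Proof.
have nm0 : ~~ middle 0 by rewrite /middle negb_and -!ltNge; apply/orP; left; lra.
elim: n => [|n [nm E]]; first by split.
suff -> : orb (c, 0) n.+1 = (iter n.+1 left c, 0) by split.
by rewrite /= {}E in nm *; rewrite /descend (negbTE nm) /= ifT ?mulr0 //; lra.
Qed.

Lemma orb1 c n : ~~ middle (orb (c, 1) n).2 /\ orb (c, 1) n = (iter n right c, 1).
Proof.
have nm1 : ~~ middle 1 by rewrite /middle negb_and -!ltNge; apply/orP; right; lra.
elim: n => [|n [nm E]]; first by split.
suff -> : orb (c, 1) n.+1 = (iter n.+1 right c, 1) by split.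
rewrite /= {}E in nm *; rewrite /descend (negbTE nm) /= ifF; first by congr pair; lra.
by apply/negbTE; rewrite -leNgt; lra.
Qed.

Lemma value0 c : value (c, 0) (src c).
Proof.
right=> n; have [nm E] := orb0 c n; split=> //; rewrite E /=.
have -> : src c = src (iter n left c) by elim: (n) => //= m ->; rewrite src_left.
exact: hull_src.
Qed.

Lemma value1 c : value (c, 1) (tgt c).
Proof.
right=> n; have [nm E] := orb1 c n; split=> //; rewrite E /=.
have -> : tgt c = tgt (iter n right c) by elim: (n) => //= m ->; rewrite tgt_right.
exact: hull_tgt.
Qed.

(** At an end of the middle third the other side lies in an outer third. There continuity is that at
    an end point of the outer interval, whose orbit never meets a middle third, and the values match
    by [tgt_left] and [src_right]. *)
Lemma cont_at_middle x : middle x.2 -> cont_at x.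
Proof.
case: x => c s m y V /(value_middle y m) -> /= nV; rewrite /= in m.
have aff_near (a b r : R) (D : set R) : r = a * s + b -> nbhs r D ->
    \forall s' \near s, D (a * s' + b).
  by move=> ->; exact: aff_cont.
have n1 : \forall s' \near s, V (pi (mid c (3 * s' - 1))).
  exact: (@aff_cont 3 (-1) s _ (@mid_cont c (3 * s - 1) V nV)).
have n2 : \forall s' \near s, s' < 3^-1 -> J (3 * s') ->
    forall y', value (left c, 3 * s') y' -> V (pi y').
  move: m => /andP[]; rewrite le_eqVlt => /orP[/eqP se|lt] _; last first.
    by apply: filterS (lt_nbhsr lt) => s' ? ?; exfalso; lra.
  have n1' : nbhs (pi (tgt (left c))) V.
    by rewrite tgt_left; move: nV; congr (nbhs (pi (mid c _)) V); rewrite -se; lra.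
  have := @cont_at_branch (left c, 1) (fun n => (orb1 (left c) n).1) _ _ (value1 _) n1'.
  have e : 1 = 3 * s + 0 by rewrite -se; lra.
  by move=> /(aff_near _ _ _ _ e); apply: filterS => s' + _; rewrite addr0.
have n3 : \forall s' \near s, 2 * 3^-1 < s' -> J (3 * s' - 2) ->
    forall y', value (right c, 3 * s' - 2) y' -> V (pi y').
  move: m => /andP[_]; rewrite le_eqVlt => /orP[/eqP se|lt]; last first.
    by apply: filterS (lt_nbhsl lt) => s' ? ?; exfalso; lra.
  have n1' : nbhs (pi (src (right c))) V.
    by rewrite src_right; move: nV; congr (nbhs (pi (mid c _)) V); rewrite se; lra.
  have := @cont_at_branch (right c, 0) (fun n => (orb0 (right c) n).1) _ _ (value0 _) n1'.
  have e : 0 = 3 * s + (-2) by rewrite se; lra.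
  by move=> /(aff_near _ _ _ _ e); apply: filterS => s' + _.
apply: filterS3 n1 n2 n3 => s' n1 n2 n3 Js' y' v.
have [m'|nm'] := boolP (middle s'); first by have /(@value_middle (c, s') y' m') -> := v.
move/value_descend in v; have := @descend_itv (c, s') Js'.
move: v; rewrite /descend /= (negbTE nm'); case: ifP => lt /= v J'; first exact: n2 lt J' _ v.
apply: n3 J' _ v; move: nm'; rewrite /middle negb_and -!ltNge => /orP[|//].
by rewrite lt.
Qed.

Lemma cont_at_itv x : J x.2 -> cont_at x.
Proof.
move=> Jx; have [[n mn]|H] := pselect (exists n, middle (orb x n).2); last first.
  by apply: cont_at_branch => n; apply/negP => m; apply: H; exists n.
elim: n x Jx mn => [|n IH] x Jx mn; first exact: cont_at_middle.
have [m|m] := boolP (middle x.2); first exact: cont_at_middle.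
by apply: cont_at_descend => //; apply: IH; [exact: descend_itv|rewrite -orbS].
Qed.

Lemma ternary_path c : exists h : R -> Y,
  [/\ {within J, continuous (pi \o h)}, forall s, J s -> hull c (h s),
      pi (h 0) = pi (src c) & pi (h 1) = pi (tgt c)].
Proof.
have [h hP] : exists h : R -> Y, forall s, J s -> value (c, s) (h s).
  have ex s : exists y, J s -> value (c, s) y.
    have [Js|nJ] := pselect (J s); last by exists (src c).
    by have [y] := @value_exists (c, s) Js; exists y.
  by have [h] := choice ex; exists h.
exists h; split.
- apply/subspace_continuousP => s0 Js0 V nV.
  by apply: filterS (@cont_at_itv (c, s0) Js0 _ _ (hP _ Js0) nV) => s K Js; apply: K (hP _ Js).
- by move=> s Js; exact: (@value_hull (c, s) _ Js (hP _ Js)).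
- apply: (@value_uniq (c, 0)); last exact: value0.
  by apply: hP; rewrite /= in_itv /= lexx ler01.
- apply: (@value_uniq (c, 1)); last exact: value1.
  by apply: hP; rewrite /= in_itv /= lexx ler01.
Qed.

End TernaryPath.

(** * Frames joined along simplices and edges *)

Section SimplexPaths.
Variable R : realType.


Lemma clamp01_itv (s : R) : 0 <= clamp 0 1 s <= 1.
Proof. by rewrite /clamp le_min le_max lexx ler01 orbT /= ge_min lexx orbT. Qed.

Section Segment.
Variables (n : nat) (t t' : simplex R n).

Lemma segment_subproof (s : R) :
  ((fun i => (1 - clamp 0 1 s) * (val t : _ -> R) i + clamp 0 1 s * (val t' : _ -> R) i)
    : {ptws 'I_n.+1 -> R}) \in
  [set t : {ptws 'I_n.+1 -> R} | (forall i, 0 <= t i) /\ \sum_i t i = 1].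
Proof.
have /andP[c0 c1] := clamp01_itv s; apply/mem_set; split=> [i|] /=.
  by apply: addr_ge0; apply: mulr_ge0; rewrite ?subr_ge0 //; exact: simplex_ge0.
by rewrite big_split /= -!mulr_sumr !simplex_sum; lra.
Qed.

(** The parameter is clamped to [0,1], so the segment is defined and continuous on the whole
    line. *)
Definition segment (s : R) : simplex R n := SigSub (segment_subproof s).

Lemma segment0 : segment 0 = t.
Proof.
apply: val_inj; apply/funext => i /=.
by rewrite clamp_lo ?ler01 // subr0 mul1r mul0r addr0.
Qed.

Lemma segment1 : segment 1 = t'.
Proof.
apply: val_inj; apply/funext => i /=.
by rewrite clamp_hi ?ler01 // subrr mul0r mul1r add0r.
Qed.

Lemma segment_continuous : continuous segment.
Proof.
move=> s; apply: (@cvg_set_type _ _ _ (nbhs s)); apply: cvg_ptws => i /=.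
by apply: cvgD; apply: cvgM; try exact: cvg_cst; [apply: cvgB; first exact: cvg_cst|];
  exact: clamp_continuous.
Qed.

End Segment.

Lemma vertex_subproof : ((fun=> 1) : {ptws 'I_1 -> R}) \in
  [set t : {ptws 'I_1 -> R} | (forall i, 0 <= t i) /\ \sum_i t i = 1].
Proof. by apply/mem_set; split=> [i|] /=; rewrite ?ler01 ?big_ord_recl ?big_ord0 ?addr0. Qed.

Definition vertex : simplex R 0 := SigSub vertex_subproof.

Lemma simplex0 (t : simplex R 0) : t = vertex.
Proof.
apply: val_inj; apply/funext => i /=; have := simplex_sum t.
by rewrite big_ord_recl big_ord0 addr0 (ord1 i).
Qed.

End SimplexPaths.

Definition fun_cat (R : realType) (T : Type) (u v : R -> T) : R -> T :=
  fun t => if t <= 2^-1 then u (2 * t) else v (2 * t - 1).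

Section Connected.
Variables (R : realType) (A Q : finType) (P : automaton A Q).
Hypothesis Pinv : invertible P.

Local Notation G := (autgroup P).
Local Notation L := (limit_groupoid Pinv).
Local Notation X := (realization L R).
Local Notation cells := (presimplices L R).
Local Notation frames := (@frames R A Q P Pinv).
Local Notation bundle := (@frame_bundle R A Q P Pinv).
Local Notation par := (parallel (@frame_pt R A Q P Pinv)
  (@chart R A Q P Pinv) (@coord R A Q P Pinv)).
Local Notation J := (`[0, 1]%classic : set R).

Lemma parallel_cat (p p' : R -> X) (Th Th' : R -> frames) :
  {within J, continuous p} -> {within J, continuous p'} -> p 1 = p' 0 ->
  par J p Th -> par J p' Th' -> Th 1 = Th' 0 ->
  par J (path_cat p p') (fun_cat Th Th').
Proof.
move=> cp cp' pp' pT pT' TT'.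
have ccat : {within J, continuous (path_cat p p')}.
  by have [] := @path_cat_is_path R X p p' _ _ _ (And3 cp erefl erefl) (And3 cp' (esym pp') erefl).
have h0 : 0 <= 2^-1 :> R by lra.
have h1 : 2^-1 <= 1 :> R by lra.
have h2 : 2 * 2^-1 = 1 :> R by lra.
apply: (parallel_glue bundle h0 h1 ccat).
  apply: (@parallel_eq _ _ _ _ _ _ _ _ _ (p \o (fun s => 2 * s)) _ (Th \o (fun s => 2 * s))).
  - by move=> s; rewrite /= in_itv /= /path_cat => /andP[_ ->].
  - by move=> s; rewrite /= in_itv /= /fun_cat => /andP[_ ->].
  - apply: parallel_comp pT => [s|s]; first by apply: cvgM; [exact: cvg_cst|exact: cvg_id].
    by rewrite /= !in_itv /= => /andP[? ?]; apply/andP; split; lra.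
apply: (@parallel_eq _ _ _ _ _ _ _ _ _ (p' \o (fun s => 2 * s - 1)) _ (Th' \o (fun s => 2 * s - 1))).
- move=> s; rewrite /= in_itv /= /path_cat => /andP[s2 _]; case: ifP => // s2'.
  have -> : s = 2^-1 by apply/eqP; rewrite eq_le s2 s2'.
  by rewrite /= h2 subrr pp'.
- move=> s; rewrite /= in_itv /= /fun_cat => /andP[s2 _]; case: ifP => // s2'.
  have -> : s = 2^-1 by apply/eqP; rewrite eq_le s2 s2'.
  by rewrite /= h2 subrr TT'.
- apply: parallel_comp pT' => [s|s].
    by apply: cvgB; [apply: cvgM; [exact: cvg_cst|exact: cvg_id]|exact: cvg_cst].
  by rewrite /= !in_itv /= => /andP[? ?]; apply/andP; split; lra.
Qed.

Lemma parallel_rev (p : R -> X) (Th : R -> frames) :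
  par J p Th -> par J (path_rev p) (Th \o (fun s => 1 - s)).
Proof.
apply: parallel_comp => [s|s]; first by apply: cvgB; [exact: cvg_cst|exact: cvg_id].
by rewrite /= !in_itv /= => /andP[? ?]; apply/andP; split; lra.
Qed.

Definition frames_joined (th th' : frames) : Prop :=
  exists p Th, [/\ {within J, continuous p}, par J p Th, Th 0 = th & Th 1 = th'].

Let J0 : J 0. Proof. by rewrite /= in_itv /= lexx ler01. Qed.
Let J1 : J 1. Proof. by rewrite /= in_itv /= lexx ler01. Qed.

Lemma joined_refl th : frames_joined th th.
Proof.
exists (cst (frame_pt th)), (cst th); split=> //.
  by apply: continuous_subspaceT => s; exact: cvg_cst.
move=> s _; split=> //; have [uv Uuv] := chart_cover bundle (frame_pt th).
by exists uv => //; near=> s'.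
Unshelve. all: by end_near.
Qed.

Lemma joined_sym th th' : frames_joined th th' -> frames_joined th' th.
Proof.
move=> [p [Th [cp pT T0 T1]]]; exists (path_rev p), (Th \o (fun s => 1 - s)); split.
- by have [] := path_rev_is_path (And3 cp erefl erefl : is_path p (p 0) (p 1)).
- exact: parallel_rev.
- by rewrite /= subr0.
- by rewrite /= subrr.
Qed.

Lemma joined_trans th2 th1 th3 :
  frames_joined th1 th2 -> frames_joined th2 th3 -> frames_joined th1 th3.
Proof.
move=> [p [Th [cp pT T0 T1]]] [p' [Th' [cp' pT' T0' T1']]].
have pp' : p 1 = p' 0 by rewrite -(pT _ J1).1 -(pT' _ J0).1 T1 T0'.
exists (path_cat p p'), (fun_cat Th Th'); split.
- by have [] := @path_cat_is_path R X p p' _ _ _ (And3 cp erefl erefl) (And3 cp' (esym pp') erefl).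
- by apply: parallel_cat => //; rewrite T1.
- by rewrite /fun_cat mulr0 invr_ge0 ler0n.
- rewrite /fun_cat ifF; last by apply/negbTE; rewrite -ltNge; lra.
  by rewrite (_ : 2 * 1 - 1 = 1) //; lra.
Qed.

Lemma joined_act th th' g (gG : G g) : frames_joined th th' -> frames_joined (act th gG) (act th' gG).
Proof.
move=> [p [Th [cp pT <- <-]]]; exists p, (fun s => act (Th s) gG); split=> //.
exact: parallel_act.
Qed.

Definition cell_frame (b : cells) : frames := mk_frame b (autgroup1 P).

Lemma coord_cell uv b g : maj uv b g -> coord uv (cell_frame b) g.
Proof. by move=> m; exists b, g, id; split=> //; exact: autgroup1. Qed.

(** Along the segment the chain is fixed, and with it the first vertex that the frame starts from; a
    majority label persists for nearby parameters. *)
Lemma joined_simplex n (c : chain L n) (t t' : simplex R n) :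
  frames_joined (cell_frame (cell c t)) (cell_frame (cell c t')).
Proof.
pose b s : cells := cell c (segment t t' s).
have cb : continuous b.
  move=> s V nV; have cc : continuous (fun s => (c, segment t t' s)).
    by apply: continuous_pair => s'; [exact: cvg_cst|exact: segment_continuous].
  exact: (cc s _ nV).
exists (@to_realization L R \o b), (cell_frame \o b); split; last 2 first.
- by rewrite /b /= segment0.
- by rewrite /b /= segment1.
- apply: continuous_subspaceT => s; apply: continuous_comp; first exact: cb.
  exact: to_realization_continuous.
move=> s0 _; split=> //; have [uv [g m]] := maj_exists (b s0).
exists uv; first by exists (b s0), g.
have nm : \forall s \near s0, maj uv (b s) g.
  exact: (cb s0 _ (open_nbhs_nbhs (conj (@maj_open R A Q P Pinv uv g) m))).
by apply: filterS nm => s m' _; rewrite (coord_single (coord_cell m')) (coord_single (coord_cell m)).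
Qed.

Lemma obj_chain_subproof (al : lim_obj A) :
  ((fun=> al), fun=> Defs.lim_id P al) \in is_chain (G := L) (n := 0).
Proof. by apply/mem_set => -[]. Qed.

Definition obj_chain al : chain L 0 := SigSub (obj_chain_subproof al).

Lemma arr_chain_subproof (e : lim_arr P) :
  ((fun i : 'I_2 => if i == ord0 then lim_src e else lim_tgt e), fun=> e)
    \in is_chain (G := L) (n := 1).
Proof. by apply/mem_set => i; rewrite (ord1 i). Qed.

Definition arr_chain e : chain L 1 := SigSub (arr_chain_subproof e).

Lemma chain0E (c : chain L 0) : c = obj_chain (vtx c ord0).
Proof. by apply: chain_eq => [i|[]//]; rewrite (ord1 i). Qed.

Lemma hol_to_arr_chain e : hol_to (arr_chain e) 1 = coc e.
Proof. by rewrite /= (coc_at_ord (arr_chain e) ord0). Qed.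

Definition obj_frame al : frames := cell_frame (cell (obj_chain al) (vertex R)).

(** All weight is moved to the face opposite the last vertex. It has the same first vertex, hence
    the same frame, and induction on the dimension ends at that vertex. *)
Lemma joined_obj_frame b : exists al, frames_joined (cell_frame b) (obj_frame al).
Proof.
case: b => n [c t]; exists (vtx c ord0); elim: n c t => [|n IH] c t.
  by rewrite (simplex0 t) /obj_frame -(chain0E c); exact: joined_refl.
pose t0 : simplex R n := push (fun=> ord0) (vertex R).
apply: joined_trans (joined_simplex c t (push (lift ord_max) t0)) _.
have -> : cell_frame (cell c (push (lift ord_max) t0)) = cell_frame (cell (face ord_max c) t0).
  by apply: val_inj; rewrite /= -frame_face.
have -> : vtx c ord0 = vtx (face ord_max c) ord0 by congr vtx; exact: val_inj.
exact: IH.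
Qed.

Definition edge_cell (y : lim_arr P * R) : cells :=
  cell (arr_chain y.1)
    (segment (push (lift ord_max) (vertex R)) (push (lift ord0) (vertex R)) y.2).

Lemma edge_cell0 e : cell_frame (edge_cell (e, 0)) = obj_frame (lim_src e).
Proof.
apply: val_inj; rewrite /edge_cell /= segment0 -frame_face.
by rewrite (chain0E (face _ _)).
Qed.

Lemma edge_cell1 e : cell_frame (edge_cell (e, 1)) = act (obj_frame (lim_tgt e)) (cocG e).
Proof.
apply: val_inj; rewrite /edge_cell /= segment1 -frame_face.
by rewrite (chain0E (face _ _)) -hol_to_arr_chain.
Qed.

(** Along the edge the frame is read from the source; at the other end this is the frame of the
    target precomposed with [coc e]. *)
Lemma joined_arr e : frames_joined (obj_frame (lim_src e)) (act (obj_frame (lim_tgt e)) (cocG e)).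
Proof. by rewrite -edge_cell0 -edge_cell1; exact: joined_simplex. Qed.

Lemma edge_cell_id al u : to_realization (edge_cell (Defs.lim_id P al, u)) =
  to_realization (cell (obj_chain al) (vertex R)).
Proof.
have E : arr_chain (Defs.lim_id P al) = degen ord0 (obj_chain al).
  apply: chain_eq => i; first by rewrite /vtx /=; case: ifP.
  by rewrite /arr /= /degen_arr; case: unlift.
rewrite /edge_cell /= E.
by rewrite (to_realization_glue (glue_degen _ _ _)) (simplex0 (push _ _)).
Qed.

Lemma arr_chain_continuous : continuous arr_chain.
Proof.
move=> e; apply: (@cvg_set_type _ _ _ (nbhs e)).
have c1 : (fun e' => (val (arr_chain e')).1) @ nbhs e --> (val (arr_chain e)).1.
  apply: cvg_ptws => i /=; case: (i == ord0).
    exact: (@lim_src_continuous A Q P e).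
  exact: (@lim_tgt_continuous A Q P e).
have c2 : (fun e' => (val (arr_chain e')).2) @ nbhs e --> (val (arr_chain e)).2.
  by apply: cvg_ptws => i; exact: cvg_id.
rewrite (_ : (fun e' => val (arr_chain e')) =
  (fun e' => ((val (arr_chain e')).1, (val (arr_chain e')).2))).
  by rewrite (surjective_pairing (val (arr_chain e))); exact: (cvg_pair c1 c2).
by apply/funext => e'; rewrite -surjective_pairing.
Qed.

Lemma edge_cell_continuous : continuous (@to_realization L R \o edge_cell).
Proof.
move=> y; apply: continuous_comp; last exact: to_realization_continuous.
have cc : continuous (fun y : lim_arr P * R => (arr_chain y.1,
    segment (push (lift ord_max) (vertex R)) (push (lift ord0) (vertex R)) y.2)).
  apply: continuous_pair => -[e u].
    by apply: (@continuous_comp _ _ _ fst arr_chain); [exact: cvg_fst|exact: arr_chain_continuous].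
  by apply: (@continuous_comp _ _ _ snd); [exact: cvg_snd|exact: segment_continuous].
by move=> V nV; exact: (cc y _ nV).
Qed.

(** Both vertices carry the label [id], which therefore fills [0,1]. So one chart and one coordinate
    serve all edges with trivial [coc], and every path through such edges is parallel. *)
Lemma edge_cell_maj y : coc y.1 = id -> maj (0, 1) (edge_cell y) id.
Proof.
move=> e1; split; first by split; rewrite /= ?ltr01.
rewrite /hmass /= (eq_bigl predT) => [|i]; last first.
  apply/asboolP; case: i => -[|[|i]] // i2 /=.
  by rewrite (coc_at_ord (arr_chain y.1) ord0) e1.
rewrite sum_wt_all ?ler01 //; first lra.
exact: (simplex_sum (segment (push (lift ord_max) (vertex R)) (push (lift ord0) (vertex R)) y.2)).
Qed.

Lemma edge_cell_eq y y' : coc y.1 = id -> coc y'.1 = id ->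
  to_realization (edge_cell y) = to_realization (edge_cell y') ->
  cell_frame (edge_cell y) = cell_frame (edge_cell y').
Proof.
move=> /edge_cell_maj m /edge_cell_maj m' E.
apply: (co_inj bundle (i := (0, 1))) => //; first by exists (edge_cell y), id.
by rewrite (coord_single (coord_cell m)) (coord_single (coord_cell m')).
Qed.

Lemma joined_edges (h : R -> lim_arr P * R) :
  {within J, continuous (@to_realization L R \o edge_cell \o h)} ->
  (forall s, J s -> coc (h s).1 = id) ->
  frames_joined (cell_frame (edge_cell (h 0))) (cell_frame (edge_cell (h 1))).
Proof.
move=> ch h1; exists (@to_realization L R \o edge_cell \o h), (cell_frame \o edge_cell \o h).
split=> // s0 /h1 /edge_cell_maj m; split=> //; exists (0, 1).
  by exists (edge_cell (h s0)), id.
near=> s => /h1 /edge_cell_maj m'.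
by rewrite (coord_single (coord_cell m)) (coord_single (coord_cell m')).
Unshelve. all: by end_near.
Qed.

(** The cylinder sets around [e] form a filter base that converges to [e] by [cvg_lim_arr], so each
    neighbourhood contains one of them. *)
Lemma nbhs_lim_arr (e : lim_arr P) V : nbhs e V -> exists K : nat, forall e' : lim_arr P,
  (forall j, (j < K)%N -> (val e').1 j = (val e).1 j /\ (val e').2 j = (val e).2 j) -> V e'.
Proof.
pose B K := [set e' : lim_arr P | forall j, (j < K)%N ->
  (val e').1 j = (val e).1 j /\ (val e').2 j = (val e).2 j].
have FF : Filter (filter_from setT B).
  apply: filter_from_filter; first by exists 0%N.
  move=> i j _ _; exists (maxn i j) => // e' eB; split=> m mi; apply: eB.
    by rewrite leq_max mi.
  by rewrite leq_max mi orbT.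
have /(_ V) : id @ filter_from setT B --> e.
  by apply: cvg_lim_arr => k; exists k.+1 => // e'; apply.
by move=> /[apply] -[K _ KV]; exists K.
Qed.

End Connected.

(** * Joining arbitrary objects and arbitrary frames *)

Section CantorPath.
Variables (R : realType) (A Q : finType) (P : automaton A Q).
Hypothesis Pinv : invertible P.
Hypothesis Psur : forall q', exists a q, trans P a q = q'.
Variable eps : Q.
Hypothesis run_eps : run P eps = id.
Hypothesis eps_connected : forall a b, Relation_Operators.clos_refl_trans A (eps_edge P eps) a b.

Local Notation G := (autgroup P).
Local Notation L := (limit_groupoid Pinv).
Local Notation X := (realization L R).
Local Notation frames_joined := (@frames_joined R A Q P Pinv).
Local Notation obj_frame := (@obj_frame R A Q P Pinv).
Local Notation J := (`[0, 1]%classic : set R).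

(* Surjectivity of the transition function extends a state to the left. *)
Lemma arrow_of_state a q : exists e : lim_arr P,
  [/\ lim_src e 0%N = a, lim_tgt e 0%N = out P a q & coc e = run P (trans P a q)].
Proof.
have [pre preP] : exists pre : Q -> A * Q, forall q, trans P (pre q).1 (pre q).2 = q.
  have ex q' : exists aq : A * Q, trans P aq.1 aq.2 = q'.
    by have [b [q1 E]] := Psur q'; exists (b, q1).
  by have [pre preP] := choice ex; exists pre.
pose st k := iter k (fun aq => pre aq.2) (a, q).
pose g q : autgroup_type P := exist (fun g => g \in G) (run P q) (mem_set (autgroup_gen P q)).
have eP : ((fun k => (st k).1), (fun k => g (st k).2)) \in @is_lim_arr A Q P.
  apply/mem_set; split=> [k|] /=.
    by rewrite /autgroup_fun /= (run_cons P _ _).2 preP.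
  apply: (@sub_finite_set _ _ (range g)); last exact: finite_image (@finite_finset Q setT).
  by move=> _ [k _ <-]; exists (st k).2.
exists (SigSub eP); split=> //.
by rewrite /coc /= /autgroup_fun /= (run_cons P _ _).2.
Qed.

Definition near_id (K : nat) (al : lim_obj A) (e : lim_arr P) : Prop :=
  forall j, (j < K)%N -> (val e).1 j = al j /\ (val e).2 j = Defs.ag_one P.

Lemma near_id_tgt K al e j : near_id K al e -> (j < K)%N -> lim_tgt e j = al j.
Proof. by move=> H jK; rewrite /lim_tgt (H j jK).1 (H j jK).2. Qed.

(** The state of the edge sits at index [k] and becomes the identity after one letter, so it acts
    trivially at all smaller indices. What lies at larger indices is chosen by [arrow_of_state]. *)
Lemma eps_arrow k (al : lim_obj A) b : eps_edge P eps (al k) b ->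
  exists e : lim_arr P, [/\ coc e = id, near_id k al e, lim_src e k = al k & lim_tgt e k = b].
Proof.
move=> [q [<- tq]]; elim: k al tq => [|k IH] al tq.
  have [e [e1 e2 e3]] := arrow_of_state (al 0%N) q.
  by exists e; split=> //; rewrite e3 tq.
have [e [e1 e2 e3 e4]] := IH (shift_obj al) tq.
exists (ext_arr (al 0%N) e); split.
- by rewrite coc_ext_arr e1 sect_id.
- move=> [|j] jk /=; last exact: e2.
  by split=> //; exact: autgroup_fun_inj.
- by rewrite src_ext_arr.
- by rewrite tgt_ext_arr.
Qed.

Definition eps_rel : rel A := fun a b => `[< eps_edge P eps a b >].

Lemma eps_path a b : exists2 l, path eps_rel a l & last a l = b.
Proof.
elim: (eps_connected a b) => {a b} [a b ab|a|a b c _ [l1 p1 l1E] _ [l2 p2 l2E]].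
- by exists [:: b] => //=; rewrite andbT; apply/asboolP.
- by exists [::].
- by exists (l1 ++ l2); rewrite ?cat_path ?last_cat l1E ?p1.
Qed.

(* The letters to the left of an edge of the graph of smoothness are not free,
   so that the two sides of the arrow over it recur one level further left. *)
Record config := Config {
  c_src : lim_obj A; c_tgt : lim_obj A; level : nat; c_path : seq A;
  c_agree : forall j, (j < level)%N -> c_src j = c_tgt j;
  c_pathP : path eps_rel (c_src level) c_path;
  c_last : last (c_src level) c_path = c_tgt level
}.

Lemma config_exists al be k : (forall j, (j < k)%N -> al j = be j) ->
  exists c, [/\ c_src c = al, c_tgt c = be & level c = k].
Proof.
by move=> H; have [l lP lE] := eps_path (al k) (be k); exists (Config H lP lE).
Qed.

(** The left side gains a level; the right side gains a level or has a shorter path. Hence levels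
    are unbounded along every branch of splittings. *)
Record split_of (c c1 c2 : config) (e : lim_arr P) : Prop := {
  split_src : c_src c1 = c_src c;
  split_tgt : c_tgt c2 = c_tgt c;
  split_e1 : c_tgt c1 = lim_src e;
  split_e2 : c_src c2 = lim_tgt e;
  split_coc : coc e = id;
  split_near : near_id (level c) (c_src c) e;
  split_level1 : level c1 = (level c).+1;
  split_level2 : level c2 = (level c).+1 \/
    level c2 = level c /\ (size (c_path c2) < size (c_path c))%N
}.

Lemma split_exists c : exists c1 c2 e, split_of c c1 c2 e.
Proof.
case: c => al be k [|b l] ag /= pP lE.
  (* The path is empty, so the letters at [k] agree too: the middle edge is constant and the right
     side goes on one level further left. *)
  have ag' j : (j < k.+1)%N -> al j = be j.
    by rewrite ltnS leq_eqVlt => /orP[/eqP ->|/ag].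
  have [c2 [s2 t2 l2]] := config_exists ag'.
  have [c1 [s1 t1 l1]] := @config_exists al al k.+1 (fun j _ => erefl).
  exists c1, c2, (Defs.lim_id P al); split=> //=; [exact: coc_id|by left].
(* The first step of the path gives the middle arrow. Its target has the letter [b] at index [k] and
   uncontrolled letters further left; the right side keeps the rest of the path. *)
have /andP[/asboolP ab pl] : path eps_rel (al k) (b :: l) := pP.
have [e [e1 e2 e3 e4]] := eps_arrow ab.
have ag1 j : (j < k.+1)%N -> al j = lim_src e j.
  by rewrite ltnS leq_eqVlt => /orP[/eqP -> //|/e2[E _]]; exact/esym.
have [c1 [s1 t1 l1]] := config_exists ag1.
have ag2 j : (j < k)%N -> lim_tgt e j = be j by move=> jk; rewrite (near_id_tgt e2) // ag.
have pl' : path eps_rel (lim_tgt e k) l by rewrite e4.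
have lE' : last (lim_tgt e k) l = be k by rewrite e4.
exists c1, (Config ag2 pl' lE'), e; split=> //.
by right; split=> //=.
Qed.

(** An instance of [ternary_path] whose values are points on edges with trivial [coc]: the path
    stays in the chart of [edge_cell_maj] with coordinate [id]. *)
Lemma joined_obj al be : frames_joined (obj_frame al) (obj_frame be).
Proof.
have [F FP] : exists F : config -> config * config * lim_arr P,
    forall c, split_of c (F c).1.1 (F c).1.2 (F c).2.
  have ex c : exists F : config * config * lim_arr P, split_of c F.1.1 F.1.2 F.2.
    by have [c1 [c2 [e H]]] := split_exists c; exists (c1, c2, e).
  by have [F FP] := choice ex; exists F.
pose hull c := [set y : lim_arr P * R | [/\ coc y.1 = id, near_id (level c) (c_src c) y.1 & J y.2]].
have [c [cs ct cl]] := @config_exists al be 0 (fun j (j0 : (j < 0)%N) => False_rect _ (notF j0)).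
have J0 : J 0 by rewrite /= in_itv /= lexx ler01.
have near_id_le K K' al1 al2 e : (K <= K')%N -> (forall j, (j < K)%N -> al1 j = al2 j) ->
    near_id K' al2 e -> near_id K al1 e.
  by move=> KK ag H j jK; have [-> ->] := H j (leq_trans jK KK); rewrite ag.
have src2 c' j : (j < level c')%N -> c_src (F c').1.2 j = c_src c' j.
  by move=> jk; rewrite (split_e2 (FP c')) (near_id_tgt (split_near (FP c'))).
have level2 c' : (level c' <= level (F c').1.2)%N.
  by case: (split_level2 (FP c')) => [->|[->]].
have lev1 c' : (level c' < level (F c').1.1)%N by rewrite (split_level1 (FP c')).
(* Along a branch the sources agree on longer and longer stretches, hence converge to an object
   [al0]. *)
have brP (b : nat -> config) :
    (forall n, b n.+1 = (F (b n)).1.1 \/ b n.+1 = (F (b n)).1.2) ->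
    exists al0, (forall n j, (j < level (b n))%N -> c_src (b n) j = al0 j) /\
      forall K, exists n, (K <= level (b n))%N.
  move=> bP.
  have bl n : (level (b n) <= level (b n.+1))%N.
    by case: (bP n) => ->; [exact: ltnW|exact: level2].
  have grow n : exists m, (level (b n) < level (b m))%N.
    have [m] := ubnP (size (c_path (b n))); elim: m n => // m IH n nm.
    case: (bP n) => E; first by exists n.+1; rewrite E.
    case: (split_level2 (FP (b n))) => [l2|[l2 sz]]; first by exists n.+1; rewrite E l2.
    have [|m' lm] := IH n.+1; first by rewrite E; exact: leq_trans sz nm.
    by exists m'; move: lm; rewrite {1}E l2.
  have unb K : exists n, (K <= level (b n))%N.
    elim: K => [|K [n Kn]]; first by exists 0%N.
    by have [m nm] := grow n; exists m; exact: leq_ltn_trans Kn nm.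
  have agS n j : (j < level (b n))%N -> c_src (b n.+1) j = c_src (b n) j.
    by move=> jn; case: (bP n) => ->; [rewrite (split_src (FP _))|exact: src2].
  have blD n d : (level (b n) <= level (b (d + n)))%N.
    by elim: d => // d IH; rewrite addSn; exact: leq_trans IH (bl _).
  have agD n d j : (j < level (b n))%N -> c_src (b (d + n)%N) j = c_src (b n) j.
    by move=> jn; elim: d => // d <-; rewrite addSn; apply: agS; exact: leq_trans jn (blD _ _).
  have [N NP] := choice unb.
  exists (fun j => c_src (b (N j.+1)) j); split; last exact: unb.
  move=> n j jn; have [le|/ltnW le] := leqP n (N j.+1).
    by rewrite -(subnK le) agD.
  by rewrite -(subnK le) agD //; exact: NP.
(* Only the identity arrow of [al0] survives in all hulls, and its whole edge is one point of the
   realization ([edge_cell_id]). *)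
have hull_id (b : nat -> config) al0 y : (forall n j, (j < level (b n))%N -> c_src (b n) j = al0 j) ->
    (forall K, exists n, (K <= level (b n))%N) -> (forall n, hull (b n) y) ->
    y.1 = Defs.lim_id P al0.
  move=> bag unb H.
  have E j : (val y.1).1 j = al0 j /\ (val y.1).2 j = Defs.ag_one P.
    have [n jn] := unb j.+1; have [_ H1 _] := H n.
    by have [-> ->] := H1 j jn; rewrite (bag n).
  apply: lim_arr_eq; apply/funext => j; [exact: (E j).1|exact: (E j).2].
have [h [ch hh h0 h1]] : exists h : R -> lim_arr P * R,
    [/\ {within J, continuous ((@to_realization L R \o @edge_cell R A Q P Pinv) \o h)},
     forall s, J s -> hull c (h s),
     to_realization (edge_cell Pinv (h 0)) = to_realization (edge_cell Pinv (Defs.lim_id P al, 0)) &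
     to_realization (edge_cell Pinv (h 1)) = to_realization (edge_cell Pinv (Defs.lim_id P be, 0))].
  rewrite -cs -ct.
  apply: (@ternary_path R X config (lim_arr P * R)%type
    (@to_realization L R \o @edge_cell R A Q P Pinv)
    (fun c => (Defs.lim_id P (c_src c), 0)) (fun c => (Defs.lim_id P (c_tgt c), 0))
    (fun c => (F c).1.1) (fun c => (F c).1.2) (fun c u => ((F c).2, u)) hull).
  - by move=> c'; rewrite (split_src (FP c')).
  - by move=> c'; rewrite (split_tgt (FP c')).
  - move=> c'; rewrite /= edge_cell_id (split_e1 (FP c')).
    exact/esym/(congr1 (@frame_pt R A Q P Pinv) (@edge_cell0 R A Q P Pinv _)).
  - move=> c'; rewrite /= edge_cell_id (split_e2 (FP c')).
    have := congr1 (@frame_pt R A Q P Pinv) (@edge_cell1 R A Q P Pinv (F c').2).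
    by rewrite frame_pt_act.
  - move=> c' u; apply: (@continuous_comp _ _ _ (pair (F c').2)).
      by apply: continuous_pair => u'; [exact: cvg_cst|exact: cvg_id].
    exact: edge_cell_continuous.
  - by move=> c'; split=> //; exact: coc_id.
  - move=> c'; split=> //; first exact: coc_id.
    by move=> j jc /=; rewrite c_agree.
  - move=> c' u Ju; split=> //; first exact: (split_coc (FP c')).
    exact: (split_near (FP c')).
  - move=> c' y [y1 y2 y3]; split=> //; apply: near_id_le y2; first exact: ltnW.
    by move=> j _; rewrite (split_src (FP c')).
  - move=> c' y [y1 y2 y3]; split=> //; apply: near_id_le y2; first exact: level2.
    by move=> j jc; rewrite src2.
  - move=> b /brP [al0 [bag unb]]; split.
      exists (Defs.lim_id P al0, 0) => n; split=> //; first exact: coc_id.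
      by move=> j jn; rewrite (bag n).
    move=> [e u] H; have := hull_id _ _ _ bag unb H => /= -> V nV.
    (* [V] contains the edge of the identity arrow for all parameters; compactness of [0,1] gives
       one depth [n0] that works for every [u]. *)
    have cJ : compact J by exact: segment_compact.
    move/compact_near_coveringP: cJ => /(_ nat \oo%classic
      (fun n u => forall e, near_id n al0 e -> V (to_realization (edge_cell Pinv (e, u))))).
    case=> [u1 _|n0 _ n0P].
      have nV1 : nbhs (to_realization (edge_cell Pinv (Defs.lim_id P al0, u1))) V.
        by move: nV; rewrite !edge_cell_id.
      have [[N1 N2] /= [/nbhs_lim_arr [K KN] n2] NV] := edge_cell_continuous nV1.
      exists (N2, [set n | (K <= n)%N]); first by split=> //; exists K.
      move=> [u2 n] /= [N2u Kn] e' ne; apply: (NV (e', u2)); split=> //.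
      apply: KN => j jK; exact: ne (leq_trans jK Kn).
    have [n nk] := unb n0; exists n => -[e' u'] [/= _ ne Ju].
    apply: (n0P _ nk _ Ju) => j jn; have [-> ->] := ne j jn.
    by rewrite (bag n).
  - move=> b /brP [al0 [bag unb]] [e u] [e' u'] H H'.
    have := hull_id _ _ _ bag unb H; have := hull_id _ _ _ bag unb H' => /= -> ->.
    by rewrite !edge_cell_id.
have J1 : J 1 by rewrite /= in_itv /= lexx ler01.
have := joined_edges ch (fun s Js => match hh s Js with And3 e1 _ _ => e1 end).
have [c0 _ _] := hh _ J0; have [c1 _ _] := hh _ J1.
rewrite (edge_cell_eq c0 (coc_id P al : coc (Defs.lim_id P al, 0).1 = id) h0).
rewrite (edge_cell_eq c1 (coc_id P be : coc (Defs.lim_id P be, 0).1 = id) h1).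
by rewrite !edge_cell0.
Qed.

(** Some arrow has [coc] equal to [run P q]. Going to its source, across it, and back from its
    target changes the frame only on the crossing. *)
Lemma joined_run al q : frames_joined (obj_frame al) (act (obj_frame al) (autgroup_gen P q)).
Proof.
have [a [q' E]] := Psur q; have [e [_ _ ce]] := arrow_of_state a q'.
apply: joined_trans (joined_obj al (lim_src e)) _.
apply: joined_trans (joined_arr R Pinv e) _.
rewrite (_ : act _ (cocG e) = act (obj_frame (lim_tgt e)) (autgroup_gen P q)).
  by apply: joined_act; exact: joined_obj.
by apply: val_inj; rewrite /= -/(coc e) ce E.
Qed.

Lemma all_frames_joined th th' : frames_joined th th'.
Proof.
have [al0 _] : exists al0 : lim_obj A, True.
  by have [b _] := framesP th; have [al _] := joined_obj_frame b; exists al.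
(* The [g] whose translate of the base frame is joined to it form a subgroup, because the action
   carries joining paths to joining paths; it contains the generators by [joined_run]. *)
have orbit g : G g -> forall th1, val th1 = val (obj_frame al0) \o g -> frames_joined (obj_frame al0) th1.
  elim=> {g} [|q|g h gG IHg hG IHh|g h gG IHg gK hK] th1 E.
  - have -> : th1 = obj_frame al0 by apply: val_inj; rewrite E.
    exact: joined_refl.
  - have -> : th1 = act (obj_frame al0) (autgroup_gen P q) by apply: val_inj; rewrite E.
    exact: joined_run.
  - have -> : th1 = act (act (obj_frame al0) gG) hG by apply: val_inj; rewrite E.
    apply: joined_trans (IHh (act (obj_frame al0) hG) erefl) _.
    by apply: joined_act; exact: IHg.
  - have hG := autgroupV gG gK hK; have -> : th1 = act (obj_frame al0) hG by apply: val_inj; rewrite E.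
    have E2 : act (act (obj_frame al0) gG) hG = obj_frame al0.
      by apply: val_inj; apply/funext => w /=; rewrite hK.
    apply: joined_sym; rewrite -{2}E2.
    by apply: joined_act; exact: IHg.
suff base th1 : frames_joined (obj_frame al0) th1.
  by apply: joined_trans (base th'); apply: joined_sym.
have [b [k [kG E]]] := framesP th1.
have -> : th1 = act (cell_frame b) kG by apply: val_inj; rewrite E.
have [al bal] := joined_obj_frame b.
apply: joined_trans (orbit k kG (act (obj_frame al0) kG) erefl) _.
apply: joined_act; apply: joined_trans (joined_obj al0 al) _.
exact: joined_sym.
Qed.

End CantorPath.

(** * Loops and their holonomy *)

Section Loops.
Variables (R : realType) (X : topologicalType) (x : X).

Local Notation J := (`[0, 1]%classic : set R).

Lemma represents_repr (c : pi1 R x) : represents c (val (pi1_repr c)).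
Proof.
exists (loopP (pi1_repr c)); rewrite -[RHS](@reprK _ {eq_quot (@loop_equiv R X x)} c).
by rewrite /pi1_class; congr (\pi_ _ _); exact: val_inj.
Qed.

Lemma pi1_classP p p' (pP : is_path p x x) (pP' : is_path p' x x) :
  pi1_class pP = pi1_class pP' <-> path_homotopic (R := R) x x p p'.
Proof. by split=> [/eqmodP/asboolP|H] //; apply/eqmodP/asboolP. Qed.

Lemma represents_homotopic (c : pi1 R x) p p' :
  represents c p -> represents c p' -> path_homotopic x x p p'.
Proof. by move=> [pP <-] [pP' /esym/pi1_classP]. Qed.

Lemma represents_path (c : pi1 R x) p : represents c p -> is_path p x x.
Proof. by case. Qed.

Lemma represents_eq (c : pi1 R x) p p' : (forall t, J t -> p t = p' t) ->
  represents c p -> represents c p'.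
Proof.
move=> pp [pP <-]; have [cp p0 p1] := pP.
have J0 : J 0 by rewrite /= in_itv /= lexx ler01.
have J1 : J 1 by rewrite /= in_itv /= lexx ler01.
have pP' : is_path p' x x.
  split; [|by rewrite -pp|by rewrite -pp].
  by apply: subspace_eq_continuous cp => t /set_mem; exact: pp.
exists pP'; apply/pi1_classP; split=> //.
have [_ _ [h [ch h01 hab]]] := path_homotopic_refl pP.
exists h; split=> // t t01; have [-> ->] := h01 _ t01.
by split=> //; exact: pp.
Qed.

End Loops.

Section Holonomy.
Variables (R : realType) (A Q : finType) (P : automaton A Q).
Hypothesis Pinv : invertible P.

Local Notation G := (autgroup P).
Local Notation L := (limit_groupoid Pinv).
Local Notation X := (realization L R).
Local Notation f := (@realization_map R L L (limit_shift Pinv)).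
Local Notation frames := (@frames R A Q P Pinv).
Local Notation bundle := (@frame_bundle R A Q P Pinv).
Local Notation par := (parallel (@frame_pt R A Q P Pinv)
  (@chart R A Q P Pinv) (@coord R A Q P Pinv)).
Local Notation J := (`[0, 1]%classic : set R).

Variables (x : X) (th : frames).
Hypothesis thx : frame_pt th = x.
Implicit Types (c d : pi1 R x) (p : R -> X).

Let J0 : J 0. Proof. by rewrite /= in_itv /= lexx ler01. Qed.
Let J1 : J 1. Proof. by rewrite /= in_itv /= lexx ler01. Qed.
Let iJ : is_interval J. Proof. exact: interval_is_interval. Qed.

Lemma transport_exists (p : R -> X) a b th0 : is_path p a b -> frame_pt th0 = a ->
  exists2 Th, par J p Th & Th 0 = th0.
Proof. by move=> [cp <- _] tha; exact: (parallel_exists bundle ler01 cp tha). Qed.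

Lemma transport_uniq (p : R -> X) a b Th Th' : is_path p a b ->
  par J p Th -> par J p Th' -> Th 0 = Th' 0 -> Th 1 = Th' 1.
Proof. by move=> [cp _ _] pT pT' E; exact: (parallel_uniq bundle iJ cp pT pT' J0 E J1). Qed.

Lemma transport_homotopic p p' Th Th' : path_homotopic x x p p' ->
  par J p Th -> par J p' Th' -> Th 0 = th -> Th' 0 = th -> Th 1 = Th' 1.
Proof.
move=> [pP pP' [h [ch h01 hab]]] pT pT' T0 T0'.
have hpath s : J s -> is_path (fun t => h (s, t)) x x.
  move=> Js; split; [|by have [] := hab _ Js|by have [] := hab _ Js].
  apply: (@within_comp R (R * R)%type X J (J `*` J) (pair s) h) => //.
  by apply: continuous_pair => t; [exact: cvg_cst|exact: cvg_id].
have [H HP] : exists H : R -> R -> frames, forall s, J s ->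
    par J (fun t => h (s, t)) (H s) /\ H s 0 = th.
  have ex s : exists H : R -> frames, J s -> par J (fun t => h (s, t)) H /\ H 0 = th.
    have [Js|nJ] := pselect (J s); last by exists (cst th).
    by have [H H1 H2] := transport_exists (hpath _ Js) thx; exists H.
  by have [H HP] := choice ex; exists H.
have E := parallel_homotopy bundle ch (fun s Js => (HP s Js).1) (fun s Js => (HP s Js).2)
  (fun s Js => (hab s Js).2) J0 J1.
have -> : Th 1 = H 0 1.
  apply: transport_uniq pP pT _ _; last by rewrite T0 (HP _ J0).2.
  by apply: parallel_eq (HP _ J0).1 => // t Jt; exact: (h01 _ Jt).1.
rewrite E; apply/esym; apply: transport_uniq pP' pT' _ _; last by rewrite T0' (HP _ J1).2.
by apply: parallel_eq (HP _ J1).1 => // t Jt; exact: (h01 _ Jt).2.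
Qed.

Lemma holonomy_exists (c : pi1 R x) : exists g, G g /\ forall p Th, represents c p ->
  par J p Th -> Th 0 = th -> val (Th 1) = val th \o g.
Proof.
have rc := represents_repr c; have pP := represents_path rc; have [cp p0 p1] := pP.
have [Th pT T0] := transport_exists pP thx.
have [|g [gG E]] := @act_trans R A Q P Pinv th (Th 1).
  by rewrite (pT _ J1).1 p1.
exists g; split=> // p Th' rp pT' T0'.
by rewrite -(transport_homotopic (represents_homotopic rc rp) pT pT' T0 T0') E.
Qed.

Definition hol (c : pi1 R x) : seq A -> seq A := projT1 (cid (holonomy_exists c)).

Lemma holG c : G (hol c).
Proof. by rewrite /hol; case: cid => g []. Qed.

Lemma hol_transport c p Th : represents c p -> par J p Th -> Th 0 = th ->
  Th 1 = act th (holG c).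
Proof.
move=> rp pT T0; apply: val_inj; rewrite /= /hol; case: cid => g [gG H] /=.
exact: H rp pT T0.
Qed.

Lemma hol_eq c p Th g (gG : G g) : represents c p -> par J p Th -> Th 0 = th ->
  Th 1 = act th gG -> hol c = g.
Proof. by move=> rp pT T0; rewrite (hol_transport rp pT T0) => /act_inj. Qed.

Lemma hol_path c p : represents c p ->
  exists Th, [/\ par J p Th, Th 0 = th & Th 1 = act th (holG c)].
Proof.
move=> rp; have [Th pT T0] := transport_exists (represents_path rp) thx.
by exists Th; split=> //; exact: hol_transport rp pT T0.
Qed.

Lemma hol1 : hol (pi1_one R x) = id.
Proof.
apply: (@hol_eq _ (cst x) (cst th) id (autgroup1 P)) => //.
- by exists (path_cst R x).
- move=> s _; split=> //; have [uv Uuv] := chart_cover bundle x; exists uv => //.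
  by near=> s'.
- exact: val_inj.
Unshelve. all: by end_near.
Qed.

(** Transport commutes with the right action: [d] carries the translate of [th] by [hol c] to the
    translate by [hol c] of its own end frame. Hence the reversed order. *)
Lemma hol_mul c d : hol (pi1_mul c d) = hol d \o hol c.
Proof.
have rc := represents_repr c; have rd := represents_repr d.
have [Tc [pc c0 c1]] := hol_path rc; have [Td [pd d0 d1]] := hol_path rd.
have pP := represents_path rc; have pP' := represents_path rd.
have [cp p0 p1] := pP; have [cp' p0' p1'] := pP'.
apply: (@hol_eq _ (path_cat (val (pi1_repr c)) (val (pi1_repr d)))
  (fun_cat Tc (fun s => act (Td s) (holG c))) _ (autgroupM (holG d) (holG c))).
- by exists (path_cat_is_path (loopP (pi1_repr c)) (loopP (pi1_repr d))).
- by apply: parallel_cat => //; [rewrite p1|exact: parallel_act|rewrite c1 d0].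
- by rewrite /fun_cat mulr0 invr_ge0 ler0n.
- rewrite /fun_cat ifF; last by apply/negbTE; rewrite -ltNge; lra.
  rewrite (_ : 2 * 1 - 1 = 1); last lra.
  by rewrite d1; exact: val_inj.
Qed.

Lemma hol_inv c : hol (pi1_inv c) \o hol c = id /\ hol c \o hol (pi1_inv c) = id.
Proof.
have rc := represents_repr c; have [Tc [pc c0 c1]] := hol_path rc.
have [h [hG gh hg]] := autgroup_inv Pinv (holG c).
suff -> : hol (pi1_inv c) = h by [].
apply: (@hol_eq _ (path_rev (val (pi1_repr c))) (fun s => act (Tc (1 - s)) hG) _ hG).
- by exists (path_rev_is_path (loopP (pi1_repr c))).
- by apply: parallel_act; exact: parallel_rev.
- by rewrite subr0 c1; apply: val_inj; rewrite /= -compA gh.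
- by rewrite subrr c0.
Qed.

Lemma hol_lift c w p : is_lift (iter (size w) f) c (val th w) p -> p 1 = val th (hol c w).
Proof.
move=> [[cp p0 _] rp]; have [Th [pT T0 T1]] := hol_path rp.
have [cfp _ _] := represents_path rp.
have := @parallel_lift R A Q P Pinv J _ p Th 0 w iJ cfp cp (fun _ _ => erefl) pT J0.
by rewrite T0 p0 => /(_ erefl _ J1) ->; rewrite T1.
Qed.

(** The point at [w] of the transported frame traces the lift. *)
Lemma lift_exists c w : exists p, is_lift (iter (size w) f) c (val th w) p.
Proof.
have rc := represents_repr c; have [Th [pT T0 T1]] := hol_path rc.
have [cp p0 p1] := represents_path rc.
exists (fun s => val (Th s) w); split.
  by split; [exact: parallel_continuous cp pT|rewrite T0|].
apply: represents_eq rc => t Jt; rewrite /= iter_frames.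
by rewrite (pT _ Jt).1.
Qed.

(** Every point of the n-th fibre is [val th w] for exactly one word [w] of length n, and the
    monodromy of [c] moves it to [val th (hol c w)]. *)
Lemma mono_kerP c : mono_ker f c <-> hol c = id.
Proof.
split=> [H|E n y].
  apply/funext => w; apply/esym; apply: (@frames_inj R A Q P Pinv th).
    by rewrite (autgroup_size _ (holG c)).
  have [|p lp p1] := H (size w) (val th w); first by rewrite iter_frames.
  by rewrite -(hol_lift lp).
move=> yx; have [|w <- ->] := @frames_surj R A Q P Pinv n y th; first by rewrite thx.
have [p lp] := lift_exists c w.
by exists p => //; rewrite (hol_lift lp) E.
Qed.

Lemma eq_mod_kerP c d : eq_mod_ker f c d <-> hol c = hol d.
Proof.
rewrite /eq_mod_ker mono_kerP hol_mul; have [E1 E2] := hol_inv c.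
split=> [E|<- //]; rewrite -[RHS]/(hol d \o id) -E1.
by rewrite -[RHS]/((hol d \o hol (pi1_inv c)) \o hol c) E.
Qed.

Lemma hol_onto g (gG : G g) : frames_joined th (act th gG) -> exists c, hol c = g.
Proof.
move=> [p [Th [cp pT T0 T1]]].
have pP : is_path p x x.
  split=> //; first by rewrite -(pT _ J0).1 T0.
  by rewrite -(pT _ J1).1 T1 frame_pt_act.
by exists (pi1_class pP); apply: (hol_eq (p := p) _ pT T0 T1); exists pP.
Qed.

(** Transport of [th] through the three pieces: the first ends in the tail at [a] translated by
    [ka]; along [p] the tail at [a] becomes the tail at [b] composed with the section of [hol c];
    the return along the path to [b] cancels [kb]. *)
Lemma hol_transported (l : X -> R -> X) a c p r (ka kb : seq A -> seq A) Ta Tb :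
  let b := letter (hol c) a in
  is_lift f c (val th [:: a]) p ->
  is_path (l (val th [:: a])) x (val th [:: a]) -> is_path (l (val th [:: b])) x (val th [:: b]) ->
  par J (l (val th [:: a])) Ta -> Ta 0 = th -> G ka -> val (Ta 1) = val th \o cons a \o ka ->
  par J (l (val th [:: b])) Tb -> Tb 0 = th -> G kb -> val (Tb 1) = val th \o cons b \o kb ->
  represents r (path_cat (path_cat (l (val th [:: a])) p) (path_rev (l (p 1)))) ->
  p 1 = val th [:: b] /\ kb \o hol r = sect (hol c) [:: a] \o ka.
Proof.
move=> b lp la lb pTa Ta0 kaG Ta1 pTb Tb0 kbG Tb1 rr.
have p1 : p 1 = val th [:: b].
  by rewrite (@hol_lift c [:: a] p lp) (letterE _ (autgroup_tree_hom (holG c))).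
split=> //; rewrite p1 in rr.
have [pP rp] := lp; have [cp p0 _] := pP.
have [Th [pT T0 T1]] := hol_path rp; have [cfp _ _] := represents_path rp.
have pTt := parallel_tail iJ cfp cp (fun _ _ => erefl) pT J0.
rewrite T0 in pTt; have {}pTt := pTt _ p0.
have [kb' [kbG' kk kk']] := autgroup_inv Pinv kbG.
(* The expected value of [hol r]: the asserted equation solved with the inverse [kb'] of [kb]. *)
have gG : G (kb' \o (sect (hol c) [:: a] \o ka)).
  by apply: autgroupM => //; apply: autgroupM => //; apply: autgroup_sect1; exact: holG.
pose T2 s := act (tail_frame a (Th s)) kaG.
have pT2 : par J p T2 by exact: parallel_act.
have T21 : val (T2 1) = val th \o cons b \o (sect (hol c) [:: a] \o ka).
  by apply/funext => w; rewrite /T2 T1 /= (autgroup_cons _ _ (holG c)).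
pose T3 s := act (Tb (1 - s)) gG.
have pT3 : par J (path_rev (l (val th [:: b]))) T3.
  by apply: parallel_act; exact: parallel_rev.
have T30 : T2 1 = T3 0.
  apply: val_inj; rewrite T21 /T3 /= subr0 Tb1.
  by rewrite -[RHS]/(val th \o cons b \o ((kb \o kb') \o (sect (hol c) [:: a] \o ka))) kk.
have [cla la0 la1] := la; have [clb lb0 lb1] := lb.
have lrev := path_rev_is_path lb; have [clr lr0 lr1] := lrev.
have lcat := path_cat_is_path la pP; have [clc lc0 lc1] := lcat.
have T12 : Ta 1 = T2 0 by apply: val_inj; rewrite Ta1 /T2 T0.
have pT12 : par J (path_cat (l (val th [:: a])) p) (fun_cat Ta T2).
  by apply: parallel_cat => //; rewrite la1 p0.
have end1 (T : Type) (u v : R -> T) : fun_cat u v 1 = v 1.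
  rewrite /fun_cat ifF; last by apply/negbTE; rewrite -ltNge; lra.
  by rewrite (_ : 2 * 1 - 1 = 1) //; lra.
have beg0 (T : Type) (u v : R -> T) : fun_cat u v 0 = u 0.
  by rewrite /fun_cat mulr0 invr_ge0 ler0n.
have pT123 : par J (path_cat (path_cat (l (val th [:: a])) p) (path_rev (l (val th [:: b]))))
    (fun_cat (fun_cat Ta T2) T3).
  by apply: parallel_cat => //; [rewrite lc1 lr0|rewrite end1].
rewrite (hol_eq (gG := gG) rr pT123); first by rewrite -[RHS]/(id \o _) -kk.
  by rewrite !beg0.
by rewrite end1 /T3 subrr Tb0.
Qed.

End Holonomy.

(** * Conjugating one automaton to another *)

Lemma run_cat (A A' Q : Type) (P : transducer A A' Q) q v w :
  run P q (v ++ w) = run P q v ++ run P (foldl (fun q a => trans P a q) q v) w.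
Proof. by elim: v q => //= a v IH q; rewrite IH. Qed.

Section Conjugation.
Variables (A Q : finType) (P : automaton A Q).
Hypotheses (Pinv : invertible P) (Pcon : contracting P).
Variables (A' S : Type) (M : automaton A' S) (u : A -> A') (v : A' -> A).
Hypotheses (uK : cancel u v) (vK : cancel v u).
Variables (k : A -> seq A -> seq A) (H : S -> seq A -> seq A).

Local Notation G := (autgroup P).

Hypotheses (kG : forall a, G (k a)) (HG : forall s, G (H s)).
Hypothesis out_conj : forall y s, v (out M y s) = letter (H s) (v y).
Hypothesis trans_conj : forall y s,
  k (letter (H s) (v y)) \o H (trans M y s) = sect (H s) [:: v y] \o k (v y).
Hypothesis H_gen : forall C : set (seq A -> seq A), C id -> (forall s, C (H s)) ->
  (forall g h, C g -> C h -> C (g \o h)) ->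
  (forall g h, C g -> h \o g = id -> g \o h = id -> C h) -> G `<=` C.

Fixpoint conjugator (w : seq A') : seq A :=
  if w is y :: w' then v y :: k (v y) (conjugator w') else [::].

(** [trans_conj] is what carries the intertwining past the first letter. *)
Lemma conjugator_run s w : conjugator (run M s w) = H s (conjugator w).
Proof.
elim: w s => [|y w IH] s /=; first by rewrite (autgroup_nil (HG s)).
rewrite (autgroup_cons _ _ (HG s)) out_conj IH; congr cons.
exact: (congr1 (@^~ (conjugator w)) (trans_conj y s)).
Qed.

Lemma conjugator_inj : injective conjugator.
Proof.
elim=> [|y w IH] [|y' w'] //= [/(can_inj vK) <-].
by move=> /(autgroup_inj Pinv (kG _))/IH ->.
Qed.

(** [phi] is run by an automaton whose states form a finite set containing [id] and closed under
    twisting with the inverses of the [k a]. Generation of [G] by the [H s] enters as the induction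
    principle [H_gen]. *)
Lemma conjugate_automaton_equiv : automaton_equiv P M.
Proof.
have [ki kiP] : exists ki : A -> seq A -> seq A, forall a, G (ki a) /\ k a \o ki a = id.
  have ex a : exists h, G h /\ k a \o h = id.
    by have [h [hG kh _]] := autgroup_inv Pinv (kG a); exists h.
  by have [ki kiP] := choice ex; exists ki.
have [F [/finite_seqP[F' FE] FG F1 FS]] := twist_finite Pcon (fun a => (kiP a).1).
have FP (g : seq_sub F') : F (val g) by rewrite FE /=; exact: valP.
have inF g : F g -> g \in F' by rewrite FE.
pose T' : transducer A A' (seq_sub F') := Transducer
  (fun a g => u (letter (val g) a)) (fun a g => SeqSub (inF _ (FS _ a (FP g)))).
pose s0 : seq_sub F' := SeqSub (inF _ F1).
pose phi := run T' s0.
(* The state [g] thus acts as [phi \o g]: for [id] this makes [phi] the inverse of [conjugator], and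
   in general it gives the required form of the states of [phi]. *)
have psi_T g w : conjugator (run T' g w) = val g w.
  elim: w g => [|a w IH] g /=; first by rewrite (autgroup_nil (FG _ (FP g))).
  rewrite (autgroup_cons _ _ (FG _ (FP g))) IH uK; congr cons.
  exact: (congr1 (@^~ (sect (val g) [:: a] w)) (kiP (letter (val g) a)).2).
have phiK : cancel phi conjugator by exact: psi_T.
have psiK : cancel conjugator phi by move=> w; apply: conjugator_inj; rewrite phiK.
have runE s : phi \o H s \o conjugator = run M s.
  by apply/funext => w; rewrite /= -conjugator_run psiK.
split.
  rewrite (_ : [set: A'] = range u); last by apply/seteqP; split=> y // _; exists (v y).
  by rewrite card_eq_sym inj_card_eq // => a b _ _; exact: can_inj uK _ _.
exists phi, conjugator; split=> //; first exact: tree_hom_run.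
  by exists (seq_sub F'), T', s0.
split=> [st [w1 [w2 [sz E]]]|].
  pose g := foldl (fun q a => trans T' a q) s0 w1; exists (val g); first exact: FG (FP g).
  apply/funext => w; apply: conjugator_inj; rewrite /= phiK -psi_T; congr conjugator.
  have := congr1 (drop (size w2)) (E w); rewrite drop_size_cat // => <-.
  rewrite /phi run_cat drop_size_cat // sz; exact: (tree_hom_run T' s0).1.
apply/seteqP; split=> [_ [g gG <-]|h].
  apply: (H_gen (C := fun g => autgroup M (phi \o g \o conjugator))) gG.
  - rewrite (_ : phi \o id \o conjugator = id); first exact: autgroup1.
    by apply/funext => w; exact: psiK.
  - by move=> s; rewrite runE; exact: autgroup_gen.
  - move=> g1 g2 H1 H2; have := autgroupM H1 H2; congr autgroup.
    by apply/funext => w; rewrite /= phiK.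
  - move=> g1 g2 H1 g21 g12; apply: autgroupV H1 _ _ => w /=; rewrite phiK.
      by rewrite -[g2 _]/((g2 \o g1) (conjugator w)) g21 psiK.
    by rewrite -[g1 _]/((g1 \o g2) (conjugator w)) g12 psiK.
elim=> {h} [|s|g h _ [g' gG' <-] _ [h' hG' <-]|g h _ [g' gG' <-] gK hK].
- by exists id; [exact: autgroup1|apply/funext => w; exact: psiK].
- by exists (H s).
- exists (g' \o h'); first exact: autgroupM.
  by apply/funext => w; rewrite /= phiK.
- have [h' [hG' gh hg]] := autgroup_inv Pinv gG'; exists h' => //.
  apply/funext => w; rewrite -[LHS]gK; congr h.
  by rewrite /= phiK -[g' _]/((g' \o h') (conjugator w)) gh psiK.
Qed.

End Conjugation.

(** * Labels of the fibre and connecting paths *)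

Section Letters.
Variables (R : realType) (A Q : finType) (P : automaton A Q).
Hypothesis Pinv : invertible P.

Local Notation G := (autgroup P).
Local Notation L := (limit_groupoid Pinv).
Local Notation X := (realization L R).
Local Notation f := (@realization_map R L L (limit_shift Pinv)).
Local Notation frames := (@frames R A Q P Pinv).
Local Notation par := (parallel (@frame_pt R A Q P Pinv)
  (@chart R A Q P Pinv) (@coord R A Q P Pinv)).
Local Notation J := (`[0, 1]%classic : set R).

Variables (x : X) (th : frames).
Hypothesis thx : frame_pt th = x.

Local Notation A' := (set_type (f @^-1` [set x])).

Lemma fibre_subproof a : val th [:: a] \in f @^-1` [set x].
Proof. by apply/mem_set; rewrite /= -[f _]/(iter (size [:: a]) f _) iter_frames. Qed.

Definition fibre_pt a : A' := SigSub (fibre_subproof a).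

Lemma fibre_pt_inj : injective fibre_pt.
Proof. by move=> a b /(congr1 val) /= /frames_inj => /(_ erefl) []. Qed.

Lemma fibre_pt_surj (y : A') : exists a, fibre_pt a = y.
Proof.
have fy : f (val y) = x := set_mem (valP y).
have [|[|a []] // _ yE] := @frames_surj R A Q P Pinv 1 (val y) th; first by rewrite thx.
by exists a; apply: val_inj.
Qed.

Definition letter_of (y : A') : A := projT1 (cid (fibre_pt_surj y)).

Lemma fibre_ptK y : fibre_pt (letter_of y) = y.
Proof. by rewrite /letter_of; case: cid. Qed.

Lemma letter_ofK a : letter_of (fibre_pt a) = a.
Proof. by apply: fibre_pt_inj; rewrite fibre_ptK. Qed.

Lemma fibre_pt_bij : bijective fibre_pt.
Proof. by exists letter_of; [exact: letter_ofK|exact: fibre_ptK]. Qed.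

(** The transported frame and the tail of [th] at [a] lie over the same point, and the group is
    transitive on the frames over a point; [k a] is their difference. *)
Lemma connecting_paths (l : X -> R -> X) : (forall y, f y = x -> is_path (l y) x y) ->
  exists (k : A -> seq A -> seq A) (T : A -> R -> frames), forall a,
    [/\ G (k a), par J (l (val th [:: a])) (T a), T a 0 = th &
        val (T a 1) = val th \o cons a \o k a].
Proof.
move=> lP.
suff ex a : exists kT : (seq A -> seq A) * (R -> frames), [/\ G kT.1,
    par J (l (val th [:: a])) kT.2, kT.2 0 = th & val (kT.2 1) = val th \o cons a \o kT.1].
  by have [F FP] := choice ex; exists (fun a => (F a).1), (fun a => (F a).2).
have la : is_path (l (val th [:: a])) x (val th [:: a]).
  exact: lP (set_mem (valP (fibre_pt a))).
have [_ _ l1] := la.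
have [T pT T0] := @transport_exists R A Q P Pinv _ _ _ th la thx.
have J1 : J 1 by rewrite /= in_itv /= lexx ler01.
have [|g [gG E]] := @act_trans R A Q P Pinv (tail_frame a th) (T 1).
  by rewrite (pT _ J1).1 l1.
by exists (g, T); split=> //; rewrite /= E.
Qed.

End Letters.

(** * Equivalence for arbitrary data *)

Section Equivalent.
Variables (R : realType) (A Q : finType) (P : automaton A Q).
Hypothesis Pinv : invertible P.
Hypothesis Pcon : contracting P.

Local Notation G := (autgroup P).
Local Notation L := (limit_groupoid Pinv).
Local Notation X := (realization L R).
Local Notation f := (@realization_map R L L (limit_shift Pinv)).
Local Notation frames := (@frames R A Q P Pinv).

Hypothesis joined : forall th th' : frames, frames_joined th th'.

Variables (x : X) (l : X -> R -> X) (S : set (pi1 R x)).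
Variable M : automaton (set_type (f @^-1` [set x])) (set_type S).
Hypothesis cd : covering_data f l S.
Hypothesis cM : is_covering_automaton l M.

Local Notation A' := (set_type (f @^-1` [set x])).

Lemma covering_automaton_equiv : automaton_equiv P M.
Proof.
have [th thx] := @frame_exists R A Q P Pinv x.
have lP := cd_path cd; have [k [T kT]] := connecting_paths thx lP.
have kG a : G (k a) by case: (kT a).
pose v := letter_of thx; pose u := fibre_pt thx.
have lu a : is_path (l (val th [:: a])) x (val th [:: a]).
  exact: lP (set_mem (valP (u a))).
have step (y : A') s : v (out M y s) = letter (hol thx (val s)) (v y) /\
    k (letter (hol thx (val s)) (v y)) \o hol thx (val (trans M y s)) =
    sect (hol thx (val s)) [:: v y] \o k (v y).
  have [p lp [op [r rr rs]]] := cM y s.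
  set a := v y; set b := letter _ a.
  have ya : val y = val th [:: a] by rewrite -[in LHS](fibre_ptK thx y).
  rewrite ya in lp rr.
  have [_ pTa Ta0 Ta1] := kT a; have [_ pTb Tb0 Tb1] := kT b.
  have [p1 E] := @hol_transported R A Q P Pinv x th thx l a (val s) p r (k a) (k b) (T a) (T b)
    lp (lu a) (lu b) pTa Ta0 (kG a) Ta1 pTb Tb0 (kG b) Tb1 rr.
  move/(eq_mod_kerP thx): rs => <-; split=> //.
  by rewrite -(letter_ofK thx b); congr letter_of; apply: val_inj; rewrite op.
(* The holonomy is onto and its kernel is the monodromy kernel, modulo which [S] generates; so the
   holonomies of [S] generate [G]. *)
have gen (C : set (seq A -> seq A)) : C id -> (forall s : set_type S, C (hol thx (val s))) ->
    (forall g h, C g -> C h -> C (g \o h)) ->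
    (forall g h, C g -> h \o g = id -> g \o h = id -> C h) -> G `<=` C.
  move=> C1 Cs CM CV g gG.
  have [c cg] : exists c, hol thx c = g.
    exact: (@hol_onto R A Q P Pinv x th thx g gG (joined _ _)).
  have [c' gen /(eq_mod_kerP thx)] := cd_gen cd c; rewrite cg => <-.
  elim: gen => {c' c cg} [|c Sc|c d _ IHc _ IHd|c _ IHc].
  - by rewrite hol1.
  - exact: (Cs (SigSub (mem_set Sc))).
  - by rewrite hol_mul; exact: CM.
  - by have [E1 E2] := hol_inv thx c; exact: CV E1 E2.
exact: (@conjugate_automaton_equiv A Q P Pinv Pcon A' (set_type S) M u v
  (letter_ofK thx) (fibre_ptK thx) k (fun s => hol thx (val s)) kG (fun s => holG thx (val s))
  (fun y s => (step y s).1) (fun y s => (step y s).2) gen).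
Qed.

End Equivalent.

(** * Data that reproduce the automaton *)

Section Realized.
Variables (R : realType) (A Q : finType) (P : automaton A Q).
Hypothesis Pinv : invertible P.
Hypothesis run_inj : injective (run P).

Local Notation G := (autgroup P).
Local Notation L := (limit_groupoid Pinv).
Local Notation X := (realization L R).
Local Notation f := (@realization_map R L L (limit_shift Pinv)).
Local Notation frames := (@frames R A Q P Pinv).
Local Notation par := (parallel (@frame_pt R A Q P Pinv)
  (@chart R A Q P Pinv) (@coord R A Q P Pinv)).
Local Notation J := (`[0, 1]%classic : set R).

Hypothesis joined : forall th th' : frames, frames_joined th th'.

(** The paths [l] are chosen to transport [th] exactly to its tail frames, so all comparison
    elements are [id] and [hol_transported] returns the transitions of [P]. The loops [s q] have
    holonomy [run P q] and are distinct since [run P] is injective. *)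
Lemma automaton_realized (th : frames) :
  exists (x : X) (l : X -> R -> X) (S : set (pi1 R x))
      (M : automaton (set_type (f @^-1` [set x])) (set_type S)),
     [/\ covering_data f l S, is_covering_automaton l M &
         automaton_iso P M].
Proof.
exists (frame_pt th); set x := frame_pt th; pose thx : frame_pt th = x := erefl.
pose u := fibre_pt thx; pose v := letter_of thx.
have [w wP] : exists w : A -> (R -> X) * (R -> frames), forall a,
    [/\ {within J, continuous (w a).1}, par J (w a).1 (w a).2, (w a).2 0 = th &
        (w a).2 1 = tail_frame a th].
  have ex a : exists w : (R -> X) * (R -> frames), [/\ {within J, continuous w.1},
      par J w.1 w.2, w.2 0 = th & w.2 1 = tail_frame a th].
    by have [p [T H]] := joined th (tail_frame a th); exists (p, T).
  by have [w wP] := choice ex; exists w.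
(* The labelling is inverted on the fibre; [option] lets [l] be defined on all of [X], with nothing
   prescribed off the fibre. *)
have [v' vP] : exists v' : X -> option A,
    forall y, f y = x -> exists2 a, v' y = Some a & val th [:: a] = y.
  have ex y : exists o : option A, f y = x -> exists2 a, o = Some a & val th [:: a] = y.
    have [fy|nfy] := pselect (f y = x); last by exists None.
    have [a E] := fibre_pt_surj thx (SigSub (mem_set fy : y \in f @^-1` [set x])).
    by exists (Some a) => _; exists a => //; rewrite -[RHS](congr1 val E).
  by have [v' vP] := choice ex; exists v'.
pose l y := if v' y is Some a then (w a).1 else cst x.
have fth a : f (val th [:: a]) = x := set_mem (valP (u a)).
have lE a : l (val th [:: a]) = (w a).1.
  rewrite /l; have [b -> E] := vP _ (fth a).
  by have /frames_inj-/(_ erefl)[->] := E.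
have J0 : J 0 by rewrite /= in_itv /= lexx ler01.
have J1 : J 1 by rewrite /= in_itv /= lexx ler01.
have lP a : is_path (l (val th [:: a])) x (val th [:: a]).
  have [cw pw w0 w1] := wP a; rewrite lE; split=> //.
    by rewrite -(pw _ J0).1 w0.
  by rewrite -(pw _ J1).1 w1.
have [s sP] : exists s : Q -> pi1 R x, forall q, hol thx (s q) = run P q.
  have ex q : exists c, hol thx c = run P q.
    exact: (hol_onto thx (gG := autgroup_gen P q) (joined _ _)).
  by have [s sP] := choice ex; exists s.
have s_inj : injective s by move=> q q' /(congr1 (hol thx)); rewrite !sP; exact: run_inj.
pose S := range s.
have sS q : s q \in S by apply/mem_set; exists q.
pose v2 q : set_type S := SigSub (sS q).
have [q_of qP] : exists q_of : set_type S -> Q, cancel q_of v2.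
  have ex (c : set_type S) : exists q, v2 q = c.
    by have [q _ E] := set_mem (valP c); exists q; apply: val_inj.
  by have [q_of qP] := choice ex; exists q_of.
have qK : cancel v2 q_of by move=> q; apply: s_inj; exact: (congr1 val (qP (v2 q))).
pose M : automaton (set_type (f @^-1` [set x])) (set_type S) := Transducer
  (fun y c => u (out P (v y) (q_of c))) (fun y c => v2 (trans P (v y) (q_of c))).
have lift a q : exists2 p, is_lift f (s q) (val th [:: a]) p &
    p 1 = val th [:: out P a q] /\ transported_to f l (val th [:: a]) p (s (trans P a q)).
  have [p lp] := lift_exists thx (s q) [:: a]; exists p => //.
  have p1 : p 1 = val th [:: out P a q].
    by rewrite (@hol_lift R A Q P Pinv x th thx (s q) [:: a] p lp) sP.
  split=> //.
  have rP : is_path (path_cat (path_cat (l (val th [:: a])) p) (path_rev (l (p 1)))) x x.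
    apply: path_cat_is_path; first exact: path_cat_is_path (lP a) lp.1.
    by apply: path_rev_is_path; rewrite p1; exact: lP.
  exists (pi1_class rP); first by exists rP.
  apply/(eq_mod_kerP thx); rewrite sP.
  have [_ pa wa0 wa1] := wP a; have [_ pb wb0 wb1] := wP (letter (hol thx (s q)) a).
  rewrite -lE in pa; rewrite -lE in pb.
  have wa1' : val ((w a).2 1) = val th \o cons a \o id by rewrite wa1.
  have wb1' : val ((w (letter (hol thx (s q)) a)).2 1) =
    val th \o cons (letter (hol thx (s q)) a) \o id by rewrite wb1.
  have [_ E] := hol_transported lp (lP _) (lP _) pa wa0 (autgroup1 P) wa1'
    pb wb0 (autgroup1 P) wb1' (ex_intro _ rP erefl).
  by rewrite -[LHS]/(id \o _) E sP (run_cons P q a).2.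
exists l, S, M; split.
- split.
  + by move=> y fy; have [a _ <-] := vP y fy; exact: lP.
  + move=> c; suff gen g : G g -> exists2 c', pi1_gen S c' & hol thx c' = g.
      by have [c' H E] := gen _ (holG thx c); exists c' => //; apply/(eq_mod_kerP thx).
    elim=> {g} [|q|g h _ [c1 H1 <-] _ [c2 H2 <-]|g h _ [c1 H1 <-] gK hK].
    * by exists (pi1_one R x); [exact: pi1_gen1|exact: hol1].
    * by exists (s q) => //; apply: pi1_gen_in; exists q.
    (* The factors are swapped because [hol] reverses products. *)
    * by exists (pi1_mul c2 c1); [exact: pi1_genM|exact: hol_mul].
    * exists (pi1_inv c1); first exact: pi1_genV.
      have [E1 E2] := hol_inv thx c1; apply/funext => y.
      by rewrite -{1}[y]hK; exact: (congr1 (@^~ (h y)) E1).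
  + move=> y _ fy [q _ <-]; have [a _ <-] := vP y fy.
    have [p lp [p1 tp]] := lift a q; exists p => //.
    by exists (s (trans P a q)) => //; exists (trans P a q).
- move=> y c; have [p lp [p1 tp]] := lift (v y) (q_of c).
  have yE : val y = val th [:: v y] by rewrite -[in LHS](fibre_ptK thx y).
  have cE : val c = s (q_of c) by rewrite -[in LHS](qP c).
  by exists p; [rewrite yE cE|rewrite yE; split; rewrite ?p1].
- exists u, v2; split; [exact: fibre_pt_bij|by exists q_of|].
  move=> a q; have ua := letter_ofK thx a; split.
    exact: (f_equal2 (fun a q => u (out P a q)) ua (qK q)).
  exact: (f_equal2 (fun a q => v2 (trans P a q)) ua (qK q)).
Qed.

End Realized.

Theorem theorem6p7 (R : realType) (A Q : finType) (P : automaton A Q)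
    (Pinv : invertible P) (Pnuc : nuclear P) (Psmooth : smooth P) :
  let X : topologicalType := realization (limit_groupoid Pinv) R in
  let f : X -> X := @realization_map R _ _ (limit_shift Pinv) in
  (forall (x : X) (l : X -> R -> X) (S : set (pi1 R x))
      (M : automaton (set_type (f @^-1` [set x])) (set_type S)),
     covering_data f l S -> is_covering_automaton l M ->
     automaton_equiv P M) /\
  (exists (x : X) (l : X -> R -> X) (S : set (pi1 R x))
      (M : automaton (set_type (f @^-1` [set x])) (set_type S)),
     [/\ covering_data f l S, is_covering_automaton l M &
         automaton_iso P M]).
Proof.
have [Pcon [_ run_inj _]] := Pnuc; have [Psur [eps [run_eps eps_conn]]] := Psmooth.
have joined := @all_frames_joined R A Q P Pinv Psur eps run_eps eps_conn.
move=> X f; split=> [x l S M cd cM|].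
  exact: (@covering_automaton_equiv R A Q P Pinv Pcon joined x l S M cd cM).
(* Surjectivity onto [eps] supplies a letter, hence a constant object and a base frame. *)
have [a [q _]] := Psur eps.
apply: (automaton_realized _ joined (obj_frame R Pinv (fun=> a))) => q1 q2.
by apply: run_inj; rewrite inE.
Qed.
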